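(* Let $\mathbb{D}=\{z\in\mathbb{C}:|z|<1\}$ and let $h:\mathbb{D}\rightarrow\mathbb{C}$ be a holomorphic univalent map. Then there exists $c>0$ such that every harmonic mapping $f=h+\overline{g}$ (with $g$ holomorphic in $\mathbb{D}$) whose dilatation $\omega=g'/h'$ satisfies $|\omega(z)|<c$ for all $z\in\mathbb{D}$ is univalent in $\mathbb{D}$ if and only if $h(\mathbb{D})$ is a linearly connected domain.
   Context: Univalent means injective. A planar harmonic mapping is a complex-valued harmonic function on a domain in $\mathbb{C}$; on a simply connected domain such as $\mathbb{D}$ it can be written $f=h+\overline{g}$ with $h,g$ holomorphic. Its dilatation is $\omega=g'/h'$. A domain $\Omega\subset\mathbb{C}$ is linearly connected if there exists a constant $M<\infty$ such that any two points $w_1,w_2\in\Omega$ are joined by a path $\gamma\subset\Omega$ of length $l(\gamma)\le M|w_1-w_2|$. *)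

(* Defs.v *)
(* Stdlib reals with the complex numbers of Coquelicot. *)
From Stdlib Require Import Reals.
From Coquelicot Require Import Coquelicot.

Open Scope R_scope.

Definition unit_disk (z : C) : Prop := Cmod z < 1.

(* [ex_derive] is taken over [C_AbsRing]: complex differentiability.  Functions
   are total on [C]; on an open set [A] only their values on [A] matter. *)
Definition holomorphic_on (A : C -> Prop) (f : C -> C) : Prop :=
  forall z : C, A z -> ex_derive (K := C_AbsRing) (V := C_NormedModule) f z.

Definition univalent_on (A : C -> Prop) (f : C -> C) : Prop :=
  forall z1 z2 : C, A z1 -> A z2 -> f z1 = f z2 -> z1 = z2.

Definition image (A : C -> Prop) (f : C -> C) (w : C) : Prop :=
  exists z : C, A z /\ f z = w.

Definition harmonic_mapping (h g : C -> C) (z : C) : C :=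
  (h z + Cconj (g z))%C.

(* The quotient uses the convention x / 0 = 0; when [h] is holomorphic and
   univalent its derivative has no zeros, so that case does not arise. *)
Definition dilatation (h g : C -> C) (z : C) : C :=
  (C_derive g z / C_derive h z)%C.

(* For an open set, separations by relatively open sets are separations by
   open sets of the plane. *)
Definition domain (Omega : C -> Prop) : Prop :=
  open Omega /\
  (exists w : C, Omega w) /\
  (forall U V : C -> Prop, open U -> open V ->
     (forall w : C, Omega w -> U w \/ V w) ->
     (exists w : C, Omega w /\ U w) ->
     (exists w : C, Omega w /\ V w) ->
     exists w : C, Omega w /\ U w /\ V w).

Definition unit_interval (t : R) : Prop := 0 <= t <= 1.

Definition path_in (Omega : C -> Prop) (gamma : R -> C) (w1 w2 : C) : Prop :=
  continuous_on unit_interval gamma /\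
  (forall t : R, unit_interval t -> Omega (gamma t)) /\
  gamma 0 = w1 /\ gamma 1 = w2.

(* Lengths of the polygons inscribed at 0 = t 0 <= t 1 <= ... <= t (S n) = 1;
   [sum_n] has n + 1 terms. *)
Definition inscribed_length (gamma : R -> C) (l : R) : Prop :=
  exists (n : nat) (t : nat -> R),
    t 0%nat = 0 /\ t (S n) = 1 /\
    (forall i : nat, (i <= n)%nat -> t i <= t (S i)) /\
    l = sum_n (fun i : nat => Cmod (gamma (t (S i)) - gamma (t i))%C) n.

(* Equal to [p_infty] for a path that is not rectifiable. *)
Definition path_length (gamma : R -> C) : Rbar :=
  Lub_Rbar (inscribed_length gamma).

Definition linearly_connected_domain (Omega : C -> Prop) : Prop :=
  domain Omega /\
  exists M : R, forall w1 w2 : C, Omega w1 -> Omega w2 ->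
    exists gamma : R -> C,
      path_in Omega gamma w1 w2 /\
      Rbar_le (path_length gamma) (Finite (M * Cmod (w1 - w2)%C)).

(* Main.v *)
Require Import Defs.
From Stdlib Require Import Reals Lra Lia Classical ClassicalEpsilon.
From Coquelicot Require Import Coquelicot.
Open Scope R_scope.

(** Put Omega = h(D).

    Suppose first that Omega is linearly connected with constant M. If
    h + conj g takes the same value at z1 and z2, then
    |g(z1) - g(z2)| = |h(z1) - h(z2)|. The function g o h^-1 has derivative
    g'/h' o h^-1, of modulus below c, so near each point it stretches distances by a factor of at
    most 2c; applied to a path in Omega of length at most M |h(z1) - h(z2)| this gives
    |g(z1) - g(z2)| <= 2cM |h(z1) - h(z2)|, which for 2cM < 1 forces z1 = z2.
    Two classical facts about univalent functions are behind the differentiation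
    of g o h^-1: the inverse is continuous ([univalent_inverse_continuous]) and
    h' has no zeros ([univalent_derive_neq0]). The length estimate along a path
    that is only continuous is [dominated_end].

    Conversely, suppose that all g with |g'/h'| < c give univalent mappings. If
    |omega| <= 1 and G' = omega h', then multiplying G by a constant of modulus
    below c shows that
      |G(a) - G(b)| <= (1/c) |h(a) - h(b)|   for all a, b,              ( * )
    because otherwise a multiple of G would identify a and b
    ([variation_of_univalence]). The image under h of the hyperbolic geodesic
    from z1 to z2 is then a short path from h(z1) to h(z2). Property ( * ) is
    invariant under Moebius maps, so the disk may be replaced by the right half
    plane, with z1, z2 at the points 1 and R of the positive axis
    ([two_point_normalization]); write H for the transferred function. It is
    enough to find a bounded holomorphic omega with
      Re (omega(x) H'(x)) >= kappa |H'(x)|   for 1 <= x <= R,           ( ** )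
    with kappa and the bound of omega independent of R: then |H'| <= (Re G)'/kappa
    on the axis, so the length of H([1,R]) is at most (Re G(R) - Re G(1))/kappa,
    which ( * ) bounds by a multiple of |H(1) - H(R)| ([axis_variation]).

    To get ( ** ) one averages the unimodular function u = conj H' / |H'| of the
    axis against holomorphic kernels. Let F_n be the primitive of (1 - v^2)^n and
    V_y(z) = (z - y)/(z + y). For points y_k running through the axis,
      omega(z) = sum_k u(y_k) (F_n(V_(y_k)(z)) - F_n(V_(y_(k+1))(z)))
    is bounded on the half plane whatever the number of points, since the total
    variation of y |-> V_y(z) is bounded by a telescoping sum
    ([Cmod_multiplier_le]). On the axis the increments of F_n are positive and, for
    large n, concentrated where V_y(x) is near 0, that is, where y/x is near 1
    ([multiplier_axis]). So ( ** ) only requires that u vary slowly with respect to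
    log x. This too follows from ( * ): with omega(z) = (z - y)/(z + y), the
    function Q = (G - G(y))/(H - H(y)) is holomorphic and bounded, so Cauchy's
    estimate bounds Q''(y), and expanding at y expresses H''(y)/H'(y) through Q''(y);
    the outcome is |H''(y)/H'(y)| <= P/y ([pre_schwarzian_bound]).

    The complex analysis on the way (Goursat's theorem, primitives, Cauchy's
    formula, differentiability of the derivative, Cauchy estimates) is developed
    for squares with sides parallel to the axes. The integral of 1/(z - a) over
    the boundary of a square is only bounded below, not evaluated; the price is a
    factor 2 in the maximum principle [center_bound], which is harmless here. *)

(** * Complex derivatives and continuity *)

(** Differentiability of a map C -> C written with [Cmod] on both sides: [is_derive]
    uses different uniform structures on its source and its target, and
    [is_derive_cdiff] is the only place where the two have to be reconciled. *)
Definition cdiff (f : C -> C) (z l : C) : Prop :=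
  forall eps : R, 0 < eps -> exists delta : R, 0 < delta /\
    forall w : C, Cmod (w - z) < delta ->
      Cmod (f w - f z - l * (w - z)) <= eps * Cmod (w - z).

Definition ccont (f : C -> C) (z : C) : Prop :=
  forall eps : R, 0 < eps -> exists delta : R, 0 < delta /\
    forall w : C, Cmod (w - z) < delta -> Cmod (f w - f z) < eps.

Definition holo (U : C -> Prop) (f : C -> C) : Prop :=
  forall z : C, U z -> exists l : C, cdiff f z l.

Definition copen (U : C -> Prop) : Prop :=
  forall z : C, U z -> exists r : R, 0 < r /\ forall w : C, Cmod (w - z) < r -> U w.

Definition cball (a : C) (r : R) (z : C) : Prop := Cmod (z - a) < r.

Lemma Cmod_sub_sym (a b : C) : Cmod (a - b) = Cmod (b - a).
Proof. rewrite <- Cmod_opp. f_equal. ring. Qed.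

Lemma Cmod_sub_triangle (a b c : C) : Cmod (a - c) <= Cmod (a - b) + Cmod (b - c).
Proof.
  replace (a - c)%C with ((a - b) + (b - c))%C by ring. apply Cmod_triangle.
Qed.

Lemma Cmod_sub_ge (a b : C) : Cmod a - Cmod b <= Cmod (a - b).
Proof.
  pose proof (Cmod_triangle (a - b) b) as H.
  replace ((a - b) + b)%C with a in H by ring. lra.
Qed.

Lemma Cmod_sub_le (a b : C) : Cmod (a - b) <= Cmod a + Cmod b.
Proof.
  unfold Cminus. rewrite <- (Cmod_opp b). apply Cmod_triangle.
Qed.

Lemma Cmod_sub_diag (a : C) : Cmod (a - a) = 0.
Proof. replace (a - a)%C with (RtoC 0) by ring. apply Cmod_0. Qed.

Lemma Cmod_sub_eq0 (a b : C) : Cmod (a - b) = 0 -> a = b.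
Proof.
  intros H. apply Cmod_eq_0 in H.
  replace a with ((a - b) + b)%C by ring. rewrite H. ring.
Qed.

Lemma Cmod_sub_pos (a b : C) : a <> b -> 0 < Cmod (a - b).
Proof.
  intros H. destruct (Cmod_ge_0 (a - b)) as [H0|H0]; [exact H0|].
  exfalso. apply H. apply Cmod_sub_eq0. now symmetry.
Qed.

Lemma Csub_neq0 (a b : C) : a <> b -> (a - b)%C <> 0.
Proof. intros H. apply Cmod_gt_0. now apply Cmod_sub_pos. Qed.

Lemma Cmod_pair_le (x y : R) : Cmod (x, y) <= Rabs x + Rabs y.
Proof.
  replace ((x, y) : C) with (RtoC x + Ci * RtoC y)%C
    by (unfold RtoC, Ci, Cplus, Cmult; simpl; f_equal; ring).
  eapply Rle_trans; [apply Cmod_triangle|].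
  rewrite Cmod_mult, Cmod_Ci, !Cmod_R. lra.
Qed.

Lemma Rabs_Im_le_Cmod (z : C) : Rabs (Im z) <= Cmod z.
Proof.
  eapply Rle_trans; [|apply Rmax_Cmod]. apply Rmax_r.
Qed.

Lemma Re_le_Cmod (z : C) : Re z <= Cmod z.
Proof. eapply Rle_trans; [apply Rle_abs|apply re_le_Cmod]. Qed.

Lemma Cmod_RtoC_mult (r : R) (z : C) : 0 <= r -> Cmod (r * z) = r * Cmod z.
Proof. intros H. rewrite Cmod_mult, Cmod_R, Rabs_pos_eq; auto. Qed.

Lemma copen_cball (a : C) (r : R) : copen (cball a r).
Proof.
  intros z Hz. unfold cball in *. exists (r - Cmod (z - a)). split; [lra|].
  intros w Hw. pose proof (Cmod_sub_triangle w z a). lra.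
Qed.

Lemma is_derive_cdiff (f : C -> C) (z l : C) :
  is_derive (K := C_AbsRing) (V := C_NormedModule) f z l <-> cdiff f z l.
Proof.
  split.
  - intros [_ H] eps Heps.
    assert (Hz : is_filter_lim (T := AbsRing_NormedModule C_AbsRing)
      (locally (T := AbsRing_NormedModule C_AbsRing) z) z)
      by (intros P HP; exact HP).
    specialize (H z Hz (mkposreal eps Heps)). destruct H as [d Hd].
    exists d. split; [apply cond_pos|]. intros w Hw.
    specialize (Hd w Hw). simpl in Hd.
    assert (E : (f w - f z - l * (w - z))%C =
      minus (G := C_NormedModule) (minus (f w) (f z)) (scal (minus w z) l)).
    { unfold minus, plus, opp, scal. simpl. unfold mult. simpl. ring. }
    rewrite E. exact Hd.
  - intros H. split.
    + apply is_linear_scal_l.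
    + intros x Hx.
      assert (Ex : z = x)
        by (apply (is_filter_lim_locally_unique (V := AbsRing_NormedModule C_AbsRing)); exact Hx).
      subst x. intros eps. destruct (H eps (cond_pos eps)) as [d [Hd H1]].
      exists (mkposreal d Hd). intros w Hw. specialize (H1 w Hw).
      assert (E : (f w - f z - l * (w - z))%C =
      minus (G := C_NormedModule) (minus (f w) (f z)) (scal (minus w z) l)).
      { unfold minus, plus, opp, scal. simpl. unfold mult. simpl. ring. }
      rewrite E in H1. exact H1.
Qed.

Lemma holomorphic_on_holo (U : C -> Prop) (f : C -> C) :
  holomorphic_on U f <-> holo U f.
Proof.
  split; intros H z Hz; destruct (H z Hz) as [l Hl]; exists l; now apply is_derive_cdiff.
Qed.

Lemma cdiff_C_derive (f : C -> C) (z l : C) : cdiff f z l -> C_derive f z = l.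
Proof. intros H. apply is_C_derive_unique. now apply is_derive_cdiff. Qed.

Lemma holo_C_derive (U : C -> Prop) (f : C -> C) (z : C) :
  holo U f -> U z -> cdiff f z (C_derive f z).
Proof.
  intros H Hz. destruct (H z Hz) as [l Hl]. now rewrite (cdiff_C_derive _ _ _ Hl).
Qed.

Lemma cdiff_unique (f : C -> C) (z l m : C) : cdiff f z l -> cdiff f z m -> l = m.
Proof.
  intros H1 H2. now rewrite <- (cdiff_C_derive _ _ _ H1), <- (cdiff_C_derive _ _ _ H2).
Qed.

Lemma cdiff_lip (f : C -> C) (z l : C) : cdiff f z l ->
  exists delta : R, 0 < delta /\ forall w : C, Cmod (w - z) < delta ->
     Cmod (f w - f z) <= (Cmod l + 1) * Cmod (w - z).
Proof.
  intros H. destruct (H 1 Rlt_0_1) as [d [Hd H1]].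
  exists d. split; [exact Hd|]. intros w Hw. specialize (H1 w Hw).
  replace (f w - f z)%C with ((f w - f z - l * (w - z)) + l * (w - z))%C by ring.
  eapply Rle_trans; [apply Cmod_triangle|]. rewrite Cmod_mult. lra.
Qed.

Lemma cdiff_ccont (f : C -> C) (z l : C) : cdiff f z l -> ccont f z.
Proof.
  intros H eps He. destruct (cdiff_lip f z l H) as [d [Hd H1]].
  pose proof (Cmod_ge_0 l) as Hl.
  assert (Hp : 0 < eps / (Cmod l + 1)) by (apply Rdiv_lt_0_compat; lra).
  exists (Rmin d (eps / (Cmod l + 1))). split; [now apply Rmin_pos|].
  intros w Hw. eapply Rle_lt_trans; [apply H1|].
  - eapply Rlt_le_trans; [exact Hw|apply Rmin_l].
  - assert (Hw2 : Cmod (w - z) < eps / (Cmod l + 1))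
      by (eapply Rlt_le_trans; [exact Hw|apply Rmin_r]).
    apply (Rmult_lt_compat_l (Cmod l + 1)) in Hw2; [|lra].
    replace ((Cmod l + 1) * (eps / (Cmod l + 1))) with eps in Hw2 by (field; lra). exact Hw2.
Qed.

Lemma holo_ccont (U : C -> Prop) (f : C -> C) (z : C) : holo U f -> U z -> ccont f z.
Proof. intros H Hz. destruct (H z Hz) as [l Hl]. now apply cdiff_ccont with l. Qed.

Lemma cdiff_ext_loc (f g : C -> C) (z l : C) (r : R) :
  0 < r -> (forall w, Cmod (w - z) < r -> f w = g w) -> cdiff f z l -> cdiff g z l.
Proof.
  intros Hr E H eps He. destruct (H eps He) as [d [Hd H1]].
  exists (Rmin d r). split; [now apply Rmin_pos|].
  intros w Hw. rewrite <- !E.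
  - apply H1. eapply Rlt_le_trans; [exact Hw|apply Rmin_l].
  - rewrite Cmod_sub_diag. exact Hr.
  - eapply Rlt_le_trans; [exact Hw|apply Rmin_r].
Qed.

Lemma cdiff_const (c z : C) : cdiff (fun _ => c) z 0.
Proof.
  intros eps He. exists 1. split; [lra|]. intros w _.
  replace (c - c - 0 * (w - z))%C with (RtoC 0) by ring. rewrite Cmod_0.
  apply Rmult_le_pos; [lra|apply Cmod_ge_0].
Qed.

Lemma cdiff_id (z : C) : cdiff (fun w => w) z 1.
Proof.
  intros eps He. exists 1. split; [lra|]. intros w _.
  replace (w - z - 1 * (w - z))%C with (RtoC 0) by ring. rewrite Cmod_0.
  apply Rmult_le_pos; [lra|apply Cmod_ge_0].
Qed.

Lemma ccont_mult (f g : C -> C) (z : C) :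
  ccont f z -> ccont g z -> ccont (fun w => f w * g w)%C z.
Proof.
  intros Hf Hg eps He.
  pose proof (Cmod_ge_0 (f z)) as Pf. pose proof (Cmod_ge_0 (g z)) as Pg.
  set (A := Cmod (f z) + Cmod (g z) + 1).
  assert (HA : 0 < A) by (unfold A; lra).
  set (e := Rmin 1 (eps / (2 * A))).
  assert (Hq : 0 < eps / (2 * A)) by (apply Rdiv_lt_0_compat; lra).
  assert (He' : 0 < e) by (unfold e; apply Rmin_pos; lra).
  assert (He1 : e <= 1) by apply Rmin_l.
  assert (He2 : e * A <= eps / 2).
  { replace (eps / 2) with (eps / (2 * A) * A) by (field; lra).
    apply Rmult_le_compat_r; [lra|apply Rmin_r]. }
  destruct (Hf e He') as [d1 [Hd1 H1]]. destruct (Hg e He') as [d2 [Hd2 H2]].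
  exists (Rmin d1 d2). split; [now apply Rmin_pos|]. intros w Hw.
  specialize (H1 w (Rlt_le_trans _ _ _ Hw (Rmin_l _ _))).
  specialize (H2 w (Rlt_le_trans _ _ _ Hw (Rmin_r _ _))).
  replace (f w * g w - f z * g z)%C
    with ((f w - f z) * (g w - g z) + (f w - f z) * g z + f z * (g w - g z))%C by ring.
  eapply Rle_lt_trans; [apply Cmod_triangle|].
  eapply Rle_lt_trans; [apply Rplus_le_compat_r, Cmod_triangle|].
  rewrite !Cmod_mult.
  pose proof (Cmod_ge_0 (f w - f z)). pose proof (Cmod_ge_0 (g w - g z)).
  assert (Cmod (f w - f z) * Cmod (g w - g z) <= e * 1)
    by (apply Rmult_le_compat; lra).
  assert (Cmod (f w - f z) * Cmod (g z) <= e * Cmod (g z))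
    by (apply Rmult_le_compat_r; lra).
  assert (Cmod (f z) * Cmod (g w - g z) <= Cmod (f z) * e)
    by (apply Rmult_le_compat_l; lra).
  unfold A in He2. lra.
Qed.

Lemma ccont_plus (f g : C -> C) (z : C) :
  ccont f z -> ccont g z -> ccont (fun w => f w + g w)%C z.
Proof.
  intros Hf Hg eps He.
  destruct (Hf (eps / 2)) as [d1 [Hd1 H1]]; [lra|].
  destruct (Hg (eps / 2)) as [d2 [Hd2 H2]]; [lra|].
  exists (Rmin d1 d2). split; [now apply Rmin_pos|]. intros w Hw.
  specialize (H1 w (Rlt_le_trans _ _ _ Hw (Rmin_l _ _))).
  specialize (H2 w (Rlt_le_trans _ _ _ Hw (Rmin_r _ _))).
  replace (f w + g w - (f z + g z))%C with ((f w - f z) + (g w - g z))%C by ring.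
  eapply Rle_lt_trans; [apply Cmod_triangle|]. lra.
Qed.

Lemma ccont_const (c z : C) : ccont (fun _ => c) z.
Proof. apply cdiff_ccont with (RtoC 0). apply cdiff_const. Qed.

Lemma ccont_inv (f : C -> C) (z : C) :
  ccont f z -> f z <> 0 -> ccont (fun w => / f w)%C z.
Proof.
  intros Hf Hz eps He. set (m := Cmod (f z)).
  assert (Hm : 0 < m) by (unfold m; now apply Cmod_gt_0).
  set (e := Rmin (m / 2) (eps * (m / 2 * m))).
  assert (Hp : 0 < m / 2 * m) by (apply Rmult_lt_0_compat; lra).
  assert (He' : 0 < e).
  { apply Rmin_pos; [lra|]. now apply Rmult_lt_0_compat. }
  destruct (Hf e He') as [d [Hd H]]. exists d. split; [exact Hd|].
  intros w Hw. specialize (H w Hw).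
  assert (B1 : Cmod (f w - f z) < m / 2) by (eapply Rlt_le_trans; [exact H|apply Rmin_l]).
  assert (B2 : Cmod (f w - f z) < eps * (m / 2 * m)) by (eapply Rlt_le_trans; [exact H|apply Rmin_r]).
  assert (B3 : m / 2 < Cmod (f w)).
  { pose proof (Cmod_sub_ge (f z) (f z - f w)) as X.
    replace (f z - (f z - f w))%C with (f w) in X by ring.
    rewrite (Cmod_sub_sym (f z)) in X. fold m in X. lra. }
  assert (Hw0 : f w <> 0) by (apply Cmod_gt_0; lra).
  replace (/ f w - / f z)%C with ((f z - f w) / (f w * f z))%C by (field; now split).
  rewrite Cmod_div by (now apply Cmult_neq_0).
  rewrite Cmod_mult. fold m. rewrite Cmod_sub_sym.
  assert (Hd' : 0 < Cmod (f w) * m) by (apply Rmult_lt_0_compat; lra).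
  apply (Rmult_lt_reg_r (Cmod (f w) * m)); [exact Hd'|].
  replace (Cmod (f w - f z) / (Cmod (f w) * m) * (Cmod (f w) * m)) with (Cmod (f w - f z))
    by (field; split; lra).
  eapply Rlt_le_trans; [exact B2|]. apply Rmult_le_compat_l; [lra|].
  apply Rmult_le_compat_r; lra.
Qed.

Lemma ccont_comp (f g : C -> C) (z : C) :
  ccont f (g z) -> ccont g z -> ccont (fun w => f (g w)) z.
Proof.
  intros Hf Hg eps He. destruct (Hf eps He) as [d [Hd H1]].
  destruct (Hg d Hd) as [d' [Hd' H2]]. exists d'. auto.
Qed.

Definition slope (f : C -> C) (a z : C) : C :=
  if excluded_middle_informative (z = a) then C_derive f a else ((f z - f a) / (z - a))%C.

Lemma slope_eq (f : C -> C) (a : C) : slope f a a = C_derive f a.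
Proof. unfold slope. destruct excluded_middle_informative; [reflexivity|congruence]. Qed.

Lemma slope_neq (f : C -> C) (a z : C) : z <> a -> slope f a z = ((f z - f a) / (z - a))%C.
Proof. intros H. unfold slope. destruct excluded_middle_informative; [congruence|reflexivity]. Qed.

Lemma slope_mult (f : C -> C) (a z : C) : (slope f a z * (z - a) = f z - f a)%C.
Proof.
  destruct (classic (z = a)) as [->|H].
  - ring.
  - rewrite slope_neq by exact H. field. now apply Csub_neq0.
Qed.

Lemma slope_ccont (f : C -> C) (a l : C) : cdiff f a l -> ccont (slope f a) a.
Proof.
  intros H eps He. destruct (H (eps / 2)) as [d [Hd H1]]; [lra|].
  exists d. split; [exact Hd|]. intros w Hw. rewrite slope_eq, (cdiff_C_derive _ _ _ H).
  destruct (classic (w = a)) as [->|Hn].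
  - rewrite slope_eq, (cdiff_C_derive _ _ _ H), Cmod_sub_diag. lra.
  - rewrite slope_neq by exact Hn. specialize (H1 w Hw).
    pose proof (Cmod_sub_pos _ _ Hn) as Hp. pose proof (Csub_neq0 _ _ Hn) as Hz.
    replace ((f w - f a) / (w - a) - l)%C with ((f w - f a - l * (w - a)) / (w - a))%C
      by (field; exact Hz).
    rewrite Cmod_div by exact Hz. apply (Rmult_lt_reg_r (Cmod (w - a))); [exact Hp|].
    replace (Cmod (f w - f a - l * (w - a)) / Cmod (w - a) * Cmod (w - a))
      with (Cmod (f w - f a - l * (w - a))) by (field; lra). nra.
Qed.

Lemma cdiff_eq (f : C -> C) (z l m : C) : cdiff f z l -> l = m -> cdiff f z m.
Proof. intros H <-. exact H. Qed.

(** Caratheodory's form of differentiability, through a slope continuous at z; the product,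
    quotient and chain rules become identities between slopes. *)
Lemma cdiff_slope (f q : C -> C) (z l : C) (r : R) : 0 < r ->
  (forall w, Cmod (w - z) < r -> f w - f z = q w * (w - z))%C ->
  ccont q z -> q z = l -> cdiff f z l.
Proof.
  intros Hr E H <- eps He. destruct (H eps He) as [d [Hd H1]].
  exists (Rmin d r). split; [now apply Rmin_pos|]. intros w Hw.
  rewrite E by (eapply Rlt_le_trans; [exact Hw|apply Rmin_r]).
  replace (q w * (w - z) - q z * (w - z))%C with ((q w - q z) * (w - z))%C by ring.
  rewrite Cmod_mult. apply Rmult_le_compat_r; [apply Cmod_ge_0|].
  left. apply H1. eapply Rlt_le_trans; [exact Hw|apply Rmin_l].
Qed.

Lemma slope_at (f : C -> C) (z l : C) : cdiff f z l -> slope f z z = l.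
Proof. intros H. now rewrite slope_eq, (cdiff_C_derive _ _ _ H). Qed.

Lemma cdiff_plus (f g : C -> C) (z l m : C) :
  cdiff f z l -> cdiff g z m -> cdiff (fun w => f w + g w)%C z (l + m)%C.
Proof.
  intros Hf Hg. apply (cdiff_slope _ (fun w => slope f z w + slope g z w)%C) with (r := 1); [lra|..].
  - intros w _. rewrite Cmult_plus_distr_r, !slope_mult. ring.
  - apply ccont_plus; eapply slope_ccont; eassumption.
  - now rewrite (slope_at f z l), (slope_at g z m).
Qed.

Lemma cdiff_mult (f g : C -> C) (z l m : C) :
  cdiff f z l -> cdiff g z m -> cdiff (fun w => f w * g w)%C z (l * g z + f z * m)%C.
Proof.
  intros Hf Hg.
  apply (cdiff_slope _ (fun w => slope f z w * g w + f z * slope g z w)%C) with (r := 1); [lra|..].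
  - intros w _.
    transitivity (slope f z w * (w - z) * g w + f z * (slope g z w * (w - z)))%C; [|ring].
    rewrite !slope_mult. ring.
  - apply ccont_plus; apply ccont_mult.
    + eapply slope_ccont; eassumption.
    + eapply cdiff_ccont; eassumption.
    + apply ccont_const.
    + eapply slope_ccont; eassumption.
  - now rewrite (slope_at f z l), (slope_at g z m).
Qed.

Lemma cdiff_inv (f : C -> C) (z l : C) :
  cdiff f z l -> f z <> 0 -> cdiff (fun w => / f w)%C z (- l / (f z * f z))%C.
Proof.
  intros Hf Hz. assert (Hc := cdiff_ccont _ _ _ Hf).
  destruct (Hc (Cmod (f z))) as [d [Hd H]]; [now apply Cmod_gt_0|].
  apply (cdiff_slope _ (fun w => - / f z * (slope f z w * / f w))%C) with (r := d); [exact Hd|..].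
  - intros w Hw.
    assert (Hw0 : f w <> 0).
    { intros E. specialize (H w Hw). rewrite E in H.
      replace (0 - f z)%C with (- f z)%C in H by ring. rewrite Cmod_opp in H. lra. }
    transitivity (- / f z * (slope f z w * (w - z)) * / f w)%C; [|ring].
    rewrite slope_mult. field. now split.
  - apply ccont_mult; [apply ccont_const|]. apply ccont_mult; [|now apply ccont_inv].
    eapply slope_ccont; eassumption.
  - rewrite (slope_at f z l) by exact Hf. field. exact Hz.
Qed.

Lemma cdiff_comp (f g : C -> C) (z l m : C) :
  cdiff f (g z) l -> cdiff g z m -> cdiff (fun w => f (g w)) z (l * m)%C.
Proof.
  intros Hf Hg.
  apply (cdiff_slope _ (fun w => slope f (g z) (g w) * slope g z w)%C) with (r := 1); [lra|..].
  - intros w _. rewrite <- Cmult_assoc, !slope_mult. reflexivity.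
  - apply ccont_mult; [|eapply slope_ccont; eassumption].
    apply (ccont_comp (slope f (g z)) g); [eapply slope_ccont; eassumption|].
    eapply cdiff_ccont; eassumption.
  - now rewrite (slope_at f (g z) l), (slope_at g z m).
Qed.

Lemma cdiff_scal (c : C) (f : C -> C) (z l : C) :
  cdiff f z l -> cdiff (fun w => c * f w)%C z (c * l)%C.
Proof.
  intros H. eapply cdiff_eq; [exact (cdiff_mult _ _ _ _ _ (cdiff_const c z) H)|]. simpl. ring.
Qed.

Lemma cdiff_minus (f g : C -> C) (z l m : C) :
  cdiff f z l -> cdiff g z m -> cdiff (fun w => f w - g w)%C z (l - m)%C.
Proof.
  intros Hf Hg.
  apply cdiff_ext_loc with (f := (fun w => f w + (-1) * g w)%C) (r := 1); [lra| |].
  - intros w _. ring.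
  - eapply cdiff_eq; [apply cdiff_plus; [exact Hf|apply cdiff_scal; exact Hg]|]. ring.
Qed.

Lemma cdiff_div (f g : C -> C) (z l m : C) : g z <> 0 ->
  cdiff f z l -> cdiff g z m ->
  cdiff (fun w => f w / g w)%C z ((l * g z - f z * m) / (g z * g z))%C.
Proof.
  intros Hz Hf Hg. eapply cdiff_eq; [apply cdiff_mult; [exact Hf|apply cdiff_inv; eauto]|].
  simpl. field. exact Hz.
Qed.

(** * Restriction to segments and the mean value inequality *)


(** Multiplication by [conj_phase z] rotates z onto the positive axis; it turns a bound
    on a modulus into a statement about one real function, to which the real mean value
    theorem applies. *)
Definition conj_phase (z : C) : C := (Cconj z / RtoC (Cmod z))%C.

Lemma RtoC_neq0 (r : R) : r <> 0 -> RtoC r <> 0.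
Proof. intros H E. apply H. now apply (f_equal fst) in E. Qed.

Lemma Cmod_neq0 (z : C) : z <> 0 -> RtoC (Cmod z) <> 0.
Proof. intros Hz. apply RtoC_neq0. apply Cmod_gt_0 in Hz. lra. Qed.

Lemma conj_phase_mult (z : C) : z <> 0 -> (conj_phase z * z = RtoC (Cmod z))%C.
Proof.
  intros Hz. pose proof (Cmod_neq0 z Hz) as Hm. unfold conj_phase.
  replace (Cconj z / RtoC (Cmod z) * z)%C with (z * Cconj z / RtoC (Cmod z))%C
    by (field; exact Hm).
  rewrite <- Cmod2_conj, RtoC_pow. field. exact Hm.
Qed.

Lemma Cmod_conj_phase (z : C) : z <> 0 -> Cmod (conj_phase z) = 1.
Proof.
  intros Hz. assert (H := f_equal Cmod (conj_phase_mult z Hz)).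
  rewrite Cmod_mult, Cmod_R, (Rabs_pos_eq _ (Cmod_ge_0 z)) in H.
  apply Cmod_gt_0 in Hz. apply (Rmult_eq_reg_r (Cmod z)); lra.
Qed.

Lemma exists_phase (z : C) : exists u, Cmod u = 1 /\ (u * z = RtoC (Cmod z))%C.
Proof.
  destruct (classic (z = 0)) as [->|Hz].
  - exists (RtoC 1). rewrite Cmod_1, Cmod_0. split; [reflexivity|ring].
  - exists (conj_phase z). split; [now apply Cmod_conj_phase|now apply conj_phase_mult].
Qed.

Lemma Re_minus (a b : C) : Re (a - b) = Re a - Re b.
Proof. reflexivity. Qed.
Lemma Re_plus (a b : C) : Re (a + b) = Re a + Re b.
Proof. reflexivity. Qed.
Lemma Re_RtoC_mult (r : R) (z : C) : Re (r * z) = r * Re z.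
Proof. unfold Re, Cmult, RtoC; simpl; ring. Qed.

Lemma cdiff_line (f : C -> C) (k a d l : C) (t : R) :
  cdiff f (a + t * d) l ->
  derivable_pt_lim (fun s : R => Re (k * f (a + s * d)))%C t (Re (k * l * d)).
Proof.
  intros H eps He.
  pose proof (Cmod_ge_0 k) as Pk. pose proof (Cmod_ge_0 d) as Pd.
  set (e := eps / (2 * (Cmod k * Cmod d + 1))).
  assert (Pkd : 0 <= Cmod k * Cmod d) by now apply Rmult_le_pos.
  assert (He' : 0 < e) by (apply Rdiv_lt_0_compat; lra).
  destruct (H e He') as [r [Hr H1]].
  assert (Hr' : 0 < r / (Cmod d + 1)) by (apply Rdiv_lt_0_compat; lra).
  exists (mkposreal _ Hr'). intros h Hh0 Hh. simpl in Hh.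
  assert (Ph : 0 < Rabs h) by now apply Rabs_pos_lt.
  specialize (H1 (a + RtoC (t + h) * d)%C).
  assert (E0 : ((a + RtoC (t + h) * d) - (a + t * d) = h * d)%C)
    by (rewrite RtoC_plus; ring).
  rewrite E0 in H1. rewrite Cmod_mult, Cmod_R in H1.
  assert (B : Rabs h * Cmod d < r).
  { apply Rle_lt_trans with (Rabs h * (Cmod d + 1)); [nra|].
    apply (Rmult_lt_compat_r (Cmod d + 1)) in Hh; [|lra].
    replace (r / (Cmod d + 1) * (Cmod d + 1)) with r in Hh by (field; lra). exact Hh. }
  specialize (H1 B).
  set (X := (f (a + RtoC (t + h) * d) - f (a + t * d) - l * (h * d))%C) in H1.
  assert (E1 : (Re (k * f (a + RtoC (t + h) * d))%C - Re (k * f (a + t * d))%C) / h - Re (k * l * d)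
     = Re (k * X) / h).
  { replace (k * X)%C with ((k * f (a + RtoC (t + h) * d) - k * f (a + t * d))
        - h * (k * l * d))%C by (unfold X; ring).
    rewrite !Re_minus, Re_RtoC_mult. field. exact Hh0. }
  rewrite E1. unfold Rdiv. rewrite Rabs_mult, Rabs_inv.
  assert (E2 : Rabs (Re (k * X)) <= Cmod k * (e * (Rabs h * Cmod d))).
  { eapply Rle_trans; [apply re_le_Cmod|]. rewrite Cmod_mult.
    apply Rmult_le_compat_l; lra. }
  apply Rle_lt_trans with (Cmod k * (e * (Rabs h * Cmod d)) * / Rabs h).
  - apply Rmult_le_compat_r; [left; now apply Rinv_0_lt_compat|exact E2].
  - replace (Cmod k * (e * (Rabs h * Cmod d)) * / Rabs h) with (e * (Cmod k * Cmod d))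
      by (field; lra).
    assert (Ee : e * (Cmod k * Cmod d + 1) = eps / 2) by (unfold e; field; lra). lra.
Qed.

(** After rotating f b - f a onto the positive axis, this is the real mean value theorem
    for the real part of f along the segment. *)
Lemma mean_value_ineq (f l : C -> C) (a b : C) (B : R) :
  (forall t : R, 0 <= t <= 1 -> cdiff f (a + t * (b - a)) (l (a + t * (b - a))%C)) ->
  (forall t : R, 0 <= t <= 1 -> Cmod (l (a + t * (b - a))%C) <= B) ->
  Cmod (f b - f a) <= B * Cmod (b - a).
Proof.
  intros Hd HB.
  destruct (exists_phase (f b - f a)) as [k [Hk Ek]].
  destruct (MVT_cor2 (fun s : R => Re (k * f (a + s * (b - a))))%C
     (fun s : R => Re (k * l (a + s * (b - a)) * (b - a)))%C 0 1) as [c [Hc Hc1]]; [lra| |].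
  { intros c Hc. apply cdiff_line. now apply Hd. }
  replace (a + RtoC 1 * (b - a))%C with b in Hc by ring.
  replace (a + RtoC 0 * (b - a))%C with a in Hc by ring.
  rewrite <- Re_minus in Hc.
  replace (k * f b - k * f a)%C with (k * (f b - f a))%C in Hc by ring.
  rewrite Ek in Hc.
  change (Re (RtoC (Cmod (f b - f a)))) with (Cmod (f b - f a)) in Hc.
  rewrite Hc. rewrite Rminus_0_r, Rmult_1_r.
  eapply Rle_trans; [apply Re_le_Cmod|]. rewrite !Cmod_mult, Hk, Rmult_1_l.
  apply Rmult_le_compat_r; [apply Cmod_ge_0|]. apply HB. lra.
Qed.

(** * Integrals over boundaries of rectangles *)

Definition between (a b x : R) : Prop := Rmin a b <= x <= Rmax a b.

Ltac between_tac :=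
  unfold between, Rmin, Rmax in *;
  repeat match goal with
  | |- context [Rle_dec ?a ?b] => destruct (Rle_dec a b)
  | H : context [Rle_dec ?a ?b] |- _ => destruct (Rle_dec a b)
  end; lra.

Definition CInt (f : R -> C) (a b : R) : C := RInt (V := C_R_CompleteNormedModule) f a b.
Definition exCInt (f : R -> C) (a b : R) : Prop := ex_RInt (V := C_R_CompleteNormedModule) f a b.

Lemma ccont_continuous_h (f : C -> C) (x y : R) : ccont f (x, y) ->
  continuous (T := R_UniformSpace) (U := C_R_CompleteNormedModule) (fun u => f (u, y)) x.
Proof.
  intros H. apply filterlim_locally. intros eps.
  destruct (H eps (cond_pos eps)) as [d [Hd H1]].
  exists (mkposreal d Hd). intros u Hu.
  assert (Hc : Cmod (f (u, y) - f (x, y)) < eps).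
  { apply H1. replace ((u, y) - (x, y))%C with (RtoC (u - x))
      by (unfold RtoC, Cminus, Cplus, Copp; simpl; f_equal; ring).
    rewrite Cmod_R. exact Hu. }
  split; (eapply Rle_lt_trans; [|exact Hc]).
  - apply (re_le_Cmod (f (u, y) - f (x, y))).
  - apply (Rabs_Im_le_Cmod (f (u, y) - f (x, y))).
Qed.

Lemma ccont_continuous_v (f : C -> C) (x y : R) : ccont f (x, y) ->
  continuous (T := R_UniformSpace) (U := C_R_CompleteNormedModule) (fun v => f (x, v)) y.
Proof.
  intros H. apply filterlim_locally. intros eps.
  destruct (H eps (cond_pos eps)) as [d [Hd H1]].
  exists (mkposreal d Hd). intros u Hu.
  assert (Hc : Cmod (f (x, u) - f (x, y)) < eps).
  { apply H1. replace ((x, u) - (x, y))%C with (Ci * RtoC (u - y))%C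
      by (unfold RtoC, Ci, Cmult, Cminus, Cplus, Copp; simpl; f_equal; ring).
    rewrite Cmod_mult, Cmod_Ci, Cmod_R, Rmult_1_l. exact Hu. }
  split; (eapply Rle_lt_trans; [|exact Hc]).
  - apply (re_le_Cmod (f (x, u) - f (x, y))).
  - apply (Rabs_Im_le_Cmod (f (x, u) - f (x, y))).
Qed.

Lemma exCInt_h (f : C -> C) (a b y : R) :
  (forall u, between a b u -> ccont f (u, y)) -> exCInt (fun u => f (u, y)) a b.
Proof.
  intros H. apply ex_RInt_continuous. intros u Hu. apply ccont_continuous_h. now apply H.
Qed.

Lemma exCInt_v (f : C -> C) (a b x : R) :
  (forall v, between a b v -> ccont f (x, v)) -> exCInt (fun v => f (x, v)) a b.
Proof.
  intros H. apply ex_RInt_continuous. intros u Hu. apply ccont_continuous_v. now apply H.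
Qed.

Lemma CInt_Chasles (f : R -> C) (a b c : R) :
  exCInt f a b -> exCInt f b c -> (CInt f a b + CInt f b c = CInt f a c)%C.
Proof. intros H1 H2. exact (RInt_Chasles (V := C_R_CompleteNormedModule) f a b c H1 H2). Qed.

Lemma CInt_plus (f g : R -> C) (a b : R) : exCInt f a b -> exCInt g a b ->
  CInt (fun t => f t + g t)%C a b = (CInt f a b + CInt g a b)%C.
Proof. intros H1 H2. exact (RInt_plus (V := C_R_CompleteNormedModule) f g a b H1 H2). Qed.

Lemma CInt_minus (f g : R -> C) (a b : R) : exCInt f a b -> exCInt g a b ->
  CInt (fun t => f t - g t)%C a b = (CInt f a b - CInt g a b)%C.
Proof. intros H1 H2. exact (RInt_minus (V := C_R_CompleteNormedModule) f g a b H1 H2). Qed.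

Lemma exCInt_minus (f g : R -> C) (a b : R) : exCInt f a b -> exCInt g a b ->
  exCInt (fun t => f t - g t)%C a b.
Proof. intros H1 H2. exact (ex_RInt_minus (V := C_R_CompleteNormedModule) f g a b H1 H2). Qed.

Lemma CInt_swap (f : R -> C) (a b : R) : exCInt f a b -> CInt f b a = (- CInt f a b)%C.
Proof.
  intros H. symmetry. exact (opp_RInt_swap (V := C_R_CompleteNormedModule) f a b H).
Qed.

Lemma is_RInt_Cscal (f : R -> C) (a b : R) (c I : C) :
  is_RInt (V := C_R_CompleteNormedModule) f a b I ->
  is_RInt (V := C_R_CompleteNormedModule) (fun t => c * f t)%C a b (c * I)%C.
Proof.
  intros H.
  pose proof (is_RInt_fct_extend_fst (U := R_NormedModule) (V := R_NormedModule) f a b I H) as H1.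
  pose proof (is_RInt_fct_extend_snd (U := R_NormedModule) (V := R_NormedModule) f a b I H) as H2.
  apply (is_RInt_fct_extend_pair (U := R_NormedModule) (V := R_NormedModule)
    (fun t => c * f t)%C a b).
  - exact (is_RInt_minus _ _ _ _ _ _ (is_RInt_scal _ a b (fst c) _ H1) (is_RInt_scal _ a b (snd c) _ H2)).
  - exact (is_RInt_plus _ _ _ _ _ _ (is_RInt_scal _ a b (fst c) _ H2) (is_RInt_scal _ a b (snd c) _ H1)).
Qed.

Lemma CInt_Cscal (f : R -> C) (a b : R) (c : C) : exCInt f a b ->
  CInt (fun t => c * f t)%C a b = (c * CInt f a b)%C.
Proof.
  intros H. apply (is_RInt_unique (V := C_R_CompleteNormedModule)). apply is_RInt_Cscal.
  exact (RInt_correct (V := C_R_CompleteNormedModule) f a b H).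
Qed.

Lemma CInt_const (a b : R) (c : C) : CInt (fun _ => c) a b = (RtoC (b - a) * c)%C.
Proof.
  unfold CInt. rewrite (RInt_const (V := C_R_CompleteNormedModule)). unfold scal. simpl. unfold prod_scal, scal. simpl.
  unfold mult. simpl. unfold Cmult, RtoC. simpl. f_equal; ring.
Qed.

Lemma exCInt_const (a b : R) (c : C) : exCInt (fun _ => c) a b.
Proof. apply (ex_RInt_const (V := C_R_CompleteNormedModule)). Qed.

Lemma exCInt_swap (f : R -> C) (a b : R) : exCInt f a b -> exCInt f b a.
Proof. apply (ex_RInt_swap (V := C_R_CompleteNormedModule)). Qed.

Lemma CInt_bound (f : R -> C) (a b B : R) : exCInt f a b ->
  (forall t, between a b t -> Cmod (f t) <= B) -> Cmod (CInt f a b) <= Rabs (b - a) * B.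
Proof.
  assert (W : forall a b, a <= b -> exCInt f a b -> (forall t, between a b t -> Cmod (f t) <= B) ->
    Cmod (CInt f a b) <= (b - a) * B).
  { intros x y Hxy Hex HB. rewrite Cmod_norm.
    apply (norm_RInt_le_const (V := C_R_NormedModule) f x y); [exact Hxy| |].
    - intros t Ht. rewrite <- Cmod_norm. apply HB. between_tac.
    - exact (RInt_correct (V := C_R_CompleteNormedModule) f x y Hex). }
  intros Hex HB. destruct (Rle_or_lt a b) as [Hab|Hab].
  - rewrite Rabs_pos_eq by lra. now apply W.
  - rewrite Rabs_left by lra. rewrite CInt_swap by (now apply exCInt_swap).
    rewrite Cmod_opp. replace (- (b - a)) with (a - b) by ring. apply W; [lra| |].
    + now apply exCInt_swap.
    + intros t Ht. apply HB. between_tac.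
Qed.

Lemma CInt_near_const (f : R -> C) (a b e : R) (c : C) : exCInt f a b ->
  (forall t, between a b t -> Cmod (f t - c) <= e) ->
  Cmod (CInt f a b - RtoC (b - a) * c) <= Rabs (b - a) * e.
Proof.
  intros Hex H. rewrite <- CInt_const.
  rewrite <- CInt_minus by (auto; apply exCInt_const).
  apply CInt_bound; auto. apply exCInt_minus; auto. apply exCInt_const.
Qed.

(** The boundary integral of f over the rectangle, with opposite sides paired in one
    integrand. The pairing makes the contributions of an affine f constant along each
    side. The corners may come in any order, so the rectangle is signed. *)
Definition rect_int (f : C -> C) (x1 x2 y1 y2 : R) : C :=
  (CInt (fun u => f (u, y1) - f (u, y2)) x1 x2
   + Ci * CInt (fun v => f (x2, v) - f (x1, v)) y1 y2)%C.

Definition cont_on_rect (f : C -> C) (x1 x2 y1 y2 : R) : Prop :=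
  forall u v, between x1 x2 u -> between y1 y2 v -> ccont f (u, v).

Definition on_bdry (x1 x2 y1 y2 u v : R) : Prop :=
  between x1 x2 u /\ between y1 y2 v /\ (u = x1 \/ u = x2 \/ v = y1 \/ v = y2).

Definition cont_on_bdry (f : C -> C) (x1 x2 y1 y2 : R) : Prop :=
  forall u v, on_bdry x1 x2 y1 y2 u v -> ccont f (u, v).

Lemma cont_on_rect_cont_on_bdry (f : C -> C) (x1 x2 y1 y2 : R) : cont_on_rect f x1 x2 y1 y2 -> cont_on_bdry f x1 x2 y1 y2.
Proof. intros H u v [Hu [Hv _]]. now apply H. Qed.

Lemma between_l (a b : R) : between a b a. Proof. between_tac. Qed.
Lemma between_r (a b : R) : between a b b. Proof. between_tac. Qed.
#[local] Hint Resolve between_l between_r : core.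

Ltac on_bdry_tac := split; [|split]; auto; between_tac.


Lemma rect_int_split_x (f : C -> C) (x1 x2 x3 y1 y2 : R) : between x1 x3 x2 ->
  cont_on_rect f x1 x3 y1 y2 -> (rect_int f x1 x3 y1 y2 = rect_int f x1 x2 y1 y2 + rect_int f x2 x3 y1 y2)%C.
Proof.
  intros Hb H. unfold rect_int.
  assert (E : forall y a b, between y1 y2 y -> between x1 x3 a -> between x1 x3 b ->
     exCInt (fun u => f (u, y)) a b).
  { intros y a b Hy Ha Hb'. apply exCInt_h. intros u Hu. apply H; auto. between_tac. }
  rewrite <- (CInt_Chasles _ x1 x2 x3) by (apply exCInt_minus; apply E; auto).
  assert (F : forall x, between x1 x3 x -> exCInt (fun v => f (x, v)) y1 y2).
  { intros x Hx. apply exCInt_v. intros v Hv. apply H; auto. }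
  rewrite !(CInt_minus (fun v => f (_, v))) by (apply F; auto). ring.
Qed.

Lemma rect_int_split_y (f : C -> C) (x1 x2 y1 y2 y3 : R) : between y1 y3 y2 ->
  cont_on_rect f x1 x2 y1 y3 -> (rect_int f x1 x2 y1 y3 = rect_int f x1 x2 y1 y2 + rect_int f x1 x2 y2 y3)%C.
Proof.
  intros Hb H. unfold rect_int.
  assert (E : forall x a b, between x1 x2 x -> between y1 y3 a -> between y1 y3 b ->
     exCInt (fun v => f (x, v)) a b).
  { intros y a b Hy Ha Hb'. apply exCInt_v. intros u Hu. apply H; auto. between_tac. }
  rewrite <- (CInt_Chasles _ y1 y2 y3) by (apply exCInt_minus; apply E; auto).
  assert (F : forall y, between y1 y3 y -> exCInt (fun u => f (u, y)) x1 x2).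
  { intros x Hx. apply exCInt_h. intros v Hv. apply H; auto. }
  rewrite !(CInt_minus (fun u => f (u, _))) by (apply F; auto). ring.
Qed.

Lemma Cpair_minus (a b c d : R) : ((a, b) - (c, d))%C = (a - c, b - d).
Proof. reflexivity. Qed.

(** The boundary integral of an affine function is zero, so only the error e counts.
    Only values on the boundary matter, which allows integrands with a pole inside. *)
Lemma rect_int_near_affine (f : C -> C) (x1 x2 y1 y2 e : R) (al l p : C) :
  cont_on_bdry f x1 x2 y1 y2 ->
  (forall u v, on_bdry x1 x2 y1 y2 u v ->
     Cmod (f (u, v) - (al + l * ((u, v) - p))) <= e) ->
  Cmod (rect_int f x1 x2 y1 y2) <= 2 * e * (Rabs (x2 - x1) + Rabs (y2 - y1)).
Proof.
  intros H He. unfold rect_int.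
  set (c1 := (l * (Ci * RtoC (y1 - y2)))%C). set (c2 := (l * RtoC (x2 - x1))%C).
  assert (D1 : forall u, (u, y1) = ((u, y2) + Ci * RtoC (y1 - y2))%C).
  { intros u. unfold RtoC, Ci, Cmult, Cplus; simpl; f_equal; ring. }
  assert (D2 : forall v, (x2, v) = ((x1, v) + RtoC (x2 - x1))%C).
  { intros u. unfold RtoC, Cplus; simpl; f_equal; ring. }
  assert (B1 : Cmod (CInt (fun u => f (u, y1) - f (u, y2))%C x1 x2 - RtoC (x2 - x1) * c1)
     <= Rabs (x2 - x1) * (2 * e)).
  { apply CInt_near_const.
    - apply exCInt_minus; apply exCInt_h; intros; apply H; on_bdry_tac.
    - intros u Hu. pose proof (He u y1 ltac:(on_bdry_tac)) as G1.
      pose proof (He u y2 ltac:(on_bdry_tac)) as G2.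
      replace (f (u, y1) - f (u, y2) - c1)%C
        with ((f (u, y1) - (al + l * ((u, y1) - p))) - (f (u, y2) - (al + l * ((u, y2) - p))))%C.
      + eapply Rle_trans; [apply Cmod_sub_le|]. lra.
      + unfold c1. rewrite (D1 u). ring. }
  assert (B2 : Cmod (CInt (fun v => f (x2, v) - f (x1, v))%C y1 y2 - RtoC (y2 - y1) * c2)
     <= Rabs (y2 - y1) * (2 * e)).
  { apply CInt_near_const.
    - apply exCInt_minus; apply exCInt_v; intros; apply H; on_bdry_tac.
    - intros v Hv. pose proof (He x1 v ltac:(on_bdry_tac)) as G1.
      pose proof (He x2 v ltac:(on_bdry_tac)) as G2.
      replace (f (x2, v) - f (x1, v) - c2)%C
        with ((f (x2, v) - (al + l * ((x2, v) - p))) - (f (x1, v) - (al + l * ((x1, v) - p))))%C.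
      + eapply Rle_trans; [apply Cmod_sub_le|]. lra.
      + unfold c2. rewrite (D2 v). ring. }
  set (I1 := CInt _ x1 x2) in *. set (I2 := CInt _ y1 y2) in *.
  replace (I1 + Ci * I2)%C
    with ((I1 - RtoC (x2 - x1) * c1) + Ci * (I2 - RtoC (y2 - y1) * c2))%C.
  - eapply Rle_trans; [apply Cmod_triangle|]. rewrite Cmod_mult, Cmod_Ci. lra.
  - unfold c1, c2. rewrite !RtoC_minus. ring.
Qed.

Lemma rect_int_bound (f : C -> C) (x1 x2 y1 y2 B : R) :
  cont_on_bdry f x1 x2 y1 y2 ->
  (forall u v, on_bdry x1 x2 y1 y2 u v -> Cmod (f (u, v)) <= B) ->
  Cmod (rect_int f x1 x2 y1 y2) <= 2 * B * (Rabs (x2 - x1) + Rabs (y2 - y1)).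
Proof.
  intros H HB. apply rect_int_near_affine with (al := RtoC 0) (l := RtoC 0) (p := RtoC 0); [exact H|].
  intros u v Huv. replace (f (u, v) - (0 + 0 * ((u, v) - 0)))%C with (f (u, v)) by ring.
  now apply HB.
Qed.

Lemma rect_int_linear (f g : C -> C) (c d : C) (x1 x2 y1 y2 : R) :
  cont_on_bdry f x1 x2 y1 y2 -> cont_on_bdry g x1 x2 y1 y2 ->
  rect_int (fun z => c * f z + d * g z)%C x1 x2 y1 y2
    = (c * rect_int f x1 x2 y1 y2 + d * rect_int g x1 x2 y1 y2)%C.
Proof.
  intros Hf Hg. unfold rect_int.
  assert (E : forall h c x1 x2 y1 y2, cont_on_bdry h x1 x2 y1 y2 ->
    exCInt (fun u => c * (h (u, y1) - h (u, y2)))%C x1 x2 /\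
    exCInt (fun v => c * (h (x2, v) - h (x1, v)))%C y1 y2 /\
    CInt (fun u => c * (h (u, y1) - h (u, y2)))%C x1 x2
      = (c * CInt (fun u => h (u, y1) - h (u, y2)) x1 x2)%C /\
    CInt (fun v => c * (h (x2, v) - h (x1, v)))%C y1 y2
      = (c * CInt (fun v => h (x2, v) - h (x1, v)) y1 y2)%C).
  { clear. intros h c x1 x2 y1 y2 H.
    assert (E1 : exCInt (fun u => h (u, y1) - h (u, y2))%C x1 x2)
      by (apply exCInt_minus; apply exCInt_h; intros; apply H; on_bdry_tac).
    assert (E2 : exCInt (fun v => h (x2, v) - h (x1, v))%C y1 y2)
      by (apply exCInt_minus; apply exCInt_v; intros; apply H; on_bdry_tac).
    repeat split.
    - destruct E1 as [I HI]. eexists. apply is_RInt_Cscal. exact HI.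
    - destruct E2 as [I HI]. eexists. apply is_RInt_Cscal. exact HI.
    - now apply CInt_Cscal.
    - now apply CInt_Cscal. }
  destruct (E f c _ _ _ _ Hf) as [F1 [F2 [F3 F4]]].
  destruct (E g d _ _ _ _ Hg) as [G1 [G2 [G3 G4]]].
  transitivity (CInt (fun u => c * (f (u, y1) - f (u, y2)) + d * (g (u, y1) - g (u, y2)))%C x1 x2
    + Ci * CInt (fun v => c * (f (x2, v) - f (x1, v)) + d * (g (x2, v) - g (x1, v)))%C y1 y2)%C.
  { f_equal; [|f_equal]; apply (RInt_ext (V := C_R_CompleteNormedModule)); intros; simpl; ring. }
  rewrite !CInt_plus, F3, F4, G3, G4 by assumption. ring.
Qed.

Lemma CInt_ext (f g : R -> C) (a b : R) :
  (forall t, between a b t -> f t = g t) -> CInt f a b = CInt g a b.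
Proof.
  intros H. apply (RInt_ext (V := C_R_CompleteNormedModule)). intros t Ht. apply H.
  unfold between. lra.
Qed.

Lemma rect_int_ext (f g : C -> C) (x1 x2 y1 y2 : R) :
  (forall u v, on_bdry x1 x2 y1 y2 u v -> f (u, v) = g (u, v)) ->
  rect_int f x1 x2 y1 y2 = rect_int g x1 x2 y1 y2.
Proof.
  intros H. unfold rect_int. f_equal; [|f_equal]; apply CInt_ext; intros t Ht;
    rewrite !H; try reflexivity; on_bdry_tac.
Qed.

(** * Goursat's theorem *)

Section Bisection.
Variable P : nat -> R -> R -> Prop.
Hypothesis P_quarters : forall n s t,
  let h := (/ 2) ^ S n in
  P (S n) s t -> P (S n) (s + h) t -> P (S n) s (t + h) -> P (S n) (s + h) (t + h) -> P n s t.
Hypothesis P_local : forall s t, 0 <= s <= 1 -> 0 <= t <= 1 ->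
  exists N, forall s' t', 0 <= s' -> s' + (/ 2) ^ N <= 1 -> 0 <= t' -> t' + (/ 2) ^ N <= 1 ->
    s' <= s <= s' + (/ 2) ^ N -> t' <= t <= t' + (/ 2) ^ N -> P N s' t'.

Let good (n : nat) (p : R * R) : Prop :=
  0 <= fst p /\ fst p + (/ 2) ^ n <= 1 /\ 0 <= snd p /\ snd p + (/ 2) ^ n <= 1
  /\ ~ P n (fst p) (snd p).

Let child (n : nat) (p q : R * R) : Prop :=
  fst p <= fst q /\ fst q + (/ 2) ^ S n <= fst p + (/ 2) ^ n /\
  snd p <= snd q /\ snd q + (/ 2) ^ S n <= snd p + (/ 2) ^ n.

Lemma bad_child (n : nat) (p : R * R) : good n p -> exists q, good (S n) q /\ child n p q.
Proof.
  destruct p as [s t]. intros [G1 [G2 [G3 [G4 G5]]]]. simpl in G1, G2, G3, G4, G5.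
  set (h := (/ 2) ^ S n).
  assert (Eh : (/ 2) ^ n = 2 * h) by (unfold h; simpl; field).
  assert (Hh : 0 < h) by (unfold h; apply pow_lt; lra).
  apply NNPP. intros HN. apply G5. apply P_quarters; fold h; apply NNPP; intros HP; apply HN.
  - exists (s, t). unfold good, child. cbn [fst snd]. fold h. rewrite Eh in *.
    repeat split; solve [lra | assumption].
  - exists (s + h, t). unfold good, child. cbn [fst snd]. fold h. rewrite Eh in *.
    repeat split; solve [lra | assumption].
  - exists (s, t + h). unfold good, child. cbn [fst snd]. fold h. rewrite Eh in *.
    repeat split; solve [lra | assumption].
  - exists (s + h, t + h). unfold good, child. cbn [fst snd]. fold h. rewrite Eh in *.
    repeat split; solve [lra | assumption].
Qed.

Lemma nested_limit (x : nat -> R) :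
  (forall n, x n <= x (S n)) ->
  (forall n, x (S n) + (/ 2) ^ S n <= x n + (/ 2) ^ n) ->
  exists l, forall n, x n <= l <= x n + (/ 2) ^ n.
Proof.
  intros Hi Hd.
  assert (Hi' : forall n k, x n <= x (n + k)%nat).
  { intros n k. induction k as [|k IH]; [rewrite Nat.add_0_r; lra|].
    rewrite Nat.add_succ_r. pose proof (Hi (n + k)%nat). lra. }
  assert (Hd' : forall n k, x (n + k)%nat + (/ 2) ^ (n + k) <= x n + (/ 2) ^ n).
  { intros n k. induction k as [|k IH]; [rewrite Nat.add_0_r; lra|].
    rewrite Nat.add_succ_r. pose proof (Hd (n + k)%nat). lra. }
  assert (Hp : forall n, 0 < (/ 2) ^ n) by (intros n; apply pow_lt; lra).
  assert (Hub : forall n m, x m <= x n + (/ 2) ^ n).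
  { intros n m. destruct (Nat.le_gt_cases m n) as [H|H].
    - replace n with (m + (n - m))%nat by lia. pose proof (Hi' m (n - m)%nat).
      pose proof (Hp (m + (n - m))%nat). lra.
    - replace m with (n + (m - n))%nat by lia. pose proof (Hd' n (m - n)%nat).
      pose proof (Hp (n + (m - n))%nat). lra. }
  destruct (completeness (fun r => exists n, r = x n)) as [l [L1 L2]].
  - exists (x 0%nat + (/ 2) ^ 0). intros r [n ->]. apply Hub.
  - now exists (x 0%nat), 0%nat.
  - exists l. intros n. split.
    + apply L1. now exists n.
    + apply L2. intros r [m ->]. apply Hub.
Qed.

(** A square where P fails has a quarter where P fails; iterating, the corners of the
    nested quarters converge to a point at which [P_local] is contradicted. *)
Lemma bisection : P 0 0 0.
Proof.
  apply NNPP. intros HN.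
  assert (G0 : good 0 (0, 0)) by (unfold good; simpl; repeat split; solve [lra | assumption]).
  set (next := fun (n : nat) (p : {p | good n p}) =>
    constructive_indefinite_description _ (bad_child n (proj1_sig p) (proj2_sig p))).
  set (sq := fix sq (n : nat) : {p | good n p} :=
    match n return {p | good n p} with
    | O => exist _ (0, 0) G0
    | S m => exist _ (proj1_sig (next m (sq m))) (proj1 (proj2_sig (next m (sq m))))
    end).
  set (x := fun n => fst (proj1_sig (sq n))). set (y := fun n => snd (proj1_sig (sq n))).
  assert (Hc : forall n, child n (proj1_sig (sq n)) (proj1_sig (sq (S n))))
    by (intros n; exact (proj2 (proj2_sig (next n (sq n))))).
  assert (Hg : forall n, good n (proj1_sig (sq n))) by (intros n; exact (proj2_sig (sq n))).
  destruct (nested_limit x) as [s Hs]; [intros n; apply (Hc n)..|].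
  destruct (nested_limit y) as [t Ht]; [intros n; apply (Hc n)..|].
  destruct (P_local s t) as [N HP].
  - pose proof (Hs 0%nat) as H0. unfold x in H0. simpl in H0. lra.
  - pose proof (Ht 0%nat) as H0. unfold y in H0. simpl in H0. lra.
  - destruct (Hg N) as [A1 [A2 [A3 [A4 A5]]]]. apply A5. apply HP; auto.
    + apply Hs.
    + apply Ht.
Qed.
End Bisection.

Lemma pow_half_small (e : R) : 0 < e -> exists N, (/ 2) ^ N < e.
Proof.
  intros He. destruct (pow_lt_1_zero (/ 2)) with (y := e) as [N HN]; [|exact He|].
  - rewrite Rabs_pos_eq; lra.
  - exists N. specialize (HN N (le_n N)). rewrite Rabs_pos_eq in HN; [exact HN|].
    apply pow_le. lra.
Qed.

Lemma between_affine_dist (a A s s' h u : R) : 0 < h -> s' <= s <= s' + h ->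
  between (a + A * s') (a + A * (s' + h)) u -> Rabs (u - (a + A * s)) <= Rabs A * h.
Proof.
  intros Hh Hs Hu. unfold between, Rmin, Rmax in Hu. unfold Rabs at 2.
  apply Rabs_le. destruct Rle_dec; destruct Rcase_abs; nra.
Qed.

(** The bound eps * (side)^2 on the unit square follows by bisection: it adds up over
    the four quarters, and it holds near each point because f is there affine up to a
    small multiple of the side. Sub-rectangles are described by coordinates s, t in
    [0,1], so that degenerate and reversed rectangles need no separate treatment. *)
Lemma rect_int_goursat (f : C -> C) (x1 x2 y1 y2 : R) :
  (forall u v, between x1 x2 u -> between y1 y2 v -> exists l, cdiff f (u, v) l) ->
  rect_int f x1 x2 y1 y2 = 0.
Proof.
  intros Hf. apply Cmod_eq_0. apply Rle_antisym; [|apply Cmod_ge_0].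
  apply le_epsilon. intros eps He. rewrite Rplus_0_l.
  set (X := x2 - x1). set (Y := y2 - y1). set (L := Rabs X + Rabs Y + 1).
  pose proof (Rabs_pos X) as PX. pose proof (Rabs_pos Y) as PY.
  assert (PL : 0 < L) by (unfold L; lra).
  set (e := eps / (2 * L * L)).
  assert (Pe : 0 < e) by (apply Rdiv_lt_0_compat; [lra|]; apply Rmult_lt_0_compat; lra).
  set (sub := fun n s t => rect_int f (x1 + X * s) (x1 + X * (s + (/ 2) ^ n))
                               (y1 + Y * t) (y1 + Y * (t + (/ 2) ^ n))).
  assert (Bx : forall s, 0 <= s <= 1 -> between x1 x2 (x1 + X * s)).
  { intros s Hs. unfold X. unfold between, Rmin, Rmax. destruct (Rle_dec x1 x2); nra. }
  assert (By : forall s, 0 <= s <= 1 -> between y1 y2 (y1 + Y * s)).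
  { intros s Hs. unfold Y. unfold between, Rmin, Rmax. destruct (Rle_dec y1 y2); nra. }
  assert (Hp : forall n, 0 < (/ 2) ^ n) by (intros n; apply pow_lt; lra).
  assert (Hcont : forall n s t, 0 <= s -> s + (/ 2) ^ n <= 1 -> 0 <= t -> t + (/ 2) ^ n <= 1 ->
    cont_on_rect f (x1 + X * s) (x1 + X * (s + (/ 2) ^ n)) (y1 + Y * t) (y1 + Y * (t + (/ 2) ^ n))).
  { intros n s t S1 S2 T1 T2 u v Hu Hv.
    pose proof (Hp n).
    pose proof (Bx s ltac:(lra)). pose proof (Bx (s + (/ 2) ^ n) ltac:(lra)).
    pose proof (By t ltac:(lra)). pose proof (By (t + (/ 2) ^ n) ltac:(lra)).
    destruct (Hf u v) as [l Hl]; [between_tac..|]. now apply cdiff_ccont with l. }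
  assert (Hmain : 0 <= 0 -> 0 + (/ 2) ^ 0 <= 1 -> 0 <= 0 -> 0 + (/ 2) ^ 0 <= 1 ->
    Cmod (sub 0%nat 0 0) <= eps * (/ 2) ^ 0 * (/ 2) ^ 0).
  { apply (bisection (fun n s t => 0 <= s -> s + (/ 2) ^ n <= 1 -> 0 <= t ->
      t + (/ 2) ^ n <= 1 -> Cmod (sub n s t) <= eps * (/ 2) ^ n * (/ 2) ^ n)).
    - intros n s t h P1 P2 P3 P4 S1 S2 T1 T2.
      assert (Eh : (/ 2) ^ n = 2 * h) by (unfold h; simpl; field).
      assert (Hh : 0 < h) by apply Hp.
      fold h in P1, P2, P3, P4. rewrite Eh in S2, T2.
      specialize (P1 ltac:(lra) ltac:(lra) ltac:(lra) ltac:(lra)).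
      specialize (P2 ltac:(lra) ltac:(lra) ltac:(lra) ltac:(lra)).
      specialize (P3 ltac:(lra) ltac:(lra) ltac:(lra) ltac:(lra)).
      specialize (P4 ltac:(lra) ltac:(lra) ltac:(lra) ltac:(lra)).
      set (A := sub (S n) s t) in *. set (B := sub (S n) (s + h) t) in *.
      set (A' := sub (S n) s (t + h)) in *. set (B' := sub (S n) (s + h) (t + h)) in *.
      assert (E : sub n s t = (A + B + (A' + B'))%C).
      { assert (Btw : forall a D r, between (a + D * r) (a + D * (r + 2 * h)) (a + D * (r + h)))
          by (intros; unfold between, Rmin, Rmax; destruct Rle_dec; nra).
        assert (Hr := Hcont n s t S1 ltac:(lra) T1 ltac:(lra)).
        unfold A, B, A', B', sub. fold h. rewrite Eh in *.
        replace (s + h + h) with (s + 2 * h) by ring.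
        replace (t + h + h) with (t + 2 * h) by ring.
        rewrite (rect_int_split_y f _ _ _ (y1 + Y * (t + h)) _); [|apply Btw|exact Hr].
        pose proof (Btw y1 Y t).
        f_equal; apply rect_int_split_x; try apply Btw; intros u v Hu Hv;
          (apply Hr; [exact Hu|between_tac]). }
      rewrite E. rewrite Eh.
      eapply Rle_trans; [apply Cmod_triangle|].
      eapply Rle_trans; [apply Rplus_le_compat; apply Cmod_triangle|]. nra.
    - intros s t Hs Ht. set (p := (x1 + X * s, y1 + Y * t) : C).
      destruct (Hf (x1 + X * s) (y1 + Y * t) (Bx s Hs) (By t Ht)) as [l Hl].
      destruct (Hl e Pe) as [d [Hd H1]].
      destruct (pow_half_small (d / L)) as [N HN]; [apply Rdiv_lt_0_compat; lra|].
      exists N. intros s' t' S1 S2 T1 T2 Ss Tt _ _ _ _.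
      set (h := (/ 2) ^ N) in *. pose proof (Hp N) as Hh. fold h in Hh.
      assert (HL : L * h < d).
      { apply (Rmult_lt_compat_l L) in HN; [|lra].
        replace (L * (d / L)) with d in HN by (field; lra). exact HN. }
      unfold sub. eapply Rle_trans; [apply rect_int_near_affine with (al := f p) (l := l) (p := p) (e := e * (L * h))|].
      + apply cont_on_rect_cont_on_bdry. apply (Hcont N); assumption.
      + intros u v [Hu [Hv _]].
        assert (Dist : Cmod ((u, v) - p) <= L * h).
        { unfold p. rewrite Cpair_minus. eapply Rle_trans; [apply Cmod_pair_le|].
          pose proof (between_affine_dist x1 X s s' h u Hh Ss Hu).
          pose proof (between_affine_dist y1 Y t t' h v Hh Tt Hv).
          unfold L. nra. }
        replace (f (u, v) - (f p + l * ((u, v) - p)))%C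
          with (f (u, v) - f p - l * ((u, v) - p))%C by ring.
        eapply Rle_trans; [apply H1; eapply Rle_lt_trans; [exact Dist|exact HL]|].
        apply Rmult_le_compat_l; [lra|exact Dist].
      + replace (x1 + X * (s' + (/ 2) ^ N) - (x1 + X * s')) with (X * h) by (unfold h; ring).
        replace (y1 + Y * (t' + (/ 2) ^ N) - (y1 + Y * t')) with (Y * h) by (unfold h; ring).
        rewrite !Rabs_mult, (Rabs_pos_eq h) by lra.
        apply Rle_trans with (2 * (e * (L * h)) * (L * h)).
        * assert (0 < L * h) by (apply Rmult_lt_0_compat; lra).
          assert (0 < e * (L * h)) by (apply Rmult_lt_0_compat; lra).
          apply Rmult_le_compat_l; [lra|]. unfold L. lra.
        * right. unfold e. field. lra. }
  specialize (Hmain ltac:(lra) ltac:(simpl; lra) ltac:(lra) ltac:(simpl; lra)).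
  unfold sub in Hmain. simpl in Hmain.
  replace (x1 + X * 0) with x1 in Hmain by ring. replace (y1 + Y * 0) with y1 in Hmain by ring.
  replace (x1 + X * (0 + 1)) with x2 in Hmain by (unfold X; ring).
  replace (y1 + Y * (0 + 1)) with y2 in Hmain by (unfold Y; ring). lra.
Qed.

(** * Exceptional points and primitives *)

Lemma CInt_point (f : R -> C) (a : R) : CInt f a a = 0.
Proof. unfold CInt. rewrite (RInt_point (V := C_R_CompleteNormedModule)). reflexivity. Qed.

Lemma CInt_zero (f : R -> C) (a b : R) : (forall t, f t = 0) -> CInt f a b = 0.
Proof.
  intros H. rewrite (CInt_ext f (fun _ => RtoC 0)) by (intros; apply H).
  rewrite CInt_const. ring.
Qed.

Lemma rect_int_swap_x (f : C -> C) (x1 x2 y1 y2 : R) : cont_on_rect f x1 x2 y1 y2 ->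
  rect_int f x2 x1 y1 y2 = (- rect_int f x1 x2 y1 y2)%C.
Proof.
  intros H. unfold rect_int. rewrite CInt_swap
    by (apply exCInt_minus; apply exCInt_h; intros; apply H; between_tac).
  assert (F : forall x, between x1 x2 x -> exCInt (fun v => f (x, v)) y1 y2)
    by (intros; apply exCInt_v; intros; apply H; between_tac).
  rewrite !(CInt_minus (fun v => f (_, v))) by (apply F; between_tac). ring.
Qed.

Lemma rect_int_swap_y (f : C -> C) (x1 x2 y1 y2 : R) : cont_on_rect f x1 x2 y1 y2 ->
  rect_int f x1 x2 y2 y1 = (- rect_int f x1 x2 y1 y2)%C.
Proof.
  intros H. unfold rect_int. rewrite (CInt_swap _ y1 y2)
    by (apply exCInt_minus; apply exCInt_v; intros; apply H; between_tac).
  assert (F : forall y, between y1 y2 y -> exCInt (fun u => f (u, y)) x1 x2)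
    by (intros; apply exCInt_h; intros; apply H; between_tac).
  rewrite !(CInt_minus (fun u => f (u, _))) by (apply F; between_tac). ring.
Qed.

Lemma rect_int_degenerate_x (f : C -> C) (x y1 y2 : R) : rect_int f x x y1 y2 = 0.
Proof. unfold rect_int. rewrite CInt_point, CInt_zero by (intros; ring). ring. Qed.

Lemma rect_int_degenerate_y (f : C -> C) (x1 x2 y : R) : rect_int f x1 x2 y y = 0.
Proof. unfold rect_int. rewrite CInt_point, CInt_zero by (intros; ring). ring. Qed.

Lemma cont_on_rect_sub (f : C -> C) (x1 x2 y1 y2 a1 a2 b1 b2 : R) :
  cont_on_rect f x1 x2 y1 y2 -> between x1 x2 a1 -> between x1 x2 a2 -> between y1 y2 b1 -> between y1 y2 b2 ->
  cont_on_rect f a1 a2 b1 b2.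
Proof. intros H A1 A2 B1 B2 u v Hu Hv. apply H; between_tac. Qed.

(** By Goursat the integral does not change when the rectangle is shrunk towards the
    exceptional corner, and there it tends to zero because f is bounded. *)
Lemma rect_int_corner (f : C -> C) (px py x y : R) : cont_on_rect f px x py y ->
  (forall u v, between px x u -> between py y v -> (u, v) <> (px, py) -> exists l, cdiff f (u, v) l) ->
  rect_int f px x py y = 0.
Proof.
  intros Hc Hd.
  destruct (Req_dec x px) as [->|Hx]; [apply rect_int_degenerate_x|].
  destruct (Req_dec y py) as [->|Hy]; [apply rect_int_degenerate_y|].
  assert (Cut : forall a b s, 0 < s <= 1 -> between a b (a + s * (b - a))).
  { intros a b s Hs. unfold between, Rmin, Rmax. destruct (Rle_dec a b); nra. }
  assert (Off : forall a b s u, b <> a -> 0 < s <= 1 -> between (a + s * (b - a)) b u -> u <> a).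
  { intros a b s u Hab Hs Hu ->. unfold between, Rmin, Rmax in Hu.
    destruct (Rdichotomy _ _ Hab); destruct Rle_dec; nra. }
  assert (E : forall s, 0 < s <= 1 ->
    rect_int f px x py y = rect_int f px (px + s * (x - px)) py (py + s * (y - py))).
  { intros s Hs. pose proof (Cut px x s Hs) as Hxs. pose proof (Cut py y s Hs) as Hys.
    pose proof (Off px x s) as Ox. pose proof (Off py y s) as Oy.
    set (xs := px + s * (x - px)) in *. set (ys := py + s * (y - py)) in *.
    rewrite (rect_int_split_x f px xs x) by assumption.
    rewrite (rect_int_split_y f px xs py ys y)
      by (try assumption; apply (cont_on_rect_sub f px x py y); auto; between_tac).
    rewrite (rect_int_goursat f xs x py y), (rect_int_goursat f px xs ys y); [ring| |].
    - intros u v Hu Hv. apply Hd; [between_tac|between_tac|]. intros [= -> ->].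
      now apply (Oy py).
    - intros u v Hu Hv. apply Hd; [between_tac|between_tac|]. intros [= -> ->].
      now apply (Ox px). }
  apply Cmod_eq_0. apply Rle_antisym; [|apply Cmod_ge_0].
  destruct (Hc px py (between_l _ _) (between_l _ _) 1 Rlt_0_1) as [d [Hd0 Hb]].
  set (L := Rabs (x - px) + Rabs (y - py)).
  pose proof (Rabs_pos_lt (x - px) ltac:(lra)). pose proof (Rabs_pos_lt (y - py) ltac:(lra)).
  assert (PL : 0 < L) by (unfold L; lra).
  set (B := Cmod (f (px, py)) + 1).
  assert (PB : 1 <= B) by (unfold B; pose proof (Cmod_ge_0 (f (px, py))); lra).
  apply le_epsilon. intros eps He. rewrite Rplus_0_l.
  set (s := Rmin 1 (Rmin (d / (2 * L)) (eps / (2 * B * L)))).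
  assert (0 < d / (2 * L)) by (apply Rdiv_lt_0_compat; lra).
  assert (HBL : 0 < B * L) by (apply Rmult_lt_0_compat; lra).
  assert (0 < eps / (2 * B * L)) by (apply Rdiv_lt_0_compat; lra).
  assert (Hs : 0 < s <= 1) by (unfold s; split; [repeat apply Rmin_pos; lra|apply Rmin_l]).
  assert (S1 : s <= d / (2 * L)) by (unfold s; eapply Rle_trans; [apply Rmin_r|apply Rmin_l]).
  assert (S2 : s <= eps / (2 * B * L)) by (unfold s; eapply Rle_trans; [apply Rmin_r|apply Rmin_r]).
  rewrite (E s Hs).
  eapply Rle_trans; [apply rect_int_bound with (B := B)|].
  - apply cont_on_rect_cont_on_bdry. apply (cont_on_rect_sub f px x py y); auto; try between_tac; now apply Cut.
  - intros u v [Hu [Hv _]].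
    assert (D : Cmod ((u, v) - (px, py)) <= s * L).
    { rewrite Cpair_minus. eapply Rle_trans; [apply Cmod_pair_le|].
      assert (W : forall a b w, between a (a + s * (b - a)) w -> Rabs (w - a) <= s * Rabs (b - a)).
      { intros a b w Hw. rewrite <- (Rabs_pos_eq s) by lra. rewrite <- Rabs_mult.
        unfold between, Rmin, Rmax in Hw. unfold Rabs. 
        destruct Rle_dec; repeat destruct Rcase_abs; lra. }
      pose proof (W _ _ _ Hu). pose proof (W _ _ _ Hv). unfold L. lra. }
    assert (D2 : s * L < d).
    { apply (Rmult_le_compat_r L) in S1; [|lra].
      replace (d / (2 * L) * L) with (d / 2) in S1 by (field; lra). lra. }
    specialize (Hb (u, v) ltac:(lra)).
    pose proof (Cmod_sub_ge (f (u, v)) (f (px, py))). unfold B. lra.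
  - replace (px + s * (x - px) - px) with (s * (x - px)) by ring.
    replace (py + s * (y - py) - py) with (s * (y - py)) by ring.
    rewrite !Rabs_mult, (Rabs_pos_eq s) by lra.
    replace (2 * B * (s * Rabs (x - px) + s * Rabs (y - py))) with (s * (2 * B * L))
      by (unfold L; ring).
    replace eps with (eps / (2 * B * L) * (2 * B * L)) by (field; lra).
    apply Rmult_le_compat_r; lra.
Qed.

(** The point p cuts the rectangle into four rectangles having p as a corner. *)
Lemma rect_int_goursat_except (f : C -> C) (p : C) (x1 x2 y1 y2 : R) : cont_on_rect f x1 x2 y1 y2 ->
  (forall u v, between x1 x2 u -> between y1 y2 v -> (u, v) <> p -> exists l, cdiff f (u, v) l) ->
  rect_int f x1 x2 y1 y2 = 0.
Proof.
  destruct p as [px py]. intros Hc Hd.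
  destruct (classic (between x1 x2 px /\ between y1 y2 py)) as [[Hx Hy]|Hn].
  - assert (K : forall x y, between x1 x2 x -> between y1 y2 y -> rect_int f px x py y = 0).
    { intros x y Bx By. apply rect_int_corner.
      - apply (cont_on_rect_sub f x1 x2 y1 y2); auto.
      - intros u v Hu Hv Hne. apply Hd; [between_tac|between_tac|exact Hne]. }
    assert (S : forall a b c d, between x1 x2 a -> between x1 x2 b -> between y1 y2 c -> between y1 y2 d ->
      cont_on_rect f a b c d) by (intros; apply (cont_on_rect_sub f x1 x2 y1 y2); auto).
    rewrite (rect_int_split_x f x1 px x2) by auto.
    rewrite (rect_int_split_y f x1 px y1 py y2), (rect_int_split_y f px x2 y1 py y2)
      by (auto; apply S; between_tac).
    rewrite (rect_int_swap_x f px x1 y1 py), (rect_int_swap_x f px x1 py y2), (rect_int_swap_y f px x1 py y1),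
      (rect_int_swap_y f px x2 py y1) by (apply S; between_tac).
    rewrite !K by between_tac. ring.
  - apply rect_int_goursat. intros u v Hu Hv. apply Hd; auto. intros [= -> ->]. now apply Hn.
Qed.

(** The shape of domain for which integration along an L-shaped path from a defines a
    primitive; disks about a and the half plane are examples. *)
Definition rect_star (U : C -> Prop) (a : C) : Prop :=
  U a /\ forall z, U z -> forall u v, between (fst a) (fst z) u -> between (snd a) (snd z) v -> U (u, v).

(** The primitive is the integral along the horizontal and then the vertical segment from
    a. Comparing its values at z and w leaves, by Goursat, the integral along an L-shaped
    path from z to w, where f is nearly f z. The exceptional point p makes the
    statement applicable to divided differences. *)
Lemma primitive_except (U : C -> Prop) (a p : C) (f : C -> C) : copen U -> rect_star U a ->
  (forall z, U z -> ccont f z) -> (forall z, U z -> z <> p -> exists l, cdiff f z l) ->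
  exists F, forall z, U z -> cdiff F z (f z).
Proof.
  intros Ho [Ha Hstar] Hc Hd. destruct a as [x0 y0]. simpl in Hstar.
  exists (fun z => CInt (fun u => f (u, y0)) x0 (fst z) + Ci * CInt (fun v => f (fst z, v)) y0 (snd z))%C.
  intros [x y] Hz eps He.
  destruct (Hc _ Hz (eps / 2)) as [d1 [Hd1 C1]]; [lra|].
  destruct (Ho _ Hz) as [d2 [Hd2 O1]].
  exists (Rmin d1 d2 / 2). split; [pose proof (Rmin_pos _ _ Hd1 Hd2); lra|].
  intros [x' y'] Hw. cbn [fst snd].
  assert (Hx : Rabs (x' - x) <= Cmod ((x', y') - (x, y)))
    by exact (re_le_Cmod ((x', y') - (x, y))).
  assert (Hy : Rabs (y' - y) <= Cmod ((x', y') - (x, y)))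
    by exact (Rabs_Im_le_Cmod ((x', y') - (x, y))).
  set (D := Cmod ((x', y') - (x, y))) in *.
  pose proof (Rmin_l d1 d2) as M1. pose proof (Rmin_r d1 d2) as M2.
  assert (Near : forall u v, between x x' u -> between y y' v ->
     Cmod ((u, v) - (x, y)) < d1 /\ Cmod ((u, v) - (x, y)) < d2).
  { intros u v Hu Hv.
    assert (Cmod ((u, v) - (x, y)) <= 2 * D); [|lra].
    rewrite Cpair_minus. eapply Rle_trans; [apply Cmod_pair_le|].
    assert (W : forall a b w, between a b w -> Rabs (w - a) <= Rabs (b - a)).
    { intros a b w Hw'. unfold between, Rmin, Rmax in Hw'. unfold Rabs.
      destruct Rle_dec; repeat destruct Rcase_abs; lra. }
    pose proof (W _ _ _ Hu). pose proof (W _ _ _ Hv). lra. }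
  assert (UN : forall u v, between x x' u -> between y y' v -> U (u, v))
    by (intros u v Hu Hv; apply O1; now apply Near).
  assert (U1 : forall u v, between x x' u -> between y0 y v -> U (u, v)).
  { intros u v Hu Hv. apply (Hstar (u, y)); [apply UN; between_tac|simpl; between_tac|exact Hv]. }
  assert (U2 : forall u v, between x0 x u -> between y0 y v -> U (u, v)).
  { intros u v Hu Hv. apply (Hstar (x, y)); assumption. }
  (* the two L-shaped paths from the centre to (x, y) and to (x', y) differ by this rectangle *)
  assert (R0 : rect_int f x x' y0 y = 0).
  { apply rect_int_goursat_except with p.
    - intros u v Hu Hv. apply Hc, U1; assumption.
    - intros u v Hu Hv. apply Hd, U1; assumption. }
  unfold rect_int in R0.
  assert (Eh : forall v, between y0 y v -> exCInt (fun u => f (u, v)) x x').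
  { intros v Hv. apply exCInt_h. intros u Hu. apply Hc, U1; assumption. }
  assert (Ev : forall u, between x x' u -> exCInt (fun v => f (u, v)) y0 y).
  { intros u Hu. apply exCInt_v. intros v Hv. apply Hc, U1; assumption. }
  rewrite !CInt_minus in R0 by (first [apply Eh|apply Ev]; between_tac).
  rewrite <- (CInt_Chasles (fun u => f (u, y0)) x0 x x').
  2: { apply exCInt_h. intros u Hu. apply Hc, U2; [exact Hu|between_tac]. }
  2: { apply Eh. between_tac. }
  rewrite <- (CInt_Chasles (fun v => f (x', v)) y0 y y').
  2: { apply Ev. between_tac. }
  2: { apply exCInt_v. intros v Hv. apply Hc, UN; [between_tac|exact Hv]. }
  assert (B1 : Cmod (CInt (fun u => f (u, y)) x x' - RtoC (x' - x) * f (x, y))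
      <= Rabs (x' - x) * (eps / 2)).
  { apply CInt_near_const; [apply Eh; between_tac|]. intros u Hu. left. apply C1.
    apply Near; [exact Hu|between_tac]. }
  assert (B2 : Cmod (CInt (fun v => f (x', v)) y y' - RtoC (y' - y) * f (x, y))
      <= Rabs (y' - y) * (eps / 2)).
  { apply CInt_near_const.
    - apply exCInt_v. intros v Hv. apply Hc, UN; [between_tac|exact Hv].
    - intros v Hv. left. apply C1. apply Near; [between_tac|exact Hv]. }
  set (I1 := CInt (fun u => f (u, y0)) x0 x) in *.
  set (I2 := CInt (fun u => f (u, y0)) x x') in *.
  set (I3 := CInt (fun v => f (x', v)) y0 y) in *.
  set (I4 := CInt (fun v => f (x', v)) y y') in *.
  set (I5 := CInt (fun v => f (x, v)) y0 y) in *.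
  set (I6 := CInt (fun u => f (u, y)) x x') in *.
  replace (I1 + I2 + Ci * (I3 + I4) - (I1 + Ci * I5) - f (x, y) * ((x', y') - (x, y)))%C
    with ((I6 - RtoC (x' - x) * f (x, y)) + Ci * (I4 - RtoC (y' - y) * f (x, y)))%C.
  - eapply Rle_trans; [apply Cmod_triangle|]. rewrite Cmod_mult, Cmod_Ci.
    assert (Rabs (x' - x) * (eps / 2) <= D * (eps / 2)) by (apply Rmult_le_compat_r; lra).
    assert (Rabs (y' - y) * (eps / 2) <= D * (eps / 2)) by (apply Rmult_le_compat_r; lra).
    lra.
  - replace ((x', y') - (x, y))%C with (RtoC (x' - x) + Ci * RtoC (y' - y))%C
      by (unfold RtoC, Ci, Cminus, Cmult, Cplus, Copp; simpl; f_equal; ring).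
    assert (R1 : (I2 + Ci * I3 = I6 + Ci * I5)%C).
    { transitivity (I2 - I6 + Ci * (I3 - I5) + (I6 + Ci * I5))%C; [ring|].
      rewrite R0. ring. }
    transitivity ((I2 + Ci * I3) - Ci * I5 + Ci * I4 - f (x, y) * (RtoC (x' - x) + Ci * RtoC (y' - y)))%C;
      [rewrite R1|]; ring.
Qed.

Lemma holo_primitive (U : C -> Prop) (a : C) (f : C -> C) : copen U -> rect_star U a -> holo U f ->
  exists F, forall z, U z -> cdiff F z (f z).
Proof.
  intros Ho Ha Hf. apply primitive_except with (a := a) (p := a); auto.
  intros z Hz. now apply holo_ccont with U.
Qed.

(** * Cauchy's formula on squares *)

Definition sq_int (f : C -> C) (a : C) (r : R) : C :=
  rect_int f (fst a - r) (fst a + r) (snd a - r) (snd a + r).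

Definition sq_bdry (a : C) (r : R) (z : C) : Prop :=
  on_bdry (fst a - r) (fst a + r) (snd a - r) (snd a + r) (fst z) (snd z).

Lemma sq_bdry_dist (a : C) (r : R) (z : C) : 0 < r -> sq_bdry a r z ->
  r <= Cmod (z - a) < 3 * r.
Proof.
  intros Hr [Hu [Hv Hb]]. destruct a as [x0 y0], z as [x y]. simpl in *.
  assert (Hx : Rabs (x - x0) <= r) by (apply Rabs_le; between_tac).
  assert (Hy : Rabs (y - y0) <= r) by (apply Rabs_le; between_tac).
  assert (Dx : Rabs (x - x0) <= Cmod ((x, y) - (x0, y0)))
    by exact (re_le_Cmod ((x, y) - (x0, y0))).
  assert (Dy : Rabs (y - y0) <= Cmod ((x, y) - (x0, y0)))
    by exact (Rabs_Im_le_Cmod ((x, y) - (x0, y0))).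
  split.
  - destruct Hb as [->|[->|[->| ->]]].
    + eapply Rle_trans; [|exact Dx]. rewrite Rabs_left; lra.
    + eapply Rle_trans; [|exact Dx]. rewrite Rabs_pos_eq; lra.
    + eapply Rle_trans; [|exact Dy]. rewrite Rabs_left; lra.
    + eapply Rle_trans; [|exact Dy]. rewrite Rabs_pos_eq; lra.
  - rewrite Cpair_minus. eapply Rle_lt_trans; [apply Cmod_pair_le|]. lra.
Qed.

Lemma sq_dist (a : C) (r u v : R) : 0 < r ->
  between (fst a - r) (fst a + r) u -> between (snd a - r) (snd a + r) v ->
  Cmod ((u, v) - a) < 3 * r.
Proof.
  intros Hr Hu Hv. destruct a as [x0 y0]. simpl in *.
  assert (Hx : Rabs (u - x0) <= r) by (apply Rabs_le; between_tac).
  assert (Hy : Rabs (v - y0) <= r) by (apply Rabs_le; between_tac).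
  rewrite Cpair_minus. eapply Rle_lt_trans; [apply Cmod_pair_le|]. lra.
Qed.

Lemma sq_int_bound (f : C -> C) (a : C) (r B : R) : 0 < r ->
  (forall z, sq_bdry a r z -> ccont f z) -> (forall z, sq_bdry a r z -> Cmod (f z) <= B) ->
  Cmod (sq_int f a r) <= 8 * r * B.
Proof.
  intros Hr Hc HB. unfold sq_int. eapply Rle_trans; [apply rect_int_bound with (B := B)|].
  - intros u v H. now apply Hc.
  - intros u v H. now apply HB.
  - right. replace (fst a + r - (fst a - r)) with (2 * r) by ring.
    replace (snd a + r - (snd a - r)) with (2 * r) by ring. rewrite Rabs_pos_eq by lra. ring.
Qed.

Lemma sq_int_linear (f g : C -> C) (c d a : C) (r : R) :
  (forall z, sq_bdry a r z -> ccont f z) -> (forall z, sq_bdry a r z -> ccont g z) ->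
  sq_int (fun z => c * f z + d * g z)%C a r = (c * sq_int f a r + d * sq_int g a r)%C.
Proof.
  intros Hf Hg. unfold sq_int. apply rect_int_linear; intros u v H;
    [exact (Hf (u, v) H)|exact (Hg (u, v) H)].
Qed.

Lemma sq_int_ext (f g : C -> C) (a : C) (r : R) :
  (forall z, sq_bdry a r z -> f z = g z) -> sq_int f a r = sq_int g a r.
Proof. intros H. unfold sq_int. apply rect_int_ext. intros u v Huv. now apply H. Qed.

Lemma ccont_shift_inv (w z : C) : z <> w -> ccont (fun y => / (y - w))%C z.
Proof.
  intros H. eapply cdiff_ccont. apply (cdiff_inv (fun y => y - w)%C); [|now apply Csub_neq0].
  apply cdiff_minus; [apply cdiff_id|apply cdiff_const].
Qed.

(** On each pair of opposite sides the integrand is, up to a factor i, the real number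
    2r/(s^2 + r^2), which lies between 1/r and 2/r. *)
Lemma sq_int_winding (a : C) (r : R) : 0 < r -> 4 <= Cmod (sq_int (fun z => / (z - a))%C a r).
Proof.
  intros Hr. destruct a as [x0 y0]. unfold sq_int, rect_int. cbn [fst snd].
  assert (Ht : forall t x, between (x - r) (x + r) t -> Rabs (t - x) <= r)
    by (intros; apply Rabs_le; between_tac).
  assert (Cc : forall u v, between (x0 - r) (x0 + r) u -> between (y0 - r) (y0 + r) v ->
     (u = x0 - r \/ u = x0 + r \/ v = y0 - r \/ v = y0 + r) ->
     ccont (fun z => / (z - (x0, y0)))%C (u, v)).
  { intros u v Hu Hv Hb. apply ccont_shift_inv. intros [= -> ->]. lra. }
  assert (K : forall s, Rabs s <= r ->
    Cmod (RtoC (2 * r / (s * s + r * r)) - RtoC (3 / (2 * r))) <= 1 / (2 * r)).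
  { intros s Hs. rewrite <- RtoC_minus, Cmod_R.
    assert (s * s <= r * r) by (apply Rsqr_le_abs_1; rewrite (Rabs_pos_eq r); lra).
    assert (0 <= s * s) by apply Rle_0_sqr.
    assert (0 < r * r) by (apply Rmult_lt_0_compat; lra).
    assert (E : r * r <= s * s + r * r <= 2 * (r * r)) by lra.
    assert (Pq : 0 < 2 * r * (s * s + r * r)) by (apply Rmult_lt_0_compat; lra).
    apply Rabs_le. split.
    - apply (Rmult_le_reg_r (2 * r * (s * s + r * r))); [exact Pq|].
      replace (- (1 / (2 * r)) * (2 * r * (s * s + r * r))) with (- (s * s + r * r)) by (field; lra).
      replace ((2 * r / (s * s + r * r) - 3 / (2 * r)) * (2 * r * (s * s + r * r)))
        with (4 * (r * r) - 3 * (s * s + r * r)) by (field; lra). lra.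
    - apply (Rmult_le_reg_r (2 * r * (s * s + r * r))); [exact Pq|].
      replace ((1 / (2 * r)) * (2 * r * (s * s + r * r))) with ((s * s + r * r)) by (field; lra).
      replace ((2 * r / (s * s + r * r) - 3 / (2 * r)) * (2 * r * (s * s + r * r)))
        with (4 * (r * r) - 3 * (s * s + r * r)) by (field; lra). lra. }
  assert (N : forall s t : R, s <> 0 \/ t <> 0 -> (RtoC s + Ci * RtoC t)%C <> 0).
  { intros s t H E. apply (f_equal fst) in E as E1. apply (f_equal snd) in E as E2.
    unfold RtoC, Ci in E1, E2. simpl in E1, E2. lra. }
  assert (SQ : forall s, (RtoC (s * s + r * r) = (RtoC s + Ci * RtoC r) * (RtoC s - Ci * RtoC r))%C).
  { intros s. unfold RtoC, Ci, Cminus, Cmult, Cplus, Copp; simpl; f_equal; ring. }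
  assert (N2 : forall s, (RtoC s - Ci * RtoC r)%C <> 0).
  { intros s. replace (RtoC s - Ci * RtoC r)%C with (RtoC s + Ci * RtoC (- r))%C
      by (rewrite RtoC_opp; ring). apply N. right. lra. }
  assert (B1 : Cmod (CInt (fun u => / ((u, (y0 - r)%R) - (x0, y0)) - / ((u, (y0 + r)%R) - (x0, y0)))%C
       (x0 - r) (x0 + r) - RtoC (x0 + r - (x0 - r)) * (Ci * RtoC (3 / (2 * r))))
       <= Rabs (x0 + r - (x0 - r)) * (1 / (2 * r))).
  { apply CInt_near_const.
    - apply exCInt_minus; apply (exCInt_h (fun z => / (z - (x0, y0)))%C); intros u Hu; apply Cc; auto; between_tac.
    - intros u Hu. specialize (K (u - x0) (Ht _ _ Hu)). set (s := u - x0) in *.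
      replace ((u, (y0 - r)%R) - (x0, y0))%C with (RtoC s - Ci * RtoC r)%C
        by (unfold s, RtoC, Ci, Cminus, Cmult, Cplus, Copp; simpl; f_equal; ring).
      replace ((u, (y0 + r)%R) - (x0, y0))%C with (RtoC s + Ci * RtoC r)%C
        by (unfold s, RtoC, Ci, Cminus, Cmult, Cplus, Copp; simpl; f_equal; ring).
      replace (/ (RtoC s - Ci * RtoC r) - / (RtoC s + Ci * RtoC r) - Ci * RtoC (3 / (2 * r)))%C
        with (Ci * (RtoC (2 * r / (s * s + r * r)) - RtoC (3 / (2 * r))))%C.
      + rewrite Cmod_mult, Cmod_Ci, Rmult_1_l. exact K.
      + rewrite RtoC_div by (apply Rgt_not_eq; pose proof (Rle_0_sqr s); unfold Rsqr in *; nra). rewrite SQ, RtoC_mult. field.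
        split; first [apply N2 | apply N; right; lra]. }
  assert (B2 : Cmod (CInt (fun v => / (((x0 + r)%R, v) - (x0, y0)) - / (((x0 - r)%R, v) - (x0, y0)))%C
       (y0 - r) (y0 + r) - RtoC (y0 + r - (y0 - r)) * (RtoC (3 / (2 * r))))
       <= Rabs (y0 + r - (y0 - r)) * (1 / (2 * r))).
  { apply CInt_near_const.
    - apply exCInt_minus; apply (exCInt_v (fun z => / (z - (x0, y0)))%C); intros u Hu; apply Cc; auto; between_tac.
    - intros u Hu. specialize (K (u - y0) (Ht _ _ Hu)). set (s := u - y0) in *.
      replace (((x0 + r)%R, u) - (x0, y0))%C with (Ci * (RtoC s - Ci * RtoC r))%C
        by (unfold s, RtoC, Ci, Cminus, Cmult, Cplus, Copp; simpl; f_equal; ring).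
      replace (((x0 - r)%R, u) - (x0, y0))%C with (Ci * (RtoC s + Ci * RtoC r))%C
        by (unfold s, RtoC, Ci, Cminus, Cmult, Cplus, Copp; simpl; f_equal; ring).
      replace (/ (Ci * (RtoC s - Ci * RtoC r)) - / (Ci * (RtoC s + Ci * RtoC r)) - RtoC (3 / (2 * r)))%C
        with (RtoC (2 * r / (s * s + r * r)) - RtoC (3 / (2 * r)))%C; [exact K|].
      rewrite RtoC_div by (apply Rgt_not_eq; pose proof (Rle_0_sqr s); unfold Rsqr in *; nra). rewrite SQ, RtoC_mult. field.
      repeat split; first [apply N2 | apply N; right; lra
        | intros E; apply (f_equal snd) in E; simpl in E; lra]. }
  set (I1 := CInt _ (x0 - r) (x0 + r)) in *. set (I2 := CInt _ (y0 - r) (y0 + r)) in *.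
  replace (x0 + r - (x0 - r)) with (2 * r) in B1 by ring.
  replace (y0 + r - (y0 - r)) with (2 * r) in B2 by ring.
  rewrite Rabs_pos_eq in B1, B2 by lra.
  replace (2 * r * (1 / (2 * r))) with 1 in B1, B2 by (field; lra).
  assert (E3 : (RtoC (2 * r) * RtoC (3 / (2 * r)) = RtoC 3)%C)
    by (rewrite <- RtoC_mult; f_equal; field; lra).
  replace (RtoC (2 * r) * (Ci * RtoC (3 / (2 * r))))%C with (Ci * RtoC 3)%C in B1 by (rewrite <- E3; ring).
  rewrite E3 in B2.
  pose proof (Cmod_sub_ge (Ci * RtoC 6) (- ((I1 - Ci * RtoC 3) + Ci * (I2 - RtoC 3)))%C) as G.
  rewrite Cmod_mult, Cmod_Ci, Cmod_R, Rabs_pos_eq in G by lra.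
  rewrite Cmod_opp in G.
  pose proof (Cmod_triangle (I1 - Ci * RtoC 3) (Ci * (I2 - RtoC 3))) as G2.
  rewrite (Cmod_mult Ci), Cmod_Ci in G2.
  replace (I1 + Ci * I2)%C with (Ci * RtoC 6 - - ((I1 - Ci * RtoC 3) + Ci * (I2 - RtoC 3)))%C; [lra|].
  replace (RtoC 6) with (RtoC 3 + RtoC 3)%C by (rewrite <- RtoC_plus; f_equal; ring). ring.
Qed.

Lemma slope_cdiff (f : C -> C) (a z l : C) : z <> a -> cdiff f z l ->
  exists m, cdiff (slope f a) z m.
Proof.
  intros Hn H. eexists.
  apply cdiff_ext_loc with (f := (fun w => (f w - f a) / (w - a))%C) (r := Cmod (z - a)).
  - now apply Cmod_sub_pos.
  - intros w Hw. symmetry. apply slope_neq. intros ->. rewrite Cmod_sub_sym in Hw. lra.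
  - apply (cdiff_div (fun w => f w - f a)%C (fun w => w - a)%C).
    + now apply Csub_neq0.
    + apply cdiff_minus; [exact H|apply cdiff_const].
    + apply cdiff_minus; [apply cdiff_id|apply cdiff_const].
Qed.

Lemma slope_ccont_on (U : C -> Prop) (f : C -> C) (a : C) : U a -> holo U f ->
  forall z, U z -> ccont (slope f a) z.
Proof.
  intros Ha H z Hz. destruct (H z Hz) as [l Hl].
  destruct (classic (z = a)) as [->|Hn]; [now apply slope_ccont with l|].
  destruct (slope_cdiff f a z l Hn Hl) as [m Hm]. now apply cdiff_ccont with m.
Qed.

(** Goursat with exceptional point z, applied to the divided difference of f at z. *)
Lemma cauchy_formula (f : C -> C) (a z : C) (r : R) : 0 < r ->
  holo (cball a (3 * r)) f -> Cmod (z - a) < r ->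
  (f z * sq_int (fun y => / (y - z)) a r = sq_int (fun y => f y * / (y - z)) a r)%C.
Proof.
  intros Hr Hf Hz.
  assert (Uz : cball a (3 * r) z) by (unfold cball; lra).
  assert (Z : sq_int (slope f z) a r = 0).
  { unfold sq_int. apply rect_int_goursat_except with z.
    - intros u v Hu Hv. apply slope_ccont_on with (cball a (3 * r)); auto. now apply sq_dist.
    - intros u v Hu Hv Hn. destruct (Hf (u, v)) as [l Hl]; [now apply sq_dist|].
      now apply slope_cdiff with l. }
  assert (Hne : forall y, sq_bdry a r y -> y <> z).
  { intros y Hy ->. apply sq_bdry_dist in Hy; lra. }
  assert (C1 : forall y, sq_bdry a r y -> ccont (fun y => / (y - z))%C y)
    by (intros y Hy; apply ccont_shift_inv; auto).
  assert (C2 : forall y, sq_bdry a r y -> ccont (fun y => f y * / (y - z))%C y).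
  { intros y Hy. apply ccont_mult; [|auto].
    apply holo_ccont with (cball a (3 * r)); [exact Hf|]. apply sq_bdry_dist in Hy; unfold cball; lra. }
  pose proof (sq_int_linear _ _ 1 (- f z)%C a r C2 C1) as L.
  rewrite (sq_int_ext _ (slope f z)) in L.
  - rewrite Z in L.
    transitivity (f z * sq_int (fun y => / (y - z)) a r + 0)%C; [ring|]. rewrite L. ring.
  - intros y Hy. rewrite slope_neq by auto. unfold Cdiv. ring.
Qed.

(** A maximum principle at the centre of a square, with the constant 8/4: the boundary has
    length 8r and the winding integral is at least 4 in modulus. *)
Lemma center_bound (f : C -> C) (a : C) (r B : R) : 0 < r ->
  holo (cball a (3 * r)) f -> (forall z, sq_bdry a r z -> Cmod (f z) <= B) -> Cmod (f a) <= 2 * B.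
Proof.
  intros Hr Hf HB.
  pose proof (cauchy_formula f a a r Hr Hf) as H. rewrite Cmod_sub_diag in H. specialize (H Hr).
  apply (f_equal Cmod) in H. rewrite Cmod_mult in H.
  pose proof (sq_int_winding a r Hr) as W.
  assert (Cmod (sq_int (fun y => f y * / (y - a))%C a r) <= 8 * r * (B * / r)).
  { apply sq_int_bound; [exact Hr|..]; intros z Hz; pose proof (sq_bdry_dist a r z Hr Hz) as D.
    - apply ccont_mult; [apply holo_ccont with (cball a (3 * r)); [exact Hf|apply D]|].
      apply ccont_shift_inv. intros ->. rewrite Cmod_sub_diag in D. lra.
    - assert (Hn : (z - a)%C <> 0) by (apply Cmod_gt_0; lra).
      rewrite Cmod_mult, Cmod_inv by exact Hn.
      apply Rmult_le_compat; [apply Cmod_ge_0|left; apply Rinv_0_lt_compat; lra|now apply HB|].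
      apply Rinv_le_contravar; lra. }
  replace (8 * r * (B * / r)) with (8 * B) in H0 by (field; lra).
  pose proof (Cmod_ge_0 (f a)). nra.
Qed.

(** * Differentiability of the derivative, Cauchy estimates *)

#[local] Opaque sq_int.

(** Differentiation under the integral sign, from a remainder that is quadratic uniformly
    over the boundary. *)
Lemma sq_int_cdiff (k : C -> C -> C) (k' : C -> C) (a z : C) (r d M : R) :
  0 < r -> 0 < d -> 0 <= M ->
  (forall w y, Cmod (w - z) < d -> sq_bdry a r y -> ccont (k w) y) ->
  (forall y, sq_bdry a r y -> ccont k' y) ->
  (forall w y, Cmod (w - z) < d -> sq_bdry a r y ->
     Cmod (k w y - k z y - k' y * (w - z)) <= M * (Cmod (w - z) * Cmod (w - z))) ->
  cdiff (fun w => sq_int (k w) a r) z (sq_int k' a r).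
Proof.
  intros Hr Hd HM C1 C2 HB eps He.
  assert (Hz : Cmod (z - z) < d) by (rewrite Cmod_sub_diag; exact Hd).
  set (e := eps / (8 * r * (M + 1))).
  assert (Hrm : 0 < 8 * r * (M + 1)) by (apply Rmult_lt_0_compat; lra).
  assert (Pe : 0 < e) by (apply Rdiv_lt_0_compat; lra).
  exists (Rmin d e). split; [now apply Rmin_pos|]. intros w Hw.
  assert (W1 : Cmod (w - z) < d) by (eapply Rlt_le_trans; [exact Hw|apply Rmin_l]).
  assert (W2 : Cmod (w - z) < e) by (eapply Rlt_le_trans; [exact Hw|apply Rmin_r]).
  assert (Cm : forall y, sq_bdry a r y -> ccont (fun y => 1 * k w y + (- (1)) * k z y)%C y).
  { intros y Hy. apply ccont_plus; apply ccont_mult; try apply ccont_const; now apply C1. }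
  replace (sq_int (k w) a r - sq_int (k z) a r - sq_int k' a r * (w - z))%C
    with (sq_int (fun y => 1 * (1 * k w y + (- (1)) * k z y) + (- (w - z)) * k' y)%C a r).
  2: { rewrite sq_int_linear by assumption. rewrite sq_int_linear.
       - ring.
       - intros y Hy. now apply C1.
       - intros y Hy. now apply C1. }
  set (D := Cmod (w - z)) in *. assert (HD : 0 <= D) by apply Cmod_ge_0.
  eapply Rle_trans; [apply sq_int_bound with (B := M * (D * D)); [exact Hr|..]|].
  - intros y Hy. apply ccont_plus; apply ccont_mult; try apply ccont_const; auto.
  - intros y Hy.
    replace (1 * (1 * k w y + - (1) * k z y) + - (w - z) * k' y)%C
      with (k w y - k z y - k' y * (w - z))%C by ring. now apply HB.
  - assert (Ee : 8 * r * (M + 1) * e = eps) by (unfold e; field; split; lra).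
    replace (8 * r * (M * (D * D))) with (8 * r * M * D * D) by ring.
    apply Rmult_le_compat_r; [exact HD|]. rewrite <- Ee.
    assert (8 * r * M * D <= 8 * r * M * e)
      by (apply Rmult_le_compat_l; [apply Rmult_le_pos; lra|lra]).
    assert (0 <= 8 * r * e) by (apply Rmult_le_pos; lra). lra.
Qed.

Lemma sq_int_cauchy_cdiff (f : C -> C) (a z : C) (r B : R) : 0 < r ->
  (forall y, sq_bdry a r y -> ccont f y) -> (forall y, sq_bdry a r y -> Cmod (f y) <= B) ->
  Cmod (z - a) < r ->
  cdiff (fun w => sq_int (fun y => f y * / (y - w))%C a r) z
     (sq_int (fun y => f y * (/ (y - z) * / (y - z)))%C a r) /\
  cdiff (fun w => sq_int (fun y => f y * (/ (y - w) * / (y - w)))%C a r) z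
     (sq_int (fun y => f y * (2 * (/ (y - z) * / (y - z) * / (y - z))))%C a r).
Proof.
  intros Hr Hc HB Hz.
  (* for w within m of z, the boundary stays at distance at least m from w *)
  set (m := (r - Cmod (z - a)) / 2). assert (Hm : 0 < m) by (unfold m; lra).
  assert (Hd : forall w y, Cmod (w - z) < m -> sq_bdry a r y -> m <= Cmod (y - w)).
  { intros w y Hw Hy. apply (sq_bdry_dist a r y Hr) in Hy.
    pose proof (Cmod_sub_triangle y w a). pose proof (Cmod_sub_triangle w z a). unfold m in *. lra. }
  assert (Hzm : Cmod (z - z) < m) by (rewrite Cmod_sub_diag; exact Hm).
  assert (Hne : forall w y, Cmod (w - z) < m -> sq_bdry a r y -> (y - w)%C <> 0).
  { intros w y Hw Hy. apply Cmod_gt_0. specialize (Hd w y Hw Hy). lra. }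
  assert (Hinv : forall w y, Cmod (w - z) < m -> sq_bdry a r y -> Cmod (/ (y - w)) <= / m).
  { intros w y Hw Hy. rewrite Cmod_inv by (now apply Hne).
    apply Rinv_le_contravar; [exact Hm|now apply Hd]. }
  assert (Ci1 : forall w y, Cmod (w - z) < m -> sq_bdry a r y -> ccont (fun y => / (y - w))%C y).
  { intros w y Hw Hy. apply ccont_shift_inv. intros ->. apply (Hne w w Hw Hy). ring. }
  assert (Pm : 0 < / m) by now apply Rinv_0_lt_compat.
  assert (HB0 : forall y, sq_bdry a r y -> Cmod (f y) <= Rabs B)
    by (intros y Hy; eapply Rle_trans; [now apply HB|apply Rle_abs]).
  assert (PB : 0 <= Rabs B) by apply Rabs_pos.
  assert (P3 : 0 <= Rabs B * (/ m * (/ m * / m))).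
  { apply Rmult_le_pos; [exact PB|]. repeat apply Rmult_le_pos; lra. }
  split.
  - apply (sq_int_cdiff (fun w y => f y * / (y - w))%C _ a z r m (Rabs B * (/ m * (/ m * / m))));
      auto.
    + intros w y Hw Hy. apply ccont_mult; auto.
    + intros y Hy. repeat (apply ccont_mult; auto).
    + intros w y Hw Hy. pose proof (Hne w y Hw Hy) as N1. pose proof (Hne z y Hzm Hy) as N2.
      replace (f y * / (y - w) - f y * / (y - z) - f y * (/ (y - z) * / (y - z)) * (w - z))%C
        with (f y * (/ (y - w) * (/ (y - z) * / (y - z))) * ((w - z) * (w - z)))%C
        by (field; now split).
      rewrite !Cmod_mult. apply Rmult_le_compat_r; [apply Rmult_le_pos; apply Cmod_ge_0|].
      pose proof (Hinv w y Hw Hy). pose proof (Hinv z y Hzm Hy).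
      repeat apply Rmult_le_compat; auto; repeat apply Rmult_le_pos; apply Cmod_ge_0.
  - apply (sq_int_cdiff (fun w y => f y * (/ (y - w) * / (y - w)))%C _ a z r m
      (3 * / m * (Rabs B * (/ m * (/ m * / m))))); auto.
    + apply Rmult_le_pos; lra.
    + intros w y Hw Hy. repeat (apply ccont_mult; auto).
    + intros y Hy. apply ccont_mult; auto. apply ccont_mult; [apply ccont_const|].
      repeat (apply ccont_mult; auto).
    + intros w y Hw Hy. pose proof (Hne w y Hw Hy) as N1. pose proof (Hne z y Hzm Hy) as N2.
      replace (f y * (/ (y - w) * / (y - w)) - f y * (/ (y - z) * / (y - z))
          - f y * (2 * (/ (y - z) * / (y - z) * / (y - z))) * (w - z))%C
        with ((/ (y - w) + (/ (y - z) + / (y - z)))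
          * (f y * (/ (y - w) * (/ (y - z) * / (y - z)))) * ((w - z) * (w - z)))%C
        by (field; now split).
      rewrite !Cmod_mult. apply Rmult_le_compat_r; [apply Rmult_le_pos; apply Cmod_ge_0|].
      pose proof (Hinv w y Hw Hy). pose proof (Hinv z y Hzm Hy).
      apply Rmult_le_compat; try (repeat apply Rmult_le_pos; apply Cmod_ge_0).
      * eapply Rle_trans; [apply Cmod_triangle|].
        eapply Rle_trans; [apply Rplus_le_compat_l, Cmod_triangle|]. lra.
      * repeat apply Rmult_le_compat; auto; repeat apply Rmult_le_pos; apply Cmod_ge_0.
Qed.

(** Near a, Cauchy's formula writes f as a quotient of two Cauchy integrals. Both are twice
    differentiable, and the denominator does not vanish near a. *)
Lemma holo_derive_center (f : C -> C) (a : C) (R0 : R) : 0 < R0 -> holo (cball a R0) f ->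
  exists l, cdiff (C_derive f) a l.
Proof.
  intros HR Hf.
  assert (Ha : cball a R0 a) by (unfold cball; rewrite Cmod_sub_diag; exact HR).
  destruct (holo_ccont _ _ _ Hf Ha 1 Rlt_0_1) as [d [Hd HB]].
  (* r is small enough for f to be bounded on the square, without compactness *)
  set (r := Rmin d R0 / 3). assert (Hr : 0 < r) by (unfold r; pose proof (Rmin_pos _ _ Hd HR); lra).
  assert (Hr3 : 3 * r = Rmin d R0) by (unfold r; field).
  assert (Hf' : holo (cball a (3 * r)) f).
  { intros z Hz. apply Hf. unfold cball in *. rewrite Hr3 in Hz. pose proof (Rmin_r d R0). lra. }
  assert (Bf : forall y, sq_bdry a r y -> Cmod (f y) <= Cmod (f a) + 1).
  { intros y Hy. apply (sq_bdry_dist a r y Hr) in Hy. rewrite Hr3 in Hy.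
    specialize (HB y). pose proof (Rmin_l d R0). specialize (HB ltac:(lra)).
    pose proof (Cmod_sub_ge (f y) (f a)). lra. }
  assert (Cf : forall y, sq_bdry a r y -> ccont f y).
  { intros y Hy. apply holo_ccont with (cball a (3 * r)); [exact Hf'|].
    apply (sq_bdry_dist a r y Hr) in Hy. apply Hy. }
  set (one := fun _ : C => RtoC 1).
  assert (C1 : forall y, sq_bdry a r y -> ccont one y) by (intros; apply ccont_const).
  assert (B1 : forall y, sq_bdry a r y -> Cmod (one y) <= 1) by (intros; unfold one; rewrite Cmod_1; lra).
  set (I := fun w => sq_int (fun y => f y * / (y - w))%C a r).
  set (I2 := fun w => sq_int (fun y => f y * (/ (y - w) * / (y - w)))%C a r).
  set (W := fun w => sq_int (fun y => one y * / (y - w))%C a r).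
  set (W2 := fun w => sq_int (fun y => one y * (/ (y - w) * / (y - w)))%C a r).
  assert (DI : forall z, Cmod (z - a) < r -> cdiff I z (I2 z))
    by (intros z Hz; exact (proj1 (sq_int_cauchy_cdiff f a z r _ Hr Cf Bf Hz))).
  assert (DW : forall z, Cmod (z - a) < r -> cdiff W z (W2 z))
    by (intros z Hz; exact (proj1 (sq_int_cauchy_cdiff one a z r _ Hr C1 B1 Hz))).
  assert (DI2 : exists l, cdiff I2 a l).
  { eexists. apply sq_int_cauchy_cdiff with (1 := Hr) (2 := Cf) (3 := Bf).
    rewrite Cmod_sub_diag; exact Hr. }
  assert (DW2 : exists l, cdiff W2 a l).
  { eexists. apply sq_int_cauchy_cdiff with (1 := Hr) (2 := C1) (3 := B1).
    rewrite Cmod_sub_diag; exact Hr. }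
  assert (Haa : Cmod (a - a) < r) by (rewrite Cmod_sub_diag; exact Hr).
  assert (EW : forall w, W w = sq_int (fun y => / (y - w))%C a r).
  { intros w. apply sq_int_ext. intros y _. unfold one. ring. }
  assert (Wa : 4 <= Cmod (W a)) by (rewrite EW; now apply sq_int_winding).
  destruct (cdiff_ccont _ _ _ (DW a Haa) 1 Rlt_0_1) as [d2 [Hd2 HW]].
  set (e := Rmin r d2). assert (He : 0 < e) by now apply Rmin_pos.
  assert (Loc : forall w, Cmod (w - a) < e -> Cmod (w - a) < r /\ W w <> 0).
  { intros w Hw. pose proof (Rmin_l r d2). pose proof (Rmin_r r d2). split; [unfold e in Hw; lra|].
    specialize (HW w ltac:(unfold e in Hw; lra)). apply Cmod_gt_0.
    pose proof (Cmod_sub_ge (W a) (W a - W w)) as G. rewrite (Cmod_sub_sym (W a)) in G.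
    replace (W a - (W a - W w))%C with (W w) in G by ring. lra. }
  assert (Ef : forall w, Cmod (w - a) < e -> f w = (I w / W w)%C).
  { intros w Hw. destruct (Loc w Hw) as [L1 L2].
    pose proof (cauchy_formula f a w r Hr Hf' L1) as F. rewrite <- EW in F.
    unfold I. rewrite <- F. field. exact L2. }
  clearbody I I2 W W2.
  assert (Ed : forall w, Cmod (w - a) < e ->
     ((I2 w * W w - I w * W2 w) / (W w * W w))%C = C_derive f w).
  { intros w Hw. destruct (Loc w Hw) as [L1 L2]. symmetry. apply cdiff_C_derive.
    apply cdiff_ext_loc with (f := (fun w => I w / W w)%C) (r := e - Cmod (w - a)).
    - lra.
    - intros y Hy. symmetry. apply Ef. pose proof (Cmod_sub_triangle y w a). lra.
    - apply cdiff_div; [exact L2|exact (DI w L1)|exact (DW w L1)]. }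
  destruct (Loc a) as [_ L2]; [rewrite Cmod_sub_diag; exact He|].
  destruct DI2 as [l1 DI2]. destruct DW2 as [l2 DW2].
  eexists. eapply cdiff_ext_loc; [exact He|exact Ed|].
  apply (cdiff_div (fun w => I2 w * W w - I w * W2 w)%C (fun w => W w * W w)%C).
  - now apply Cmult_neq_0.
  - apply cdiff_minus; apply cdiff_mult; eauto.
  - apply cdiff_mult; eauto.
Qed.

Lemma holo_derive (U : C -> Prop) (f : C -> C) : copen U -> holo U f -> holo U (C_derive f).
Proof.
  intros Ho Hf z Hz. destruct (Ho z Hz) as [r [Hr Hb]].
  apply holo_derive_center with r; [exact Hr|]. intros w Hw. now apply Hf, Hb.
Qed.

Lemma rect_star_cball (a : C) (r : R) : 0 < r -> rect_star (cball a r) a.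
Proof.
  intros Hr. split; [unfold cball; rewrite Cmod_sub_diag; exact Hr|].
  intros [x y] Hz u v Hu Hv. unfold cball in *. destruct a as [x0 y0]. cbn [fst snd] in *.
  eapply Rle_lt_trans; [|exact Hz]. rewrite !Cpair_minus. unfold Cmod. apply sqrt_le_1_alt.
  cbn [fst snd].
  assert (W : forall a b w, between a b w -> (w - a) ^ 2 <= (b - a) ^ 2).
  { intros a b w Hw. assert (Rabs (w - a) <= Rabs (b - a)).
    { unfold between, Rmin, Rmax in Hw. unfold Rabs.
      destruct Rle_dec; repeat destruct Rcase_abs; lra. }
    rewrite <- !Rsqr_pow2. now apply Rsqr_le_abs_1. }
  pose proof (W _ _ _ Hu). pose proof (W _ _ _ Hv). lra.
Qed.

(** The point a is removable: the divided difference is continuous there, hence has a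
    primitive near a, and a function with a primitive is holomorphic. *)
Lemma slope_holo (U : C -> Prop) (f : C -> C) (a : C) : copen U -> holo U f -> U a ->
  holo U (slope f a).
Proof.
  intros Ho Hf Ha z Hz.
  destruct (classic (z = a)) as [->|Hn].
  2: { destruct (Hf z Hz) as [l Hl]. now apply slope_cdiff with l. }
  destruct (Ho a Ha) as [r [Hr Hb]].
  destruct (primitive_except (cball a r) a a (slope f a)) as [F HF].
  - apply copen_cball.
  - now apply rect_star_cball.
  - intros w Hw. apply slope_ccont_on with U; auto.
  - intros w Hw Hwa. destruct (Hf w (Hb w Hw)) as [l Hl]. now apply slope_cdiff with l.
  - destruct (holo_derive_center F a r Hr) as [l Hl].
    + intros w Hw. eexists. now apply HF.
    + exists l. apply cdiff_ext_loc with (f := C_derive F) (r := r); [exact Hr| |exact Hl].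
      intros w Hw. apply cdiff_C_derive. now apply HF.
Qed.

Lemma holo_sub (U V : C -> Prop) (f : C -> C) : (forall z, U z -> V z) -> holo V f -> holo U f.
Proof. intros H Hf z Hz. now apply Hf, H. Qed.

(** The derivative at a is the value at a of the divided difference. *)
Lemma cauchy_estimate (f : C -> C) (a : C) (r B : R) : 0 < r ->
  holo (cball a (3 * r)) f -> (forall z, cball a (3 * r) z -> Cmod (f z) <= B) ->
  Cmod (C_derive f a) <= 4 * B / r.
Proof.
  intros Hr Hf HB.
  assert (Ha : cball a (3 * r) a) by (unfold cball; rewrite Cmod_sub_diag; lra).
  rewrite <- slope_eq. replace (4 * B / r) with (2 * (2 * B / r)) by (field; lra).
  apply center_bound with r; [exact Hr| |].
  - apply slope_holo; auto. apply copen_cball.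
  - intros z Hz. apply (sq_bdry_dist a r z Hr) in Hz.
    assert (Hn : (z - a)%C <> 0) by (apply Cmod_gt_0; lra).
    rewrite slope_neq by (intros ->; apply Hn; ring).
    rewrite Cmod_div by exact Hn.
    assert (Cmod (f z - f a) <= 2 * B).
    { eapply Rle_trans; [apply Cmod_sub_le|]. pose proof (HB z (proj2 Hz)). pose proof (HB a Ha). lra. }
    unfold Rdiv. apply Rmult_le_compat; [apply Cmod_ge_0|left; apply Rinv_0_lt_compat; lra|lra|].
    apply Rinv_le_contravar; lra.
Qed.

Lemma cauchy_estimate2 (f : C -> C) (a : C) (r B : R) : 0 < r ->
  holo (cball a (6 * r)) f -> (forall z, cball a (6 * r) z -> Cmod (f z) <= B) ->
  Cmod (C_derive (C_derive f) a) <= 16 * B / (r * r).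
Proof.
  intros Hr Hf HB.
  replace (16 * B / (r * r)) with (4 * (4 * B / r) / r) by (field; lra).
  assert (S : forall z, cball a (3 * r) z -> forall w, cball z (3 * r) w -> cball a (6 * r) w).
  { intros z Hz w Hw. unfold cball in *. pose proof (Cmod_sub_triangle w z a). lra. }
  apply cauchy_estimate; [exact Hr| |].
  - apply holo_derive; [apply copen_cball|]. apply holo_sub with (cball a (6 * r)); [|exact Hf].
    intros z Hz. unfold cball in *. lra.
  - intros z Hz. apply cauchy_estimate; [exact Hr| |].
    + apply holo_sub with (cball a (6 * r)); [|exact Hf]. now apply S.
    + intros w Hw. apply HB. now apply (S z).
Qed.

(** * Univalent functions: inverse and derivative *)

Lemma side_min (g : C -> C) (p d : C) (L : R) : 0 <= L -> Cmod d = 1 ->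
  (forall t, 0 <= t <= L -> ccont g (p + t * d)) ->
  (forall t, 0 <= t <= L -> g (p + t * d)%C <> 0) ->
  exists m, 0 < m /\ forall t, 0 <= t <= L -> m <= Cmod (g (p + t * d)%C).
Proof.
  intros HL Hd Hc Hn.
  destruct (continuity_ab_min (fun t : R => Cmod (g (p + t * d)%C)) 0 L HL) as [t0 [H0 Ht0]].
  - intros c Hc0 eps He. destruct (Hc c Hc0 eps He) as [dl [Hdl H]].
    exists dl. split; [exact Hdl|]. intros x [_ Hx]. simpl in *. unfold Rdist in *.
    assert (E : ((p + x * d) - (p + c * d) = RtoC (x - c) * d)%C) by (rewrite RtoC_minus; ring).
    specialize (H (p + x * d)%C). rewrite E, Cmod_mult, Hd, Cmod_R, Rmult_1_r in H.
    specialize (H Hx).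
    pose proof (Cmod_sub_ge (g (p + x * d)%C) (g (p + c * d)%C)).
    pose proof (Cmod_sub_ge (g (p + c * d)%C) (g (p + x * d)%C)) as G.
    rewrite (Cmod_sub_sym (g (p + c * d)%C)) in G.
    apply Rabs_def1; lra.
  - exists (Cmod (g (p + t0 * d)%C)). split; [|exact H0]. apply Cmod_gt_0. now apply Hn.
Qed.

Lemma sq_bdry_min (g : C -> C) (a : C) (r : R) : 0 < r ->
  (forall z, sq_bdry a r z -> ccont g z) -> (forall z, sq_bdry a r z -> g z <> 0) ->
  exists m, 0 < m /\ forall z, sq_bdry a r z -> m <= Cmod (g z).
Proof.
  intros Hr Hc Hn. destruct a as [x0 y0].
  assert (Ex : forall x y t, ((x, y) + RtoC t * 1)%C = (x + t, y))
    by (intros; unfold RtoC, Cmult, Cplus; simpl; f_equal; ring).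
  assert (Ey : forall x y t, ((x, y) + RtoC t * Ci)%C = (x, y + t))
    by (intros; unfold RtoC, Ci, Cmult, Cplus; simpl; f_equal; ring).
  assert (S1 : forall y, y = y0 - r \/ y = y0 + r -> exists m, 0 < m /\
     forall t, 0 <= t <= 2 * r -> m <= Cmod (g (x0 - r + t, y))).
  { intros y Hy.
    assert (On : forall t, 0 <= t <= 2 * r -> sq_bdry (x0, y0) r (x0 - r + t, y)).
    { intros t Ht. unfold sq_bdry, on_bdry. cbn [fst snd]. split; [|split].
      - between_tac. - destruct Hy; between_tac. - right. right. exact Hy. }
    destruct (side_min g (x0 - r, y) 1 (2 * r)) as [m [Hm H]]; [lra|apply Cmod_1| | |].
    - intros t Ht. rewrite Ex. apply Hc. now apply On.
    - intros t Ht. rewrite Ex. apply Hn. now apply On.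
    - exists m. split; [exact Hm|]. intros t Ht. rewrite <- Ex. now apply H. }
  assert (S2 : forall x, x = x0 - r \/ x = x0 + r -> exists m, 0 < m /\
     forall t, 0 <= t <= 2 * r -> m <= Cmod (g (x, y0 - r + t))).
  { intros x Hx.
    assert (On : forall t, 0 <= t <= 2 * r -> sq_bdry (x0, y0) r (x, y0 - r + t)).
    { intros t Ht. unfold sq_bdry, on_bdry. cbn [fst snd]. split; [|split].
      - destruct Hx; between_tac. - between_tac. - tauto. }
    destruct (side_min g (x, y0 - r) Ci (2 * r)) as [m [Hm H]]; [lra|apply Cmod_Ci| | |].
    - intros t Ht. rewrite Ey. apply Hc. now apply On.
    - intros t Ht. rewrite Ey. apply Hn. now apply On.
    - exists m. split; [exact Hm|]. intros t Ht. rewrite <- Ey. now apply H. }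
  destruct (S1 (y0 - r)) as [m1 [P1 M1]]; [auto|]. destruct (S1 (y0 + r)) as [m2 [P2 M2]]; [auto|].
  destruct (S2 (x0 - r)) as [m3 [P3 M3]]; [auto|]. destruct (S2 (x0 + r)) as [m4 [P4 M4]]; [auto|].
  exists (Rmin (Rmin m1 m2) (Rmin m3 m4)). split; [repeat apply Rmin_pos; assumption|].
  intros [x y] [Hx [Hy Hb]]. cbn [fst snd] in *.
  assert (Tx : 0 <= x - (x0 - r) <= 2 * r) by between_tac.
  assert (Ty : 0 <= y - (y0 - r) <= 2 * r) by between_tac.
  specialize (M1 _ Tx). specialize (M2 _ Tx). specialize (M3 _ Ty). specialize (M4 _ Ty).
  replace (x0 - r + (x - (x0 - r))) with x in * by ring.
  replace (y0 - r + (y - (y0 - r))) with y in * by ring.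
  pose proof (Rmin_l (Rmin m1 m2) (Rmin m3 m4)). pose proof (Rmin_r (Rmin m1 m2) (Rmin m3 m4)).
  pose proof (Rmin_l m1 m2). pose proof (Rmin_r m1 m2).
  pose proof (Rmin_l m3 m4). pose proof (Rmin_r m3 m4).
  destruct Hb as [->|[->|[->| ->]]]; lra.
Qed.

Section Univalent.
Variables (U : C -> Prop) (h : C -> C).
Hypothesis U_open : copen U.
Hypothesis h_holo : holo U h.
Hypothesis h_inj : univalent_on U h.

Lemma small_square (a : C) (e : R) : U a -> 0 < e -> exists r m,
  0 < r /\ 3 * r < e /\ 0 < m /\ (forall z, cball a (3 * r) z -> U z) /\
  (forall z, sq_bdry a r z -> m <= Cmod (h z - h a)).
Proof.
  intros Ha He. destruct (U_open a Ha) as [R0 [HR Hb]].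
  set (r := Rmin e R0 / 4). pose proof (Rmin_pos _ _ He HR).
  pose proof (Rmin_l e R0). pose proof (Rmin_r e R0).
  assert (Hr : 0 < r) by (unfold r; lra).
  assert (Ub : forall z, cball a (3 * r) z -> U z).
  { intros z Hz. apply Hb. unfold cball, r in Hz. lra. }
  destruct (sq_bdry_min (fun z => h z - h a)%C a r Hr) as [m [Hm M]].
  - intros z Hz. apply ccont_plus; [|apply ccont_const]. apply holo_ccont with U; [exact h_holo|].
    apply Ub. now apply (sq_bdry_dist a r z Hr).
  - intros z Hz E. apply (sq_bdry_dist a r z Hr) in Hz as D.
    assert (z = a) as ->.
    { apply h_inj; [apply Ub, D|exact Ha|]. apply Cmod_sub_eq0. rewrite E. apply Cmod_0. }
    rewrite Cmod_sub_diag in D. lra.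
  - exists r, m. repeat split; auto. unfold r. lra.
Qed.

(** If w is close to h a but not taken by h near a, then 1/(h - w) is larger at a than
    [center_bound] allows, since h stays away from h a on a small square about a. *)
Lemma univalent_inverse_continuous (a : C) (e : R) : U a -> 0 < e -> exists d, 0 < d /\
  forall w, Cmod (w - h a) < d -> exists z, U z /\ Cmod (z - a) < e /\ h z = w.
Proof.
  intros Ha He. destruct (small_square a e Ha He) as [r [m [Hr [Hre [Hm [Ub M]]]]]].
  exists (m / 4). split; [lra|]. intros w Hw. apply NNPP. intros HN.
  assert (Nz : forall z, cball a (3 * r) z -> (h z - w)%C <> 0).
  { intros z Hz E. apply HN. exists z. split; [now apply Ub|]. split; [unfold cball in Hz; lra|].
    apply Cmod_sub_eq0. rewrite E. apply Cmod_0. }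
  assert (Ha' : cball a (3 * r) a) by (unfold cball; rewrite Cmod_sub_diag; lra).
  assert (Hmax : Cmod (/ (h a - w)) <= 2 * / (3 * m / 4)).
  { apply (center_bound (fun z => / (h z - w))%C a r); [exact Hr| |].
    - intros z Hz. destruct (h_holo z (Ub z Hz)) as [l Hl]. eexists.
      apply (cdiff_inv (fun z => h z - w)%C); [|now apply Nz].
      apply cdiff_minus; [exact Hl|apply cdiff_const].
    - intros z Hz. pose proof (M z Hz) as Mz. apply (sq_bdry_dist a r z Hr) in Hz.
      rewrite Cmod_inv by (apply Nz; apply Hz). apply Rinv_le_contravar; [lra|].
      pose proof (Cmod_sub_triangle (h z) w (h a)). lra. }
  rewrite Cmod_inv in Hmax by (now apply Nz).
  rewrite Cmod_sub_sym in Hmax.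
  assert (Hp : 0 < Cmod (w - h a)).
  { rewrite Cmod_sub_sym. apply Cmod_gt_0. now apply Nz. }
  assert (/ (m / 4) < / Cmod (w - h a)) by (apply Rinv_lt_contravar; nra).
  replace (/ (m / 4)) with (4 * / m) in H by (field; lra).
  replace (2 * / (3 * m / 4)) with (8 / 3 * / m) in Hmax by (field; lra).
  assert (0 < / m) by (now apply Rinv_0_lt_compat). lra.
Qed.

(** Hurwitz's argument without limits: for a' near a with h' a' nonzero, the divided
    difference [slope h a'] of h at a' has no zeros, and it is bounded below on a small square about a
    uniformly in a'. By [center_bound] so is its value (h a - h a')/(a - a') at a, and this
    contradicts h' a = 0. If instead h' vanishes throughout a neighbourhood of a, then
    h is constant there. *)
Lemma univalent_derive_neq0 (a : C) : U a -> C_derive h a <> 0.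
Proof.
  intros Ha E0. destruct (small_square a 1 Ha Rlt_0_1) as [r [m [Hr [_ [Hm [Ub M]]]]]].
  pose proof (holo_C_derive U h a h_holo Ha) as Da. rewrite E0 in Da.
  destruct (cdiff_ccont _ _ _ Da (m / 2)) as [d1 [Hd1 H1]]; [lra|].
  destruct (Da (m / (64 * r))) as [d2 [Hd2 H2]]; [apply Rdiv_lt_0_compat; lra|].
  set (d := Rmin r (Rmin d1 d2)).
  assert (Hd : 0 < d) by (repeat apply Rmin_pos; assumption).
  assert (Dd : d <= r /\ d <= d1 /\ d <= d2).
  { pose proof (Rmin_l r (Rmin d1 d2)). pose proof (Rmin_r r (Rmin d1 d2)).
    pose proof (Rmin_l d1 d2). pose proof (Rmin_r d1 d2). unfold d. lra. }
  destruct Dd as [D0 [D1 D2]].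
  assert (Zero : forall a', Cmod (a' - a) < d -> C_derive h a' = 0).
  { intros a' Ha'. destruct (classic (a' = a)) as [->|Hn]; [exact E0|].
    apply NNPP. intros HN.
    assert (Ua' : U a') by (apply Ub; unfold cball; lra).
    assert (Nq : forall z, cball a (3 * r) z -> slope h a' z <> 0).
    { intros z Hz E. destruct (classic (z = a')) as [->|Hz'].
      - rewrite slope_eq in E. contradiction.
      - apply Hz'. apply h_inj; [now apply Ub|exact Ua'|]. apply Cmod_sub_eq0.
        rewrite <- slope_mult, E. rewrite Cmult_0_l. apply Cmod_0. }
    assert (Haa : cball a (3 * r) a) by (unfold cball; rewrite Cmod_sub_diag; lra).
    assert (Hmax : Cmod (/ slope h a' a) <= 2 * (8 * r / m)).
    { apply (center_bound (fun z => / slope h a' z)%C a r); [exact Hr| |].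
      - intros z Hz. destruct (slope_holo U h a' U_open h_holo Ua' z (Ub z Hz)) as [l Hl]. eexists.
        apply cdiff_inv; [exact Hl|now apply Nq].
      - intros z Hz. pose proof (M z Hz) as Mz. apply (sq_bdry_dist a r z Hr) in Hz.
        rewrite Cmod_inv by (apply Nq, Hz).
        replace (8 * r / m) with (/ (m / (8 * r))) by (field; lra).
        apply Rinv_le_contravar; [apply Rdiv_lt_0_compat; lra|].
        pose proof (f_equal Cmod (slope_mult h a' z)) as E. rewrite Cmod_mult in E.
        pose proof (Cmod_sub_triangle (h z) (h a') (h a)) as T1.
        specialize (H1 a' ltac:(lra)).
        pose proof (Cmod_sub_triangle z a a') as T2. rewrite (Cmod_sub_sym a a') in T2.
        apply (Rmult_le_reg_r (4 * r)); [lra|].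
        replace (m / (8 * r) * (4 * r)) with (m / 2) by (field; lra).
        apply Rle_trans with (Cmod (slope h a' z) * Cmod (z - a')); [lra|].
        apply Rmult_le_compat_l; [apply Cmod_ge_0|lra]. }
    rewrite Cmod_inv in Hmax by (now apply Nq).
    pose proof (f_equal Cmod (slope_mult h a' a)) as E. rewrite Cmod_mult in E.
    specialize (H2 a' ltac:(lra)). replace (h a' - h a - 0 * (a' - a))%C with (h a' - h a)%C in H2 by ring.
    rewrite (Cmod_sub_sym (h a)), (Cmod_sub_sym a) in E.
    pose proof (Cmod_sub_pos _ _ Hn) as Hp.
    assert (Q0 : 0 < Cmod (slope h a' a)) by (apply Cmod_gt_0; now apply Nq).
    assert (Q1 : Cmod (slope h a' a) <= m / (64 * r)).
    { apply (Rmult_le_reg_r (Cmod (a' - a))); lra. }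
    assert (Q2 : / (m / (64 * r)) <= / Cmod (slope h a' a)) by (apply Rinv_le_contravar; lra).
    replace (/ (m / (64 * r))) with (64 * (r / m)) in Q2 by (field; lra).
    replace (2 * (8 * r / m)) with (16 * (r / m)) in Hmax by (field; lra).
    assert (0 < r / m) by (apply Rdiv_lt_0_compat; lra). lra. }
  set (b := (a + RtoC (d / 2))%C).
  assert (Eb : (b - a)%C = RtoC (d / 2)) by (unfold b; ring).
  assert (Hbm : Cmod (b - a) = d / 2) by (rewrite Eb, Cmod_R, Rabs_pos_eq; lra).
  assert (Near : forall t : R, 0 <= t <= 1 -> Cmod ((a + t * (b - a)) - a) < d).
  { intros t Ht. replace ((a + t * (b - a)) - a)%C with (t * (b - a))%C by ring.
    rewrite Cmod_RtoC_mult by lra. rewrite Hbm. nra. }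
  assert (MV : Cmod (h b - h a) <= 0 * Cmod (b - a)).
  { apply mean_value_ineq with (C_derive h).
    - intros t Ht. apply holo_C_derive with U; [exact h_holo|]. apply Ub. unfold cball.
      pose proof (Near t Ht). lra.
    - intros t Ht. rewrite Zero by (now apply Near). rewrite Cmod_0. lra. }
  assert (Eab : b = a).
  { apply h_inj; [apply Ub; unfold cball; lra|exact Ha|]. apply Cmod_sub_eq0.
    pose proof (Cmod_ge_0 (h b - h a)). lra. }
  rewrite Eab, Cmod_sub_diag in Hbm. lra.
Qed.
End Univalent.

(** * From short paths to univalent harmonic mappings *)

Lemma sum_n_nat_ext (f g : nat -> R) (n : nat) :
  (forall i, (i <= n)%nat -> f i = g i) -> sum_n f n = sum_n g n.
Proof. intros H. apply sum_n_ext_loc. exact H. Qed.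

Lemma continuous_on_Cmod (gamma : R -> C) (s eps : R) :
  continuous_on unit_interval gamma -> unit_interval s -> 0 < eps ->
  exists eta, 0 < eta /\ forall t, unit_interval t -> Rabs (t - s) < eta ->
    Cmod (gamma t - gamma s) < eps.
Proof.
  intros Hc Hs He.
  assert (He2 : 0 < eps / 2) by lra.
  destruct (Hc s Hs (fun w => Cmod (w - gamma s) < eps)) as [eta H].
  - exists (mkposreal _ He2). intros w [B1 B2].
    change (Rabs (fst w - fst (gamma s)) < eps / 2) in B1.
    change (Rabs (snd w - snd (gamma s)) < eps / 2) in B2.
    destruct w as [w1 w2], (gamma s) as [g1 g2]. rewrite Cpair_minus.
    eapply Rle_lt_trans; [apply Cmod_pair_le|]. simpl in *. lra.
  - exists eta. split; [apply cond_pos|]. intros t Ht Hts. now apply (H t).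
Qed.

(** The increment of psi over [0,s] is bounded by c times the length of some polygon
    inscribed in gamma over [0,s]. *)
Definition dominated_at (gamma psi : R -> C) (c s : R) : Prop :=
  exists n t, t 0%nat = 0 /\ t (S n) = s /\
    (forall i : nat, (i <= n)%nat -> t i <= t (S i)) /\
    Cmod (psi s - psi 0) <= c * sum_n (fun i : nat => Cmod (gamma (t (S i)) - gamma (t i))%C) n.

Lemma dominated_step (gamma psi : R -> C) (c s s' : R) : s <= s' ->
  dominated_at gamma psi c s -> Cmod (psi s' - psi s) <= c * Cmod (gamma s' - gamma s) ->
  dominated_at gamma psi c s'.
Proof.
  intros Hs [n [t [T0 [T1 [T2 T3]]]]] H.
  (* the old vertices are t 0, ..., t (S n); the new one has index S (S n) *)
  set (t' := fun i => if Nat.leb i (S n) then t i else s').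
  assert (E1 : forall i, (i <= S n)%nat -> t' i = t i).
  { intros i Hi. unfold t'. now rewrite (proj2 (Nat.leb_le _ _) Hi). }
  assert (E2 : t' (S (S n)) = s').
  { unfold t'. destruct (Nat.leb_spec (S (S n)) (S n)); [lia|reflexivity]. }
  exists (S n), t'. split; [now rewrite E1 by lia|]. split; [exact E2|]. split.
  - intros i Hi. destruct (Nat.eq_dec i (S n)) as [->|Hn].
    + rewrite E2, E1, T1 by lia. exact Hs.
    + rewrite !E1 by lia. apply T2. lia.
  - rewrite sum_Sn. unfold plus. simpl. rewrite E2, E1, T1 by lia.
    rewrite (sum_n_nat_ext _ (fun i : nat => Cmod (gamma (t (S i)) - gamma (t i))%C)).
    + pose proof (Cmod_sub_triangle (psi s') (psi s) (psi 0)). lra.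
    + intros i Hi. now rewrite !E1 by lia.
Qed.

(** Creeping along [0,1]: the supremum of the s that can be reached by a polygon can be
    reached, and if it were below 1 it could be passed. *)
Lemma dominated_end (gamma psi : R -> C) (c : R) :
  (forall s, unit_interval s -> exists eta, 0 < eta /\ forall t, unit_interval t ->
     Rabs (t - s) < eta -> Cmod (psi t - psi s) <= c * Cmod (gamma t - gamma s)) ->
  dominated_at gamma psi c 1.
Proof.
  intros Hloc.
  assert (D0 : dominated_at gamma psi c 0).
  { exists 0%nat, (fun _ => 0). repeat split; intros; try lra.
    rewrite sum_O, !Cmod_sub_diag. lra. }
  destruct (completeness (fun s => unit_interval s /\ dominated_at gamma psi c s)) as [s [L1 L2]].
  - exists 1. intros s [[_ H] _]. exact H.
  - exists 0. split; [unfold unit_interval; lra|exact D0].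
  - assert (Is : unit_interval s).
    { split; [apply L1; split; [unfold unit_interval; lra|exact D0]|].
      apply L2. intros x [[_ H] _]. exact H. }
    destruct (Hloc s Is) as [eta [He Hl]].
    assert (Ds : dominated_at gamma psi c s).
    { apply NNPP. intros HN.
      assert (s <= s - eta / 2); [|lra].
      apply L2. intros x [Ix Dx]. apply Rnot_lt_le. intros Hx. apply HN.
      assert (x <= s) by (apply L1; now split).
      apply dominated_step with x; [lra|exact Dx|].
      rewrite Cmod_sub_sym, (Cmod_sub_sym (gamma s)). apply Hl; [exact Ix|].
      apply Rabs_def1; lra. }
    destruct (Req_dec s 1) as [->|Hs1]; [exact Ds|].
    exfalso. destruct Is as [I1 I2].
    set (s' := Rmin 1 (s + eta / 2)).
    assert (Hs' : s < s') by (apply Rmin_glb_lt; lra).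
    assert (Is' : unit_interval s') by (split; [lra|apply Rmin_l]).
    assert (s' <= s + eta / 2) by apply Rmin_r.
    assert (s' <= s); [|lra]. apply L1. split; [exact Is'|].
    apply dominated_step with s; [lra|exact Ds|]. apply Hl; [exact Is'|].
    apply Rabs_def1; lra.
Qed.

(** The derivative of g o h^-1 at h a is the dilatation at a; only the inequality at the
    fixed point a is needed, because polygons are extended one vertex at a time. *)
Lemma dilatation_local_bound (U : C -> Prop) (h g : C -> C) (a : C) (c : R) :
  copen U -> holo U h -> univalent_on U h -> holo U g -> U a -> 0 < c ->
  Cmod (dilatation h g a) < c ->
  exists d, 0 < d /\ forall z, U z -> Cmod (h z - h a) < d ->
    Cmod (g z - g a) <= 2 * c * Cmod (h z - h a).
Proof.
  intros Ho Hh Hi Hg Ha Hc Hw.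
  pose proof (univalent_derive_neq0 U h Ho Hh Hi a Ha) as Hn.
  unfold dilatation in Hw. rewrite Cmod_div in Hw by exact Hn.
  set (k := Cmod (C_derive h a)) in *. assert (Hk : 0 < k) by now apply Cmod_gt_0.
  assert (Gk : Cmod (C_derive g a) <= c * k).
  { apply (Rmult_le_reg_r (/ k)); [now apply Rinv_0_lt_compat|].
    replace (c * k * / k) with c by (field; lra). left. exact Hw. }
  (* e solves c k + e = 2 c (k - e), the loss allowed between c and 2 c *)
  set (e := c * k / (1 + 2 * c)).
  assert (Hck : 0 < c * k) by (apply Rmult_lt_0_compat; lra).
  assert (He : 0 < e) by (apply Rdiv_lt_0_compat; lra).
  assert (Ee : e * (1 + 2 * c) = c * k) by (unfold e; field; lra).
  destruct (holo_C_derive U h a Hh Ha e He) as [r1 [Hr1 H1]].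
  destruct (holo_C_derive U g a Hg Ha e He) as [r2 [Hr2 H2]].
  destruct (univalent_inverse_continuous U h Ho Hh Hi a (Rmin r1 r2) Ha) as [d [Hd H3]];
    [now apply Rmin_pos|].
  exists d. split; [exact Hd|]. intros z Hz Hzd.
  destruct (H3 _ Hzd) as [z' [Uz' [Dz' Ez']]]. apply Hi in Ez'; [|assumption..]. subst z'.
  specialize (H1 z (Rlt_le_trans _ _ _ Dz' (Rmin_l _ _))).
  specialize (H2 z (Rlt_le_trans _ _ _ Dz' (Rmin_r _ _))).
  set (D := Cmod (z - a)) in *. assert (HD : 0 <= D) by apply Cmod_ge_0.
  assert (A1 : k * D - Cmod (h z - h a) <= e * D).
  { eapply Rle_trans; [|exact H1]. unfold k, D. rewrite <- Cmod_mult.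
    rewrite (Cmod_sub_sym (h z - h a)). apply Cmod_sub_ge. }
  assert (A2 : Cmod (g z - g a) <= c * k * D + e * D).
  { replace (g z - g a)%C with ((g z - g a - C_derive g a * (z - a)) + C_derive g a * (z - a))%C by ring.
    eapply Rle_trans; [apply Cmod_triangle|]. rewrite Cmod_mult. fold D.
    assert (Cmod (C_derive g a) * D <= c * k * D) by (apply Rmult_le_compat_r; lra). lra. }
  assert (A3 : 2 * c * (k * D - e * D) <= 2 * c * Cmod (h z - h a))
    by (apply Rmult_le_compat_l; lra).
  assert (A4 : (c * k + e) * D = 2 * c * (k - e) * D) by (f_equal; lra).
  nra.
Qed.

(** If h + conj g identifies z1 and z2, then g and h have increments of equal modulus
    there, while a short path from h z1 to h z2 makes the increment of g the smaller. *)
Lemma harmonic_univalent_of_paths (U : C -> Prop) (h : C -> C) (M : R) :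
  copen U -> holo U h -> univalent_on U h ->
  (forall w1 w2 : C, image U h w1 -> image U h w2 ->
    exists gamma : R -> C,
      path_in (image U h) gamma w1 w2 /\
      Rbar_le (path_length gamma) (Finite (M * Cmod (w1 - w2)%C))) ->
  exists c : R, 0 < c /\ forall g : C -> C, holo U g ->
    (forall z, U z -> Cmod (dilatation h g z) < c) -> univalent_on U (harmonic_mapping h g).
Proof.
  intros Ho Hh Hi Hpath. pose proof (Rabs_pos M) as PM.
  exists (/ (2 * (Rabs M + 1))). set (c := / (2 * (Rabs M + 1))).
  assert (Hc : 0 < c) by (apply Rinv_0_lt_compat; lra). split; [exact Hc|].
  intros g Hg Hw z1 z2 U1 U2 E.
  destruct (Hpath (h z1) (h z2)) as [gamma [[Gc [Gi [G0 G1]]] Gl]];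
    [now exists z1|now exists z2|].
  assert (Hlift : forall t, exists z, unit_interval t -> U z /\ h z = gamma t).
  { intros t. destruct (classic (unit_interval t)) as [It|It].
    - destruct (Gi t It) as [z Hz]. now exists z.
    - now exists z1. }
  set (zeta := fun t => proj1_sig (constructive_indefinite_description _ (Hlift t))).
  assert (Hz : forall t, unit_interval t -> U (zeta t) /\ h (zeta t) = gamma t)
    by (intros t; exact (proj2_sig (constructive_indefinite_description _ (Hlift t)))).
  assert (Dom : dominated_at gamma (fun t => g (zeta t)) (2 * c) 1).
  { apply dominated_end. intros s Is. destruct (Hz s Is) as [Us Es].
    destruct (dilatation_local_bound U h g (zeta s) c) as [d [Hd Hb]]; auto.
    destruct (continuous_on_Cmod gamma s d Gc Is Hd) as [eta [He Hcont]].
    exists eta. split; [exact He|]. intros t It Hts. destruct (Hz t It) as [Ut Et].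
    specialize (Hb (zeta t) Ut). rewrite Es, Et in Hb. apply Hb. now apply Hcont. }
  assert (I0 : unit_interval 0) by (unfold unit_interval; lra).
  assert (I1 : unit_interval 1) by (unfold unit_interval; lra).
  assert (Z0 : zeta 0 = z1) by (destruct (Hz 0 I0); apply Hi; congruence).
  assert (Z1 : zeta 1 = z2) by (destruct (Hz 1 I1); apply Hi; congruence).
  destruct Dom as [n [t [T0 [T1 [T2 T3]]]]]. cbv beta in T3. rewrite Z0, Z1 in T3.
  assert (Len : sum_n (fun i : nat => Cmod (gamma (t (S i)) - gamma (t i))%C) n
      <= M * Cmod (h z1 - h z2)).
  { assert (X : Rbar_le (Finite (sum_n (fun i : nat => Cmod (gamma (t (S i)) - gamma (t i))%C) n))
       (Finite (M * Cmod (h z1 - h z2)))).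
    { eapply Rbar_le_trans; [|exact Gl]. unfold path_length.
      apply (proj1 (Lub_Rbar_correct (inscribed_length gamma))).
      now exists n, t. }
    exact X. }
  assert (Eq : Cmod (g z2 - g z1) = Cmod (h z1 - h z2)).
  { unfold harmonic_mapping in E.
    assert (E' : (h z1 - h z2 = Cconj (g z2) - Cconj (g z1))%C).
    { transitivity (h z1 + Cconj (g z1) - h z2 - Cconj (g z1))%C; [ring|]. rewrite E. ring. }
    rewrite E', <- Cminus_conj, Cmod_conj. reflexivity. }
  rewrite Eq in T3.
  set (D := Cmod (h z1 - h z2)) in *. assert (HD : 0 <= D) by apply Cmod_ge_0.
  assert (T4 : 2 * c * (M * D) <= 2 * c * (Rabs M * D)).
  { apply Rmult_le_compat_l; [lra|]. apply Rmult_le_compat_r; [exact HD|apply Rle_abs]. }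
  assert (T5 : 2 * c * sum_n (fun i : nat => Cmod (gamma (t (S i)) - gamma (t i))%C) n
     <= 2 * c * (M * D)) by (apply Rmult_le_compat_l; lra).
  assert (Ec : 2 * c * (Rabs M + 1) = 1) by (unfold c; field; lra).
  apply Hi; auto. apply Cmod_sub_eq0. fold D. nra.
Qed.

(** * The pre-Schwarzian derivative on the half plane *)

Definition RHP (z : C) : Prop := 0 < Re z.

Lemma copen_RHP : copen RHP.
Proof.
  intros z Hz. exists (Re z). split; [exact Hz|]. intros w Hw. unfold RHP.
  pose proof (re_le_Cmod (w - z)) as H. rewrite Re_minus in H.
  pose proof (Rabs_def2 _ _ (Rle_lt_trans _ _ _ H Hw)). lra.
Qed.

Lemma rect_star_RHP : rect_star RHP 1.
Proof.
  split; [unfold RHP; simpl; lra|]. intros [x y] Hz u v Hu Hv. unfold RHP in *. simpl in *.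
  between_tac.
Qed.

Lemma RHP_RtoC (t : R) : 0 < t -> RHP (RtoC t).
Proof. intros H. exact H. Qed.

Lemma RHP_add_neq0 (z : C) (y : R) : RHP z -> 0 <= y -> (z + y)%C <> 0.
Proof.
  intros Hz Hy E. apply (f_equal fst) in E. unfold RHP, Re in Hz. simpl in E. lra.
Qed.

Lemma cdiff_unique_loc (U : C -> Prop) (f g : C -> C) (z l m : C) : copen U -> U z ->
  (forall w, U w -> f w = g w) -> cdiff f z l -> cdiff g z m -> l = m.
Proof.
  intros Ho Hz E Hf Hg. destruct (Ho z Hz) as [r [Hr Hb]].
  apply (cdiff_unique g z); [|exact Hg].
  apply cdiff_ext_loc with (f := f) (r := r); [exact Hr| |exact Hf]. intros w Hw. now apply E, Hb.
Qed.

(** What the univalence of all harmonic mappings of small dilatation amounts to. Being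
    linear in omega, it can be tested on any bounded multiplier, and it passes from the
    disk to the half plane under Moebius maps with the same constant. *)
Definition variation_bound (H : C -> C) (K : R) : Prop :=
  forall omega G : C -> C, holo RHP omega -> (forall z, RHP z -> Cmod (omega z) <= 1) ->
    (forall z, RHP z -> cdiff G z (omega z * C_derive H z)%C) ->
    forall a b, RHP a -> RHP b -> Cmod (G a - G b) <= K * Cmod (H a - H b).

Lemma Cmod_half_plane_le (al be : R) (z : C) : 0 <= al -> 0 <= be -> RHP z ->
  Cmod (al * z - be) <= Cmod (al * z + be).
Proof.
  intros Ha Hb Hz. unfold Cmod. apply sqrt_le_1_alt. unfold RHP, Re in Hz.
  destruct z as [x y]. simpl in *.
  assert (0 <= al * x * be) by (apply Rmult_le_pos; [apply Rmult_le_pos|]; lra). nra.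
Qed.

Lemma Cmod_ratio_le_1 (a b : C) : b <> 0 -> Cmod a <= Cmod b -> Cmod (a / b) <= 1.
Proof.
  intros Hb H. rewrite Cmod_div by exact Hb. apply Cmod_gt_0 in Hb.
  apply (Rmult_le_reg_r (Cmod b)); [exact Hb|].
  replace (Cmod a / Cmod b * Cmod b) with (Cmod a) by (field; lra). lra.
Qed.

Section HalfPlane.
Variables (H : C -> C) (K : R).
Hypothesis K_pos : 0 < K.
Hypothesis H_holo : holo RHP H.
Hypothesis H_inj : univalent_on RHP H.
Hypothesis H_var : variation_bound H K.

Let H1 := C_derive H.
Let H2 := C_derive H1.

Lemma deriv_holo : holo RHP H1.
Proof. apply holo_derive; [exact copen_RHP|exact H_holo]. Qed.

Lemma deriv2_holo : holo RHP H2.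
Proof. apply holo_derive; [exact copen_RHP|exact deriv_holo]. Qed.

Lemma deriv_neq0 (z : C) : RHP z -> H1 z <> 0.
Proof. apply univalent_derive_neq0; [exact copen_RHP|exact H_holo|exact H_inj]. Qed.

(** Let om(z) = (z - y)/(z + y), let G be a primitive of om H', and let
    Q = (G - G(y))/(H - H(y)). The variation bound says |Q| <= K. Differentiating
    G - G(y) = Q (H - H(y)) three times at y, where om and Q vanish, gives
    3 Q'' H' = om'' H' + (1/2) om' H'', and Cauchy's estimate on the disk of radius y
    about y bounds Q''(y). In the constant, 6912 = 12 * 16 * 6^2 combines the 12 of
    H'' = (12 y Q'' + 2/y) H' with [cauchy_estimate2] for r = y/6. *)
Lemma pre_schwarzian_bound (y : R) : 0 < y ->
  Cmod (H2 y) <= (6912 * K + 2) / y * Cmod (H1 y).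
Proof.
  intros Hy. assert (Uy : RHP y) by (now apply RHP_RtoC).
  set (om := fun z : C => ((z - y) / (z + y))%C).
  set (om1 := fun z : C => (2 * y / ((z + y) * (z + y)))%C).
  assert (Nz : forall z, RHP z -> (z + y)%C <> 0) by (intros; apply RHP_add_neq0; [assumption|lra]).
  assert (Dom : forall z, RHP z -> cdiff om z (om1 z)).
  { intros z Hz. eapply cdiff_eq.
    - apply (cdiff_div (fun z => z - y)%C (fun z => z + y)%C); [now apply Nz|..].
      + apply cdiff_minus; [apply cdiff_id|apply cdiff_const].
      + apply cdiff_plus; [apply cdiff_id|apply cdiff_const].
    - cbv beta. unfold om1. field. now apply Nz. }
  assert (Dom1 : exists om2, cdiff om1 y om2 /\ om2 = (- / (2 * y * y))%C).
  { eexists. split.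
    - apply (cdiff_div (fun _ => 2 * y)%C (fun z => (z + y) * (z + y))%C).
      + apply Cmult_neq_0; now apply Nz.
      + apply cdiff_const.
      + apply cdiff_mult; (apply cdiff_plus; [apply cdiff_id|apply cdiff_const]).
    - cbv beta. field. split; [apply RtoC_neq0; lra|now apply Nz]. }
  destruct Dom1 as [om2 [Dom1 Eom2]].
  assert (DH : forall z, RHP z -> cdiff H z (H1 z)) by (intros z Hz; now apply holo_C_derive with RHP).
  assert (DH1 : forall z, RHP z -> cdiff H1 z (H2 z))
    by (intros z Hz; apply holo_C_derive with RHP; [exact deriv_holo|exact Hz]).
  destruct (deriv2_holo y Uy) as [h3 DH2].
  destruct (holo_primitive RHP 1 (fun z => om z * H1 z)%C copen_RHP rect_star_RHP) as [G DG].
  { intros z Hz. eexists. apply cdiff_mult; [now apply Dom|now apply DH1]. }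
  assert (Hom : holo RHP om) by (intros z Hz; exists (om1 z); now apply Dom).
  assert (HG : holo RHP G) by (intros z Hz; eexists; now apply DG).
  assert (Vb : forall a, RHP a -> Cmod (G a - G y) <= K * Cmod (H a - H y)).
  { intros a Ha. apply (H_var om G); auto. intros z Hz.
    apply Cmod_ratio_le_1; [now apply Nz|].
    pose proof (Cmod_half_plane_le 1 y z ltac:(lra) ltac:(lra) Hz) as X.
    now rewrite Cmult_1_l in X. }
  assert (Ndq : forall z, RHP z -> slope H y z <> 0).
  { intros z Hz E. destruct (classic (z = y)) as [->|Hn].
    - rewrite slope_eq in E. now apply (deriv_neq0 y Uy).
    - apply Hn. apply H_inj; auto. apply Cmod_sub_eq0. rewrite <- slope_mult, E, Cmult_0_l. apply Cmod_0. }
  set (Q := fun z => (slope G y z / slope H y z)%C).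
  assert (Omy : om y = 0) by (unfold om, Cdiv; ring).
  assert (Qy : Q y = 0).
  { unfold Q. rewrite !slope_eq. rewrite (cdiff_C_derive _ _ _ (DG y Uy)), Omy. unfold Cdiv. ring. }
  assert (HQ : holo RHP Q).
  { intros z Hz. destruct (slope_holo RHP G y copen_RHP HG Uy z Hz) as [l1 L1].
    destruct (slope_holo RHP H y copen_RHP H_holo Uy z Hz) as [l2 L2].
    eexists. apply cdiff_div; [now apply Ndq|exact L1|exact L2]. }
  assert (BQ : forall z, RHP z -> Cmod (Q z) <= K).
  { intros z Hz. destruct (classic (z = y)) as [->|Hn]; [rewrite Qy, Cmod_0; lra|].
    unfold Q. rewrite Cmod_div by (now apply Ndq).
    pose proof (Ndq z Hz) as N. apply Cmod_gt_0 in N.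
    apply (Rmult_le_reg_r (Cmod (slope H y z))); [exact N|].
    replace (Cmod (slope G y z) / Cmod (slope H y z) * Cmod (slope H y z)) with (Cmod (slope G y z)) by (field; lra).
    apply (Rmult_le_reg_r (Cmod (z - y))); [now apply Cmod_sub_pos|].
    rewrite Rmult_assoc, <- !Cmod_mult, !slope_mult. now apply Vb. }
  assert (HQ1 : holo RHP (C_derive Q)) by (apply holo_derive; [exact copen_RHP|exact HQ]).
  assert (HQ2 : holo RHP (C_derive (C_derive Q))) by (apply holo_derive; [exact copen_RHP|exact HQ1]).
  assert (BQ2 : Cmod (C_derive (C_derive Q) y) <= 16 * K / (y / 6 * (y / 6))).
  { assert (S : forall z, cball y (6 * (y / 6)) z -> RHP z).
    { intros z Hz. unfold cball in Hz. unfold RHP.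
      pose proof (re_le_Cmod (z - y)) as X. rewrite Re_minus in X.
      pose proof (Rabs_def2 _ _ (Rle_lt_trans _ _ _ X Hz)) as X2. simpl in X2. lra. }
    apply cauchy_estimate2; [lra| |].
    - apply holo_sub with RHP; auto.
    - intros z Hz. apply BQ. now apply S. }
  set (Q1 := C_derive Q) in *. set (Q2 := C_derive Q1) in *.
  assert (DQ : forall z, RHP z -> cdiff Q z (Q1 z)) by (intros z Hz; now apply holo_C_derive with RHP).
  assert (DQ1 : forall z, RHP z -> cdiff Q1 z (Q2 z)) by (intros z Hz; now apply holo_C_derive with RHP).
  destruct (HQ2 y Uy) as [q3 DQ2].
  assert (DHy : forall z, RHP z -> cdiff (fun z => H z - H y)%C z (H1 z)).
  { intros z Hz. eapply cdiff_eq; [apply cdiff_minus; [now apply DH|apply cdiff_const]|]. ring. }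
  (* G - G y = Q (H - H y), differentiated three times at y *)
  assert (I0 : forall z, RHP z -> (G z = Q z * (H z - H y) + G y)%C).
  { intros z Hz. unfold Q. rewrite <- (slope_mult H y z).
    transitivity (slope G y z * (z - y) + G y)%C; [rewrite slope_mult; ring|]. field. now apply Ndq. }
  assert (I1 : forall z, RHP z -> (om z * H1 z = Q1 z * (H z - H y) + Q z * H1 z)%C).
  { intros z Hz. eapply (cdiff_unique_loc RHP _ _ z); [exact copen_RHP|exact Hz|exact I0|now apply DG|].
    eapply cdiff_eq; [apply cdiff_plus; [apply cdiff_mult; [now apply DQ|now apply DHy]|apply cdiff_const]|].
    cbv beta. ring. }
  assert (I2 : forall z, RHP z -> (om1 z * H1 z + om z * H2 z
      = Q2 z * (H z - H y) + Q1 z * H1 z + (Q1 z * H1 z + Q z * H2 z))%C).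
  { intros z Hz. eapply (cdiff_unique_loc RHP _ _ z); [exact copen_RHP|exact Hz|exact I1|..].
    - apply cdiff_mult; [now apply Dom|now apply DH1].
    - eapply cdiff_eq.
      + apply cdiff_plus; apply cdiff_mult; [now apply DQ1|now apply DHy|now apply DQ|now apply DH1].
      + cbv beta. ring. }
  assert (I3 : (om2 * H1 y + om1 y * H2 y + (om1 y * H2 y + om y * h3)
      = q3 * (H y - H y) + Q2 y * H1 y + (Q2 y * H1 y + Q1 y * H2 y)
        + (Q2 y * H1 y + Q1 y * H2 y + (Q1 y * H2 y + Q y * h3)))%C).
  { eapply (cdiff_unique_loc RHP _ _ y); [exact copen_RHP|exact Uy|exact I2|..].
    - eapply cdiff_eq.
      + apply cdiff_plus; apply cdiff_mult; [exact Dom1|now apply DH1|now apply Dom|exact DH2].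
      + cbv beta. ring.
    - eapply cdiff_eq.
      + apply cdiff_plus; [apply cdiff_plus; apply cdiff_mult|apply cdiff_plus; apply cdiff_mult];
          [exact DQ2|now apply DHy|now apply DQ1|now apply DH1
          |now apply DQ1|now apply DH1|now apply DQ|exact DH2].
      + cbv beta. ring. }
  specialize (I2 y Uy). rewrite Qy, Omy in I2, I3.
  assert (Hn : H1 y <> 0) by (now apply deriv_neq0).
  assert (Ny : RtoC y <> 0) by (apply RtoC_neq0; lra).
  assert (EQ1 : (Q1 y = om1 y / 2)%C).
  { transitivity ((om1 y * H1 y + 0 * H2 y) / (2 * H1 y))%C; [rewrite I2|]; field; exact Hn. }
  assert (Eom1 : om1 y = (/ (2 * y))%C) by (unfold om1; field; split; [exact Ny|now apply Nz]).
  rewrite EQ1, Eom1, Eom2 in I3.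
  assert (E : H2 y = ((12 * y * Q2 y + 2 / y) * H1 y)%C).
  { transitivity (4 * y * ((- / (2 * y * y) * H1 y + / (2 * y) * H2 y + (/ (2 * y) * H2 y + 0 * h3))
       + / (2 * y * y) * H1 y - 3 * (/ (2 * y) / 2 * H2 y)))%C; [field; exact Ny|].
    rewrite I3. field. exact Ny. }
  rewrite E, Cmod_mult. apply Rmult_le_compat_r; [apply Cmod_ge_0|].
  eapply Rle_trans; [apply Cmod_triangle|]. rewrite !Cmod_mult, Cmod_div by exact Ny.
  rewrite !Cmod_R, !Rabs_pos_eq by lra.
  replace (16 * K / (y / 6 * (y / 6))) with (576 * K / (y * y)) in BQ2 by (field; lra).
  assert (12 * y * Cmod (Q2 y) <= 12 * y * (576 * K / (y * y))) by (apply Rmult_le_compat_l; lra).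
  replace ((6912 * K + 2) / y) with (12 * y * (576 * K / (y * y)) + 2 / y) by (field; lra). lra.
Qed.

(** Let S be the maximum of |H'| on [y,x]. Since |H''| <= P S/y there, H' differs from
    H' y by at most S/16 on an interval of length y/(16 P); hence S and |H' y| are
    comparable, and the arguments of H' x and H' y are close. *)
Lemma derivative_slow (x y : R) : 0 < y -> y <= x <= (1 + / (16 * (6912 * K + 2))) * y ->
  3 / 4 * (Cmod (H1 y) * Cmod (H1 x)) <= Re (Cconj (H1 y) * H1 x).
Proof.
  intros Hy Hx. set (P := 6912 * K + 2) in *. assert (HP : 0 < P) by (unfold P; lra).
  assert (Pos : forall t, y <= t <= x -> RHP t) by (intros; apply RHP_RtoC; lra).
  destruct (continuity_ab_maj (fun t : R => Cmod (H1 t)) y x) as [t0 [M0 T0]]; [lra| |].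
  { intros c Hc eps He. destruct (holo_ccont RHP H1 c deriv_holo (Pos c Hc) eps He) as [d [Hd Hd1]].
    exists d. split; [exact Hd|]. intros t [_ Ht]. simpl in *. unfold Rdist in *.
    specialize (Hd1 t). rewrite <- RtoC_minus, Cmod_R in Hd1. specialize (Hd1 Ht).
    pose proof (Cmod_sub_ge (H1 t) (H1 c)). pose proof (Cmod_sub_ge (H1 c) (H1 t)) as G.
    rewrite (Cmod_sub_sym (H1 c)) in G. apply Rabs_def1; lra. }
  set (S := Cmod (H1 t0)) in *. assert (HS : 0 <= S) by apply Cmod_ge_0.
  assert (MV : forall t : R, y <= t <= x -> Cmod (H1 t - H1 y) <= S / 16).
  { intros t Ht.
    assert (E0 : (t - y = RtoC (t - y))%C) by (now rewrite RtoC_minus).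
    assert (Seg : forall s, 0 <= s <= 1 -> (y + s * (t - y))%C = RtoC (y + s * (t - y))
         /\ y <= y + s * (t - y) <= x).
    { intros s Hs. split; [now rewrite RtoC_plus, RtoC_mult, RtoC_minus|]. nra. }
    apply Rle_trans with (P / y * S * Cmod (t - y)).
    - apply mean_value_ineq with (l := H2).
      + intros s Hs. destruct (Seg s Hs) as [-> B]. apply holo_C_derive with RHP; [exact deriv_holo|].
        now apply Pos.
      + intros s Hs. destruct (Seg s Hs) as [-> B].
        eapply Rle_trans; [apply pre_schwarzian_bound; lra|]. fold P.
        apply Rmult_le_compat; [left; apply Rdiv_lt_0_compat; lra|apply Cmod_ge_0| |now apply M0].
        unfold Rdiv. apply Rmult_le_compat_l; [lra|]. apply Rinv_le_contravar; lra.
    - rewrite E0, Cmod_R, Rabs_pos_eq by lra.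
      apply Rle_trans with (P / y * S * (/ (16 * P) * y)).
      + apply Rmult_le_compat_l; [|lra].
        apply Rmult_le_pos; [left; apply Rdiv_lt_0_compat; lra|exact HS].
      + right. field. lra. }
  pose proof (MV t0 T0) as B0. pose proof (MV x ltac:(lra)) as Bx.
  pose proof (Cmod_sub_ge (H1 t0) (H1 y)) as G0. fold S in G0.
  set (a := Cmod (H1 y)) in *. assert (Ha : 0 <= a) by apply Cmod_ge_0.
  pose proof (Cmod_sub_ge (H1 x) (H1 y)) as Gx. fold a in Gx.
  replace (Cconj (H1 y) * H1 x)%C with (H1 y * Cconj (H1 y) + Cconj (H1 y) * (H1 x - H1 y))%C by ring.
  rewrite <- Cmod2_conj, Re_plus. fold a.
  change (Re (RtoC (a ^ 2))) with (a ^ 2).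
  pose proof (re_le_Cmod (Cconj (H1 y) * (H1 x - H1 y))) as R1.
  rewrite Cmod_mult, Cmod_conj in R1. fold a in R1.
  pose proof (Rle_abs (- Re (Cconj (H1 y) * (H1 x - H1 y)))) as R2. rewrite Rabs_Ropp in R2.
  assert (N1 : a * Cmod (H1 x - H1 y) <= a * (a / 15)) by (apply Rmult_le_compat_l; lra).
  assert (N2 : a * Cmod (H1 x) <= a * (16 / 15 * a)) by (apply Rmult_le_compat_l; lra).
  assert (N3 : 0 <= a * a) by (apply Rmult_le_pos; exact Ha). lra.
Qed.

Lemma derivative_slow_sym (x y v : R) : 0 < x -> 0 < y ->
  Rabs (x - y) <= v * (x + y) -> v * (2 + / (16 * (6912 * K + 2))) <= / (16 * (6912 * K + 2)) ->
  3 / 4 * (Cmod (H1 y) * Cmod (H1 x)) <= Re (Cconj (H1 y) * H1 x).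
Proof.
  intros Hx Hy Hv He.
  assert (Pe : 0 < / (16 * (6912 * K + 2))) by (apply Rinv_0_lt_compat; lra).
  set (e := / (16 * (6912 * K + 2))) in *.
  assert (Cmp : forall a b, 0 < b -> b <= a -> a - b <= v * (a + b) -> a <= (1 + e) * b).
  { intros a b Hb Hab Hv'.
    assert (a * (2 + e) - b * (2 + e) <= e * (a + b)); [|nra].
    apply Rle_trans with (v * (a + b) * (2 + e)); [nra|].
    replace (v * (a + b) * (2 + e)) with (v * (2 + e) * (a + b)) by ring.
    apply Rmult_le_compat_r; lra. }
  destruct (Rle_or_lt y x) as [Hyx|Hyx].
  - rewrite Rabs_pos_eq in Hv by lra. apply derivative_slow; [exact Hy|]. split; [exact Hyx|].
    apply Cmp; lra.
  - rewrite Rabs_left in Hv by lra.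
    replace (Re (Cconj (H1 y) * H1 x)) with (Re (Cconj (H1 x) * H1 y)).
    + rewrite (Rmult_comm (Cmod (H1 y))). apply derivative_slow; [exact Hx|]. split; [lra|].
      apply Cmp; lra.
    + unfold Re, Cconj, Cmult. simpl. ring.
Qed.
End HalfPlane.

(** * Bump functions and Cayley maps *)

(** The primitive of (1 - v^2)^n vanishing at 0, by the recursion that integration by
    parts gives. *)
Fixpoint bump_int (n : nat) (v : C) : C :=
  match n with
  | O => v
  | S m => ((v * (1 - v * v) ^ n + RtoC (2 * INR n) * bump_int m v) / RtoC (2 * INR n + 1))%C
  end.

Fixpoint rbump_int (n : nat) (v : R) : R :=
  match n with
  | O => v
  | S m => (v * (1 - v * v) ^ n + 2 * INR n * rbump_int m v) / (2 * INR n + 1)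
  end.

Lemma INR_odd_pos (n : nat) : 0 < 2 * INR n + 1.
Proof. pose proof (pos_INR n). lra. Qed.

Lemma bump_int_RtoC (n : nat) (v : R) : bump_int n (RtoC v) = RtoC (rbump_int n v).
Proof.
  induction n as [|n IH]; [reflexivity|].
  cbn [bump_int rbump_int]. rewrite IH.
  rewrite RtoC_div by (apply Rgt_not_eq; apply INR_odd_pos).
  f_equal. rewrite RtoC_plus, !RtoC_mult, RtoC_pow, RtoC_minus, RtoC_mult. reflexivity.
Qed.

Lemma cdiff_pow (f : C -> C) (z l : C) (n : nat) : cdiff f z l ->
  cdiff (fun w => f w ^ S n)%C z (RtoC (INR (S n)) * f z ^ n * l)%C.
Proof.
  intros Hf. induction n as [|n IH].
  - apply cdiff_ext_loc with (f := f) (r := 1); [lra|intros w _; simpl; ring|].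
    eapply cdiff_eq; [exact Hf|]. simpl. ring.
  - eapply cdiff_eq; [exact (cdiff_mult _ _ _ _ _ Hf IH)|]. cbv beta.
    rewrite (S_INR (S n)), RtoC_plus. simpl (f z ^ S n)%C. simpl (f z ^ S (S n))%C. ring.
Qed.

Lemma bump_int_cdiff (n : nat) (v : C) : cdiff (bump_int n) v ((1 - v * v) ^ n)%C.
Proof.
  induction n as [|n IH]; [exact (cdiff_id v)|].
  assert (Hn : RtoC (2 * INR (S n) + 1) <> 0) by (apply RtoC_neq0, Rgt_not_eq, INR_odd_pos).
  assert (Dq : cdiff (fun v => 1 - v * v)%C v (- (2 * v))%C).
  { eapply cdiff_eq; [apply cdiff_minus; [apply cdiff_const|apply cdiff_mult; apply cdiff_id]|].
    cbv beta. ring. }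
  apply cdiff_ext_loc with (f := fun v => (/ RtoC (2 * INR (S n) + 1)
     * (v * (1 - v * v) ^ S n + RtoC (2 * INR (S n)) * bump_int n v))%C) (r := 1); [lra| |].
  { intros w _. cbn [bump_int]. unfold Cdiv. ring. }
  eapply cdiff_eq.
  - apply cdiff_scal, cdiff_plus; [|apply cdiff_scal, IH].
    apply cdiff_mult; [apply cdiff_id|apply (cdiff_pow _ _ _ n Dq)].
  - cbv beta. rewrite RtoC_plus, RtoC_mult in *. simpl ((1 - v * v) ^ S n)%C. field. exact Hn.
Qed.

Lemma rbump_int_derive (n : nat) (v : R) :
  derivable_pt_lim (rbump_int n) v ((1 - v * v) ^ n).
Proof.
  pose proof (cdiff_line (bump_int n) 1 0 1 ((1 - v * v) ^ n)%C v) as L.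
  replace (0 + v * 1)%C with (RtoC v) in L by ring. specialize (L (bump_int_cdiff n v)).
  replace (Re (1 * (1 - v * v) ^ n * 1)%C) with ((1 - v * v) ^ n) in L.
  - intros eps He. destruct (L eps He) as [d Hd]. exists d. intros h Hh0 Hh.
    specialize (Hd h Hh0 Hh). cbv beta in Hd.
    replace (0 + RtoC (v + h) * 1)%C with (RtoC (v + h)) in Hd by ring.
    replace (0 + RtoC v * 1)%C with (RtoC v) in Hd by ring.
    rewrite !bump_int_RtoC, !Cmult_1_l in Hd. exact Hd.
  - replace (1 * (1 - v * v) ^ n * 1)%C with ((1 - v * v) ^ n)%C by ring.
    rewrite <- RtoC_mult, <- RtoC_minus, <- RtoC_pow. reflexivity.
Qed.

Lemma Cmod_bump_int_lip (n : nat) (v w : C) : Cmod v <= 1 -> Cmod w <= 1 ->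
  Cmod (bump_int n v - bump_int n w) <= 2 ^ n * Cmod (v - w).
Proof.
  intros Hv Hw. apply mean_value_ineq with (fun v => (1 - v * v) ^ n)%C.
  - intros t Ht. apply bump_int_cdiff.
  - intros t Ht. set (u := (w + t * (v - w))%C).
    assert (Hu : Cmod u <= 1).
    { replace u with (RtoC (1 - t) * w + t * v)%C by (unfold u; rewrite RtoC_minus; ring).
      eapply Rle_trans; [apply Cmod_triangle|]. rewrite !Cmod_RtoC_mult by lra. nra. }
    rewrite Cmod_pow. apply pow_incr. split; [apply Cmod_ge_0|].
    eapply Rle_trans; [apply Cmod_sub_le|]. rewrite Cmod_1, Cmod_mult.
    pose proof (Cmod_ge_0 u). nra.
Qed.

Definition bump_total (n : nat) : R := rbump_int n 1 - rbump_int n (-1).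

(** The mass of (1 - v^2)^n over [-1,1] hardly changes from n to n + 1, so the mass of
    v^2 (1 - v^2)^n = (1 - v^2)^n - (1 - v^2)^(n+1) is relatively small: this is how the
    concentration of the bump at 0 enters. *)
Lemma bump_total_S (n : nat) :
  bump_total (S n) = bump_total n - bump_total n / (2 * INR n + 3).
Proof.
  unfold bump_total. cbn [rbump_int]. rewrite S_INR. pose proof (pos_INR n).
  replace (1 - 1 * 1) with 0 by ring. replace (1 - -1 * -1) with 0 by ring.
  rewrite pow_i by lia. field. lra.
Qed.

Lemma bump_total_pos (n : nat) : 0 < bump_total n.
Proof.
  induction n as [|n IH]; [unfold bump_total; simpl; lra|].
  rewrite bump_total_S. pose proof (pos_INR n).
  replace (bump_total n - bump_total n / (2 * INR n + 3))
    with (bump_total n * ((2 * INR n + 2) / (2 * INR n + 3))) by (field; lra).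
  apply Rmult_lt_0_compat; [exact IH|]. apply Rdiv_lt_0_compat; lra.
Qed.

(** Integrating the pointwise inequality against (1 - v^2)^n over [a,b]; the factor v^2 is
    absorbed through v^2 (1 - v^2)^n = (1 - v^2)^n - (1 - v^2)^(n+1). *)
Lemma bump_compare (n : nat) (s A B a b : R) : -1 <= a -> a <= b -> b <= 1 ->
  (forall v, a <= v <= b -> A - B * (v * v) <= s) ->
  (A - B) * (rbump_int n b - rbump_int n a) + B * (rbump_int (S n) b - rbump_int (S n) a)
   <= s * (rbump_int n b - rbump_int n a).
Proof.
  intros Ha Hab Hb Hs. destruct Hab as [Hab|<-]; [|lra].
  destruct (MVT_cor2 (fun v => (s - (A - B)) * rbump_int n v - B * rbump_int (S n) v)
    (fun v => (s - (A - B)) * (1 - v * v) ^ n - B * (1 - v * v) ^ S n) a b Hab) as [c [E Hc]].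
  { intros c _. apply derivable_pt_lim_minus; apply derivable_pt_lim_scal; apply rbump_int_derive. }
  assert (0 <= (s - (A - B)) * (1 - c * c) ^ n - B * (1 - c * c) ^ S n).
  { simpl ((1 - c * c) ^ S n).
    replace ((s - (A - B)) * (1 - c * c) ^ n - B * ((1 - c * c) * (1 - c * c) ^ n))
      with ((s - (A - B * (c * c))) * (1 - c * c) ^ n) by ring.
    apply Rmult_le_pos.
    - specialize (Hs c ltac:(lra)). lra.
    - apply pow_le. nra. }
  assert (0 <= ((s - (A - B)) * (1 - c * c) ^ n - B * (1 - c * c) ^ S n) * (b - a))
    by (apply Rmult_le_pos; lra). lra.
Qed.

(** The map z |-> (z - y)/(z + y) with y = s/(1 - s). The parameter s makes the end
    points y = 0 and y = infinity, where the map is constantly 1 and -1, ordinary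
    values. *)
Definition cayley (s : R) (z : C) : C :=
  ((RtoC (1 - s) * z - s) / (RtoC (1 - s) * z + s))%C.
Definition rcayley (s x : R) : R := ((1 - s) * x - s) / ((1 - s) * x + s).

Lemma cayley_den_neq0 (s : R) (z : C) : 0 <= s <= 1 -> RHP z -> (RtoC (1 - s) * z + s)%C <> 0.
Proof.
  intros Hs Hz E. unfold RHP in Hz. apply (f_equal Re) in E.
  rewrite Re_plus, Re_RtoC_mult in E. simpl in E.
  destruct (Req_dec s 0) as [->|Hn]; nra.
Qed.

Lemma rcayley_den_pos (s x : R) : 0 <= s <= 1 -> 0 < x -> 0 < (1 - s) * x + s.
Proof. intros Hs Hx. destruct (Req_dec s 0) as [->|Hn]; nra. Qed.

Lemma cayley_RtoC (s x : R) : 0 <= s <= 1 -> 0 < x -> cayley s (RtoC x) = RtoC (rcayley s x).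
Proof.
  intros Hs Hx. pose proof (rcayley_den_pos s x Hs Hx). unfold cayley, rcayley.
  rewrite RtoC_div by lra. f_equal; [rewrite (RtoC_minus ((1 - s) * x))|rewrite RtoC_plus]; now rewrite RtoC_mult.
Qed.

Lemma cayley_cdiff (s : R) (z : C) : 0 <= s <= 1 -> RHP z -> exists l, cdiff (cayley s) z l.
Proof.
  intros Hs Hz. eexists.
  apply (cdiff_div (fun z => RtoC (1 - s) * z - s)%C (fun z => RtoC (1 - s) * z + s)%C).
  - now apply cayley_den_neq0.
  - apply cdiff_minus; [apply cdiff_scal, cdiff_id|apply cdiff_const].
  - apply cdiff_plus; [apply cdiff_scal, cdiff_id|apply cdiff_const].
Qed.

Lemma Cmod_cayley_le (s : R) (z : C) : 0 <= s <= 1 -> RHP z -> Cmod (cayley s z) <= 1.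
Proof.
  intros Hs Hz. apply Cmod_ratio_le_1; [now apply cayley_den_neq0|].
  apply Cmod_half_plane_le; [lra|lra|exact Hz].
Qed.

Lemma Cmod_den_ge (s : R) (z : C) : 0 <= s <= 1 -> RHP z ->
  ((1 - s) * Cmod z + s) ^ 2 <= 2 * Cmod (RtoC (1 - s) * z + s) ^ 2.
Proof.
  intros Hs Hz. rewrite Cmod2_alt. rewrite Re_plus, Re_RtoC_mult.
  replace (Im (RtoC (1 - s) * z + s)) with ((1 - s) * Im z) by (unfold Im, Re; simpl; ring).
  change (Re (RtoC s)) with s.
  pose proof (Cmod2_alt z) as E. unfold RHP in Hz.
  assert (0 <= (1 - s) * Re z * s) by (apply Rmult_le_pos; [apply Rmult_le_pos|]; lra).
  assert (0 <= ((1 - s) * Cmod z - s) ^ 2) by apply pow2_ge_0. nra.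
Qed.

(** In the half plane |az + b| and a|z| + b are comparable for a, b >= 0, which bounds the
    variation in s at z by that at |z|; on the axis the dependence on s is monotone, so
    these bounds telescope. *)
Lemma Cmod_cayley_diff (s t : R) (z : C) : 0 <= s <= 1 -> 0 <= t <= 1 -> s <= t -> RHP z ->
  Cmod (cayley s z - cayley t z) <= 2 * (rcayley s (Cmod z) - rcayley t (Cmod z)).
Proof.
  intros Hs Ht Hst Hz.
  pose proof (cayley_den_neq0 s z Hs Hz) as N1. pose proof (cayley_den_neq0 t z Ht Hz) as N2.
  assert (Pz : 0 < Cmod z).
  { apply Cmod_gt_0. intros ->. unfold RHP in Hz. simpl in Hz. lra. }
  pose proof (rcayley_den_pos s _ Hs Pz) as P1. pose proof (rcayley_den_pos t _ Ht Pz) as P2.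
  pose proof (Cmod_den_ge s z Hs Hz) as G1. pose proof (Cmod_den_ge t z Ht Hz) as G2.
  replace (cayley s z - cayley t z)%C with (RtoC (2 * (t - s)) * z
     / ((RtoC (1 - s) * z + s) * (RtoC (1 - t) * z + t)))%C.
  2: { unfold cayley. rewrite RtoC_mult, !RtoC_minus in *. field. now split. }
  rewrite Cmod_div by (now apply Cmult_neq_0). rewrite Cmod_RtoC_mult by lra. rewrite Cmod_mult.
  replace (rcayley s (Cmod z) - rcayley t (Cmod z)) with (2 * (t - s) * Cmod z
     / (((1 - s) * Cmod z + s) * ((1 - t) * Cmod z + t))).
  2: { unfold rcayley. field. lra. }
  apply Cmod_gt_0 in N1. apply Cmod_gt_0 in N2.
  set (d1 := Cmod (RtoC (1 - s) * z + s)) in *. set (d2 := Cmod (RtoC (1 - t) * z + t)) in *.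
  set (e1 := (1 - s) * Cmod z + s) in *. set (e2 := (1 - t) * Cmod z + t) in *.
  set (m := 2 * (t - s) * Cmod z).
  assert (Hm : 0 <= m) by (unfold m; apply Rmult_le_pos; lra).
  assert (HE : e1 * e2 <= 2 * (d1 * d2)).
  { apply Rsqr_incr_0_var; [|apply Rmult_le_pos; [lra|apply Rmult_le_pos; lra]].
    rewrite !Rsqr_pow2. replace ((e1 * e2) ^ 2) with (e1 ^ 2 * e2 ^ 2) by ring.
    replace ((2 * (d1 * d2)) ^ 2) with ((2 * d1 ^ 2) * (2 * d2 ^ 2)) by ring.
    apply Rmult_le_compat; try apply pow2_ge_0; assumption. }
  assert (0 < d1 * d2) by (now apply Rmult_lt_0_compat).
  assert (0 < e1 * e2) by (now apply Rmult_lt_0_compat).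
  apply (Rmult_le_reg_r ((d1 * d2) * (e1 * e2))); [now apply Rmult_lt_0_compat|].
  replace (m / (d1 * d2) * (d1 * d2 * (e1 * e2))) with (m * (e1 * e2)) by (field; lra).
  replace (2 * (m / (e1 * e2)) * (d1 * d2 * (e1 * e2))) with (m * (2 * (d1 * d2))) by (field; lra).
  now apply Rmult_le_compat_l.
Qed.

Fixpoint csum (f : nat -> C) (n : nat) : C :=
  match n with O => 0 | S m => (csum f m + f m)%C end.

Lemma Cmod_csum_telescope (f : nat -> C) (g : nat -> R) (n : nat) :
  (forall k, (k < n)%nat -> Cmod (f k) <= g k - g (S k)) -> Cmod (csum f n) <= g 0%nat - g n.
Proof.
  induction n as [|n IH]; intros Hf; simpl; [rewrite Cmod_0; lra|].
  eapply Rle_trans; [apply Cmod_triangle|].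
  pose proof (Hf n ltac:(lia)). assert (Cmod (csum f n) <= g 0%nat - g n); [|lra].
  apply IH. intros k Hk. apply Hf. lia.
Qed.

Lemma Re_csum_telescope (f : nat -> C) (c : C) (g : nat -> R) (n : nat) :
  (forall k, (k < n)%nat -> g k - g (S k) <= Re (f k * c)) -> g 0%nat - g n <= Re (csum f n * c).
Proof.
  induction n as [|n IH]; intros Hf; simpl csum; [rewrite Cmult_0_l; simpl; lra|].
  rewrite Cmult_plus_distr_r, Re_plus.
  pose proof (Hf n ltac:(lia)). assert (g 0%nat - g n <= Re (csum f n * c)); [|lra].
  apply IH. intros k Hk. apply Hf. lia.
Qed.

Lemma csum_cdiff (f : nat -> C -> C) (z : C) (n : nat) :
  (forall k, (k < n)%nat -> exists l, cdiff (f k) z l) ->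
  exists l, cdiff (fun w => csum (fun k => f k w) n) z l.
Proof.
  induction n as [|n IH]; intros Hf; [exists (RtoC 0); exact (cdiff_const 0 z)|].
  destruct IH as [l1 L1]; [intros k Hk; apply Hf; lia|]. destruct (Hf n) as [l2 L2]; [lia|].
  exists (l1 + l2)%C. exact (cdiff_plus _ _ _ _ _ L1 L2).
Qed.

(** * A bounded multiplier that aligns the derivative on the axis *)

Lemma rcayley_lip (s t x R0 : R) : 0 <= s <= 1 -> 0 <= t <= 1 -> 1 <= x <= R0 ->
  Rabs (rcayley s x - rcayley t x) <= 2 * R0 * Rabs (s - t).
Proof.
  intros Hs Ht Hx.
  assert (D : forall s, 0 <= s <= 1 -> 1 <= (1 - s) * x + s) by (intros; nra).
  pose proof (D s Hs) as D1. pose proof (D t Ht) as D2.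
  replace (rcayley s x - rcayley t x) with (2 * x * (t - s) * (/ ((1 - s) * x + s) * / ((1 - t) * x + t))).
  2: { unfold rcayley. field. lra. }
  rewrite !Rabs_mult, (Rabs_pos_eq 2), (Rabs_pos_eq x) by lra.
  rewrite (Rabs_minus_sym t s).
  assert (I : forall d, 1 <= d -> 0 <= / d <= 1).
  { intros d Hd. split; [left; apply Rinv_0_lt_compat; lra|].
    rewrite <- Rinv_1. apply Rinv_le_contravar; lra. }
  pose proof (I _ D1) as I1. pose proof (I _ D2) as I2.
  rewrite (Rabs_pos_eq (/ ((1 - s) * x + s))), (Rabs_pos_eq (/ ((1 - t) * x + t))) by lra.
  pose proof (Rabs_pos (s - t)).
  apply Rle_trans with (2 * x * Rabs (s - t) * 1).
  - apply Rmult_le_compat_l; [apply Rmult_le_pos; lra|nra].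
  - rewrite Rmult_1_r. apply Rmult_le_compat_r; lra.
Qed.

Lemma rcayley_decr (s t x : R) : 0 <= s <= 1 -> 0 <= t <= 1 -> s <= t -> 0 < x -> rcayley t x <= rcayley s x.
Proof.
  intros Hs Ht Hst Hx.
  pose proof (rcayley_den_pos s x Hs Hx). pose proof (rcayley_den_pos t x Ht Hx).
  assert (0 <= rcayley s x - rcayley t x); [|lra].
  replace (rcayley s x - rcayley t x) with (2 * x * (t - s) / (((1 - s) * x + s) * ((1 - t) * x + t))).
  - apply Rmult_le_pos; [repeat apply Rmult_le_pos; lra|].
    left. apply Rinv_0_lt_compat. now apply Rmult_lt_0_compat.
  - unfold rcayley. field. lra.
Qed.

Lemma rcayley_0 (x : R) : 0 < x -> rcayley 0 x = 1.
Proof. intros H. unfold rcayley. field. lra. Qed.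

Lemma rcayley_1 (x : R) : rcayley 1 x = -1.
Proof. unfold rcayley. replace ((1 - 1) * x - 1) with (-1) by ring.
  replace ((1 - 1) * x + 1) with 1 by ring. field. Qed.

Lemma rcayley_range (s x : R) : 0 <= s <= 1 -> 0 < x -> -1 <= rcayley s x <= 1.
Proof.
  intros Hs Hx. pose proof (rcayley_decr 0 s x). pose proof (rcayley_decr s 1 x).
  rewrite rcayley_0 in H by exact Hx. rewrite rcayley_1 in H0. split; [apply H0|apply H]; lra.
Qed.

Lemma exists_INR_ge (r : R) : exists n : nat, (0 < n)%nat /\ r <= INR n.
Proof.
  destruct (INR_unbounded r) as [n Hn]. exists (S n). split; [lia|]. rewrite S_INR. lra.
Qed.

Section Multiplier.
Variables (H : C -> C) (K : R).
Hypothesis K_pos : 0 < K.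
Hypothesis H_holo : holo RHP H.
Hypothesis H_inj : univalent_on RHP H.
Hypothesis H_var : variation_bound H K.
Let H1 := C_derive H.

Variables (v1 B R0 : R) (n N : nat).
Hypothesis v1_pos : 0 < v1.
Hypothesis v1_small : v1 * (2 + / (16 * (6912 * K + 2))) <= / (16 * (6912 * K + 2)).
Hypothesis B_large : 7 <= B * (v1 * v1).
Hypothesis n_large : 4 * B <= 2 * INR n + 3.
Hypothesis N_pos : (0 < N)%nat.
Hypothesis N_large : 8 * R0 / v1 <= INR N.

Let node (k : nat) : R := INR k / INR N.
Let tag (k : nat) : R := (INR k + / 2) / INR N.
Let phase (k : nat) : C := conj_phase (H1 (RtoC (tag k / (1 - tag k)))).

(** A Riemann sum for the integral of conj H'(y)/|H'(y)| against
    d F_n((z - y)/(z + y)) over the whole positive axis, with nodes s = k/N and tags at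
    the midpoints. *)
Definition multiplier (z : C) : C :=
  csum (fun k => phase k * (bump_int n (cayley (node k) z) - bump_int n (cayley (node (S k)) z)))%C N.

Lemma N_INR_pos : 0 < INR N.
Proof. now apply lt_0_INR. Qed.

Lemma node_range (k : nat) : (k <= N)%nat -> 0 <= node k <= 1.
Proof.
  intros Hk. pose proof N_INR_pos. unfold node. apply le_INR in Hk. pose proof (pos_INR k). split.
  - apply Rmult_le_pos; [lra|left; now apply Rinv_0_lt_compat].
  - apply (Rmult_le_reg_r (INR N)); [lra|]. replace (INR k / INR N * INR N) with (INR k) by (field; lra). lra.
Qed.

Lemma node_tag (k : nat) : (k < N)%nat ->
  node k < tag k /\ tag k < node (S k) /\ node (S k) - node k = / INR N /\ 0 < tag k < 1.
Proof.
  intros Hk. pose proof N_INR_pos as Np. pose proof (node_range k ltac:(lia)) as R1.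
  pose proof (node_range (S k) ltac:(lia)) as R2.
  assert (0 < / INR N) by now apply Rinv_0_lt_compat.
  assert (T1 : tag k = node k + / 2 * / INR N) by (unfold tag, node; field; lra).
  assert (T2 : node (S k) = node k + / INR N) by (unfold node; rewrite S_INR; field; lra).
  repeat split; lra.
Qed.

Lemma tag_point_pos (k : nat) : (k < N)%nat -> 0 < tag k / (1 - tag k).
Proof.
  intros Hk. destruct (node_tag k Hk) as [_ [_ [_ T]]]. apply Rdiv_lt_0_compat; lra.
Qed.

Lemma Cmod_phase (k : nat) : (k < N)%nat -> Cmod (phase k) = 1.
Proof.
  intros Hk. apply Cmod_conj_phase. apply (deriv_neq0 H H_holo H_inj). apply RHP_RtoC. now apply tag_point_pos.
Qed.

Lemma multiplier_holo : holo RHP multiplier.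
Proof.
  intros z Hz. unfold multiplier. apply (csum_cdiff (fun k z =>
    phase k * (bump_int n (cayley (node k) z) - bump_int n (cayley (node (S k)) z)))%C).
  intros k Hk.
  destruct (cayley_cdiff (node k) z (node_range k ltac:(lia)) Hz) as [l1 L1].
  destruct (cayley_cdiff (node (S k)) z (node_range (S k) ltac:(lia)) Hz) as [l2 L2].
  eexists. apply cdiff_scal, cdiff_minus.
  - apply (cdiff_comp (bump_int n) (cayley (node k))); [apply bump_int_cdiff|exact L1].
  - apply (cdiff_comp (bump_int n) (cayley (node (S k)))); [apply bump_int_cdiff|exact L2].
Qed.

(** The Lipschitz constant of F_n on the disk is 2^n, and the total variation of the Cayley
    maps over all nodes is at most 2 (1 - (-1)) = 4, independently of N. *)
Lemma Cmod_multiplier_le (z : C) : RHP z -> Cmod (multiplier z) <= 4 * 2 ^ n.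
Proof.
  intros Hz. unfold multiplier.
  assert (Pz : 0 < Cmod z).
  { apply Cmod_gt_0. intros ->. unfold RHP in Hz. simpl in Hz. lra. }
  assert (E0 : node 0 = 0) by (unfold node; simpl; unfold Rdiv; ring).
  assert (EN : node N = 1) by (unfold node; field; pose proof N_INR_pos; lra).
  replace (4 * 2 ^ n) with (2 * 2 ^ n * rcayley (node 0) (Cmod z) - 2 * 2 ^ n * rcayley (node N) (Cmod z)).
  2: { rewrite E0, EN, rcayley_0, rcayley_1 by exact Pz. ring. }
  apply Cmod_csum_telescope with (g := fun k => 2 * 2 ^ n * rcayley (node k) (Cmod z)).
  intros k Hk. rewrite Cmod_mult, Cmod_phase, Rmult_1_l by exact Hk.
  pose proof (node_range k ltac:(lia)) as N1. pose proof (node_range (S k) ltac:(lia)) as N2.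
  eapply Rle_trans; [apply Cmod_bump_int_lip; now apply Cmod_cayley_le|].
  replace (2 * 2 ^ n * rcayley (node k) (Cmod z) - 2 * 2 ^ n * rcayley (node (S k)) (Cmod z))
    with (2 ^ n * (2 * (rcayley (node k) (Cmod z) - rcayley (node (S k)) (Cmod z)))) by ring.
  apply Rmult_le_compat_l; [apply pow_le; lra|].
  apply Cmod_cayley_diff; auto. destruct (node_tag k Hk) as [T1 [T2 _]]. lra.
Qed.

(** Here v stands for the values (x - y)/(x + y) of the k-th interval of nodes, and w for
    the value at its tag. If w is small, the tag is close to x and H' has nearly the same
    argument at both points. Otherwise the fine mesh keeps all v of the interval away
    from 0, and B v^2 is so large that the left side is at most -1. *)
Lemma phase_condition (k : nat) (x v : R) : (k < N)%nat -> 1 <= x <= R0 ->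
  rcayley (node (S k)) x <= v <= rcayley (node k) x ->
  3 / 4 - B * (v * v) <= Re (phase k * H1 x) / Cmod (H1 x).
Proof.
  intros Hk Hx Hv. destruct (node_tag k Hk) as [T1 [T2 [T3 T4]]].
  pose proof (node_range k ltac:(lia)) as N1. pose proof (node_range (S k) ltac:(lia)) as N2.
  pose proof N_INR_pos as Np.
  assert (Hn : H1 x <> 0) by (apply (deriv_neq0 H H_holo H_inj), RHP_RtoC; lra).
  apply Cmod_gt_0 in Hn. set (y := tag k / (1 - tag k)).
  assert (Py : 0 < y) by (now apply tag_point_pos).
  assert (Hny : H1 y <> 0) by (now apply (deriv_neq0 H H_holo H_inj), RHP_RtoC).
  assert (Pny := proj1 (Cmod_gt_0 _) Hny).
  apply (Rmult_le_reg_r (Cmod (H1 x))); [exact Hn|].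
  replace (Re (phase k * H1 x) / Cmod (H1 x) * Cmod (H1 x)) with (Re (phase k * H1 x)) by (field; lra).
  set (w := rcayley (tag k) x).
  assert (Ew : w = (x - y) / (x + y)).
  { unfold w, rcayley, y. field. repeat split; try lra. nra. }
  assert (PB : 0 <= B) by nra.
  destruct (Rle_or_lt (Rabs w) v1) as [Hw|Hw].
  (* the tag is within the range where derivative_slow_sym applies *)
  - assert (S : 3 / 4 * (Cmod (H1 y) * Cmod (H1 x)) <= Re (Cconj (H1 y) * H1 x)).
    { apply (derivative_slow_sym H K K_pos H_holo H_inj H_var x y v1); auto; [lra|].
      rewrite Ew in Hw. unfold Rdiv in Hw. rewrite Rabs_mult, Rabs_inv, (Rabs_pos_eq (x + y)) in Hw by lra.
      apply (Rmult_le_compat_r (x + y)) in Hw; [|lra].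
      rewrite Rmult_assoc, Rinv_l, Rmult_1_r in Hw by lra. exact Hw. }
    assert (E : Re (phase k * H1 x) = / Cmod (H1 y) * Re (Cconj (H1 y) * H1 x)).
    { unfold phase. fold y. unfold conj_phase. rewrite <- Re_RtoC_mult. f_equal.
      rewrite RtoC_inv by lra. unfold Cdiv. ring. }
    rewrite E. apply Rle_trans with (3 / 4 * Cmod (H1 x)).
    + apply Rmult_le_compat_r; [lra|]. assert (0 <= B * (v * v)) by (apply Rmult_le_pos; [lra|apply Rle_0_sqr]). lra.
    + apply (Rmult_le_reg_l (Cmod (H1 y))); [exact Pny|].
      replace (Cmod (H1 y) * (/ Cmod (H1 y) * Re (Cconj (H1 y) * H1 x)))
        with (Re (Cconj (H1 y) * H1 x)) by (field; lra). lra.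
  (* by the mesh bound v and w differ by at most v1/2 *)
  - assert (Lw : Rabs (rcayley (node k) x - w) <= v1 / 4).
    { eapply Rle_trans; [apply (rcayley_lip _ _ x R0); lra|]. rewrite Rabs_left by lra.
      apply Rle_trans with (2 * R0 * / INR N); [apply Rmult_le_compat_l; lra|].
      apply (Rmult_le_reg_r (INR N)); [exact Np|]. rewrite Rmult_assoc, Rinv_l, Rmult_1_r by lra.
      apply (Rmult_le_compat_r (v1 / 4)) in N_large; [|lra].
      replace (8 * R0 / v1 * (v1 / 4)) with (2 * R0) in N_large by (field; lra). lra. }
    assert (Lv : Rabs (rcayley (node k) x - rcayley (node (S k)) x) <= v1 / 4).
    { eapply Rle_trans; [apply (rcayley_lip _ _ x R0); lra|]. rewrite Rabs_left by lra.
      replace (- (node k - node (S k))) with (/ INR N) by lra.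
      apply (Rmult_le_reg_r (INR N)); [exact Np|]. rewrite Rmult_assoc, Rinv_l, Rmult_1_r by lra.
      apply (Rmult_le_compat_r (v1 / 4)) in N_large; [|lra].
      replace (8 * R0 / v1 * (v1 / 4)) with (2 * R0) in N_large by (field; lra). lra. }
    apply Rabs_le_between in Lw. apply Rabs_le_between in Lv.
    assert (Vv : (v1 / 2) * (v1 / 2) <= v * v).
    { unfold Rabs in Hw. destruct (Rcase_abs w); nra. }
    assert (7 / 4 <= B * (v * v)).
    { apply Rle_trans with (B * (v1 / 2 * (v1 / 2))); [lra|]. now apply Rmult_le_compat_l. }
    apply Rle_trans with (-1 * Cmod (H1 x)); [apply Rmult_le_compat_r; lra|].
    pose proof (re_le_Cmod (phase k * H1 x)) as X.
    rewrite Cmod_mult, Cmod_phase, Rmult_1_l in X by exact Hk.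
    pose proof (Rle_abs (- Re (phase k * H1 x))) as X2. rewrite Rabs_Ropp in X2. lra.
Qed.

(** Summing [bump_compare] over the intervals of nodes telescopes to a combination of the
    total masses for n and n + 1, in which the 3/4 dominates once n is large against B. *)
Lemma multiplier_axis (x : R) : 1 <= x <= R0 ->
  bump_total n / 2 * Cmod (H1 x) <= Re (multiplier x * H1 x).
Proof.
  intros Hx. set (A := 3 / 4).
  set (L := fun v => (A - B) * rbump_int n v + B * rbump_int (S n) v).
  assert (Hn : H1 x <> 0) by (apply (deriv_neq0 H H_holo H_inj), RHP_RtoC; lra).
  apply Cmod_gt_0 in Hn.
  assert (E0 : node 0 = 0) by (unfold node; simpl; unfold Rdiv; ring).
  assert (EN : node N = 1) by (unfold node; field; pose proof N_INR_pos; lra).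
  apply Rle_trans with (Cmod (H1 x) * L (rcayley (node 0) x) - Cmod (H1 x) * L (rcayley (node N) x)).
  - rewrite E0, EN, rcayley_0, rcayley_1 by lra. unfold L.
    replace (Cmod (H1 x) * ((A - B) * rbump_int n 1 + B * rbump_int (S n) 1)
       - Cmod (H1 x) * ((A - B) * rbump_int n (-1) + B * rbump_int (S n) (-1)))
      with (((A - B) * bump_total n + B * bump_total (S n)) * Cmod (H1 x))
      by (unfold bump_total; ring).
    apply Rmult_le_compat_r; [lra|]. rewrite bump_total_S.
    pose proof (pos_INR n). pose proof (bump_total_pos n).
    replace ((A - B) * bump_total n + B * (bump_total n - bump_total n / (2 * INR n + 3)))
      with (bump_total n * (A - B / (2 * INR n + 3))) by (field; lra).
    unfold Rdiv at 1. apply Rmult_le_compat_l; [lra|].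
    assert (B / (2 * INR n + 3) <= / 4); [|unfold A; lra].
    apply (Rmult_le_reg_r (2 * INR n + 3)); [lra|].
    replace (B / (2 * INR n + 3) * (2 * INR n + 3)) with B by (field; lra). lra.
  - unfold multiplier.
    apply Re_csum_telescope with (g := fun k => Cmod (H1 x) * L (rcayley (node k) x)).
    intros k Hk. pose proof (node_range k ltac:(lia)) as N1. pose proof (node_range (S k) ltac:(lia)) as N2.
    destruct (node_tag k Hk) as [T1 [T2 _]].
    rewrite !cayley_RtoC by (auto; lra). rewrite !bump_int_RtoC, <- RtoC_minus.
    set (b := rcayley (node k) x). set (a := rcayley (node (S k)) x).
    replace (phase k * RtoC (rbump_int n b - rbump_int n a) * H1 x)%C
      with (RtoC (rbump_int n b - rbump_int n a) * (phase k * H1 x))%C by ring.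
    rewrite Re_RtoC_mult.
    pose proof (bump_compare n (Re (phase k * H1 x) / Cmod (H1 x)) A B a b) as Cmp.
    pose proof (rcayley_range (node k) x N1 ltac:(lra)). pose proof (rcayley_range (node (S k)) x N2 ltac:(lra)).
    pose proof (rcayley_decr (node k) (node (S k)) x N1 N2 ltac:(lra) ltac:(lra)).
    fold a b in H0, H2, H3.
    specialize (Cmp ltac:(lra) ltac:(lra) ltac:(lra)).
    specialize (Cmp (fun v Hv => phase_condition k x v Hk Hx Hv)).
    apply (Rmult_le_compat_l (Cmod (H1 x))) in Cmp; [|lra].
    unfold L.
    replace (Cmod (H1 x) * (Re (phase k * H1 x) / Cmod (H1 x) * (rbump_int n b - rbump_int n a)))
      with ((rbump_int n b - rbump_int n a) * Re (phase k * H1 x)) in Cmp by (field; lra).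
    lra.
Qed.
End Multiplier.

(** With G' = om H' and Re (om H') >= kappa |H'| on [1,R0], the function Phi = Re G/kappa
    increases at least as fast as H moves, and the variation bound controls its total
    increase. The constant M depends on K alone, which matters because H will be h
    composed with Moebius maps chosen according to the two points to be joined. *)
Lemma axis_variation (K : R) : 0 < K -> exists M, forall H,
  holo RHP H -> univalent_on RHP H -> variation_bound H K ->
  forall R0, 1 <= R0 -> exists Phi : R -> R,
    (forall a b, 1 <= a -> a <= b -> b <= R0 -> Cmod (H (RtoC b) - H (RtoC a)) <= Phi b - Phi a) /\
    Phi R0 - Phi 1 <= M * Cmod (H 1 - H (RtoC R0)).
Proof.
  intros HK. set (e := / (16 * (6912 * K + 2))).
  assert (He : 0 < e) by (apply Rinv_0_lt_compat; lra).
  set (v1 := e / (2 + e)). assert (Hv1 : 0 < v1) by (apply Rdiv_lt_0_compat; lra).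
  assert (Hv1e : v1 * (2 + e) <= e) by (right; unfold v1; field; lra).
  set (B := 7 / (v1 * v1)).
  assert (Hvv : 0 < v1 * v1) by (now apply Rmult_lt_0_compat).
  assert (HB : 7 <= B * (v1 * v1)) by (right; unfold B; field; lra).
  destruct (exists_INR_ge (4 * B)) as [n [_ Hn]]. pose proof (pos_INR n) as Pn.
  set (kappa := bump_total n / 2).
  assert (Hk : 0 < kappa) by (pose proof (bump_total_pos n); unfold kappa; lra).
  assert (Hc : 0 < 4 * 2 ^ n) by (pose proof (pow_lt 2 n); lra).
  exists (/ kappa * (4 * 2 ^ n * K)). intros H Hh Hi Hvar R0 HR.
  destruct (exists_INR_ge (8 * R0 / v1)) as [N [HN0 HN]].
  set (om := multiplier H n N).
  assert (Om1 : holo RHP om) by (now apply multiplier_holo).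
  assert (Om2 : forall z, RHP z -> Cmod (om z) <= 4 * 2 ^ n)
    by (intros z Hz; now apply Cmod_multiplier_le).
  assert (Om3 : forall x, 1 <= x <= R0 -> kappa * Cmod (C_derive H x) <= Re (om x * C_derive H x)).
  { intros x Hx. apply (multiplier_axis H K HK Hh Hi Hvar v1 B R0 n N); auto. lra. }
  clearbody om.
  destruct (holo_primitive RHP 1 (fun z => om z * C_derive H z)%C copen_RHP rect_star_RHP) as [G HG].
  { intros z Hz. destruct (Om1 z Hz) as [l1 L1]. destruct (deriv_holo H Hh z Hz) as [l2 L2].
    eexists. apply cdiff_mult; [exact L1|exact L2]. }
  exists (fun t => / kappa * Re (G (RtoC t))). split.
  - intros a b Ha Hab Hb. destruct Hab as [Hab| ->]; [|rewrite Cmod_sub_diag; lra].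
    destruct (exists_phase (H b - H a)) as [u [Hu Eu']].
    destruct (MVT_cor2 (fun s : R => / kappa * Re (1 * G (0 + s * 1)%C) - Re (u * H (0 + s * 1)%C))
       (fun s : R => / kappa * Re (1 * (om s * C_derive H s) * 1) - Re (u * C_derive H s * 1)) a b Hab)
        as [c [Ec Hcc]].
    + intros c Hcc. assert (Ec : (0 + c * 1)%C = RtoC c) by ring.
      assert (Uc : RHP c) by (apply RHP_RtoC; lra).
      apply derivable_pt_lim_minus.
      * apply derivable_pt_lim_scal. apply cdiff_line. rewrite Ec. now apply HG.
      * apply cdiff_line. rewrite Ec. now apply holo_C_derive with RHP.
    + cbv beta in Ec. replace (0 + b * 1)%C with (RtoC b) in Ec by ring.
      replace (0 + a * 1)%C with (RtoC a) in Ec by ring. rewrite !Cmult_1_l, !Cmult_1_r in Ec.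
      assert (Eu : Re (u * H b) - Re (u * H a) = Cmod (H b - H a)).
      { rewrite <- Re_minus. replace (u * H b - u * H a)%C with (u * (H b - H a))%C by ring.
        now rewrite Eu'. }
      assert (Pos : 0 <= (/ kappa * Re (om c * C_derive H c) - Re (u * C_derive H c)) * (b - a)).
      { apply Rmult_le_pos; [|lra].
        pose proof (Re_le_Cmod (u * C_derive H c)) as X. rewrite Cmod_mult in X.
        rewrite Hu, Rmult_1_l in X.
        pose proof (Om3 c ltac:(lra)) as Y.
        apply (Rmult_le_compat_l (/ kappa)) in Y; [|left; now apply Rinv_0_lt_compat].
        rewrite <- Rmult_assoc, Rinv_l, Rmult_1_l in Y by lra. lra. }
      lra.
  - assert (V : Cmod (/ RtoC (4 * 2 ^ n) * G 1 - / RtoC (4 * 2 ^ n) * G R0) <= K * Cmod (H 1 - H R0)).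
    { apply (Hvar (fun z => / RtoC (4 * 2 ^ n) * om z)%C (fun z => / RtoC (4 * 2 ^ n) * G z)%C).
      - intros z Hz. destruct (Om1 z Hz) as [l L]. eexists. apply cdiff_scal, L.
      - intros z Hz. rewrite Cmod_mult, Cmod_inv, Cmod_R, Rabs_pos_eq by (try apply RtoC_neq0; lra).
        apply (Rmult_le_reg_l (4 * 2 ^ n)); [exact Hc|].
        rewrite <- Rmult_assoc, Rinv_r, Rmult_1_l, Rmult_1_r by lra. now apply Om2.
      - intros z Hz. eapply cdiff_eq; [apply cdiff_scal; now apply HG|]. ring.
      - apply RHP_RtoC; lra.
      - apply RHP_RtoC; lra. }
    replace (/ RtoC (4 * 2 ^ n) * G 1 - / RtoC (4 * 2 ^ n) * G R0)%C
      with (/ RtoC (4 * 2 ^ n) * (G 1 - G R0))%C in V by ring.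
    rewrite Cmod_mult, Cmod_inv, Cmod_R, Rabs_pos_eq in V by (try apply RtoC_neq0; lra).
    rewrite <- Rmult_minus_distr_l, Rmult_assoc.
    apply Rmult_le_compat_l; [left; now apply Rinv_0_lt_compat|].
    apply Rle_trans with (Cmod (G 1 - G R0)).
    + rewrite Cmod_sub_sym. rewrite <- Re_minus. apply Re_le_Cmod.
    + apply (Rmult_le_compat_l (4 * 2 ^ n)) in V; [|lra].
      rewrite <- Rmult_assoc, Rinv_r, Rmult_1_l in V by lra. lra.
Qed.

(** * Moebius transfer between disk and half plane *)

Lemma copen_unit_disk : copen unit_disk.
Proof.
  intros z Hz. unfold unit_disk in *. exists (1 - Cmod z). split; [lra|]. intros w Hw.
  pose proof (Cmod_sub_ge w z). lra.
Qed.

Definition biholo (U V : C -> Prop) (f g : C -> C) : Prop :=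
  holo U f /\ holo V g /\ (forall z, U z -> V (f z) /\ g (f z) = z) /\
  (forall w, V w -> U (g w) /\ f (g w) = w).

Lemma holo_comp (U V : C -> Prop) (f g : C -> C) :
  holo U f -> holo V g -> (forall z, U z -> V (f z)) -> holo U (fun z => g (f z)).
Proof.
  intros Hf Hg Hm z Hz. destruct (Hf z Hz) as [l1 L1]. destruct (Hg _ (Hm z Hz)) as [l2 L2].
  eexists. apply (cdiff_comp g f); [exact L2|exact L1].
Qed.

Lemma biholo_comp (U V W : C -> Prop) (f g f' g' : C -> C) :
  biholo U V f g -> biholo V W f' g' -> biholo U W (fun z => f' (f z)) (fun w => g (g' w)).
Proof.
  intros [F1 [F2 [F3 F4]]] [G1 [G2 [G3 G4]]]. repeat split.
  - apply holo_comp with V; auto. intros z Hz. now apply F3.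
  - apply holo_comp with V; auto. intros z Hz. now apply G4.
  - now apply G3, F3.
  - destruct (F3 z H) as [A1 A2]. destruct (G3 _ A1) as [A3 A4]. now rewrite A4.
  - now apply F4, G4.
  - destruct (G4 w H) as [A1 A2]. destruct (F4 _ A1) as [A3 A4]. now rewrite A4.
Qed.

Lemma unit_disk_sq (z : C) : unit_disk z <-> Re z ^ 2 + Im z ^ 2 < 1.
Proof.
  unfold unit_disk. rewrite <- Cmod2_alt. pose proof (Cmod_ge_0 z). split; intros; nra.
Qed.

Lemma disk_aut_den (a z : C) : unit_disk a -> unit_disk z -> (1 - Cconj a * z)%C <> 0.
Proof.
  intros Ha Hz E. unfold unit_disk in *.
  assert (E2 : (Cconj a * z = 1)%C).
  { replace (Cconj a * z)%C with (1 - (1 - Cconj a * z))%C by ring. rewrite E. ring. }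
  apply (f_equal Cmod) in E2. rewrite Cmod_mult, Cmod_conj, Cmod_1 in E2.
  pose proof (Cmod_ge_0 a). pose proof (Cmod_ge_0 z). nra.
Qed.

Definition disk_aut (a z : C) : C := ((z - a) / (1 - Cconj a * z))%C.

Lemma disk_aut_disk (a z : C) : unit_disk a -> unit_disk z -> unit_disk (disk_aut a z).
Proof.
  intros Ha Hz. pose proof (disk_aut_den a z Ha Hz) as Hn. unfold unit_disk, disk_aut.
  rewrite Cmod_div by exact Hn. pose proof (proj1 (Cmod_gt_0 _) Hn) as Hp.
  apply (Rmult_lt_reg_r (Cmod (1 - Cconj a * z))); [exact Hp|].
  replace (Cmod (z - a) / Cmod (1 - Cconj a * z) * Cmod (1 - Cconj a * z)) with (Cmod (z - a)) by (field; lra).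
  rewrite Rmult_1_l. apply Rsqr_incrst_0; [|apply Cmod_ge_0|lra].
  rewrite !Rsqr_pow2, !Cmod2_alt. apply unit_disk_sq in Ha. apply unit_disk_sq in Hz.
  destruct a as [p q], z as [x y]. unfold Re, Im in *. simpl in *.
  assert (0 < (1 - (p * p + q * q)) * (1 - (x * x + y * y))) by (apply Rmult_lt_0_compat; lra).
  nra.
Qed.

Lemma unit_disk_opp (a : C) : unit_disk a -> unit_disk (- a)%C.
Proof. unfold unit_disk. now rewrite Cmod_opp. Qed.

Lemma disk_aut_inv (a z : C) : unit_disk a -> unit_disk z -> disk_aut (- a) (disk_aut a z) = z.
Proof.
  intros Ha Hz. pose proof (disk_aut_den a z Ha Hz) as H1. pose proof (disk_aut_den a a Ha Ha) as H2.
  pose proof (disk_aut_den _ _ (unit_disk_opp a Ha) (disk_aut_disk a z Ha Hz)) as H3.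
  unfold disk_aut in *. rewrite Copp_conj in *. field. split; [exact H1|].
  intros E. apply H3. transitivity ((1 - Cconj a * z + Cconj a * (z - a)) / (1 - Cconj a * z))%C;
    [field; exact H1|]. rewrite <- (Cmult_0_l (/ (1 - Cconj a * z))). unfold Cdiv. f_equal.
  rewrite <- E. ring.
Qed.

Lemma disk_aut_holo (a : C) : unit_disk a -> holo unit_disk (disk_aut a).
Proof.
  intros Ha z Hz. eexists. apply (cdiff_div (fun z => z - a)%C (fun z => 1 - Cconj a * z)%C).
  - now apply disk_aut_den.
  - apply cdiff_minus; [apply cdiff_id|apply cdiff_const].
  - apply cdiff_minus; [apply cdiff_const|apply cdiff_scal, cdiff_id].
Qed.

Lemma biholo_disk_aut (a : C) : unit_disk a ->
  biholo unit_disk unit_disk (disk_aut a) (disk_aut (- a)).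
Proof.
  intros Ha. pose proof (unit_disk_opp a Ha) as Ha'.
  split; [now apply disk_aut_holo|]. split; [now apply disk_aut_holo|]. split; intros z Hz.
  - split; [now apply disk_aut_disk|now apply disk_aut_inv].
  - split; [now apply disk_aut_disk|].
    pose proof (disk_aut_inv _ _ Ha' Hz) as E. now replace (- - a)%C with a in E by ring.
Qed.

Lemma biholo_rotation (u : C) : Cmod u = 1 ->
  biholo unit_disk unit_disk (fun z => u * z)%C (fun z => / u * z)%C.
Proof.
  intros Hu. assert (Hn : u <> 0) by (apply Cmod_gt_0; lra).
  split; [|split; [|split]]; intros z Hz.
  - eexists. apply cdiff_scal, cdiff_id.
  - eexists. apply cdiff_scal, cdiff_id.
  - split; [|field; exact Hn]. unfold unit_disk in *. now rewrite Cmod_mult, Hu, Rmult_1_l.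
  - split; [|field; exact Hn]. unfold unit_disk in *.
    now rewrite Cmod_mult, Cmod_inv, Hu, Rinv_1, Rmult_1_l.
Qed.

Lemma biholo_cayley : biholo unit_disk RHP (fun z => (1 + z) / (1 - z))%C (fun w => (w - 1) / (w + 1))%C.
Proof.
  assert (N1 : forall z, unit_disk z -> (1 - z)%C <> 0).
  { intros z Hz E. unfold unit_disk in Hz. replace z with (1 - (1 - z))%C in Hz by ring.
    rewrite E in Hz. replace (1 - 0)%C with (RtoC 1) in Hz by ring. rewrite Cmod_1 in Hz. lra. }
  assert (N2 : forall w, RHP w -> (w + 1)%C <> 0)
    by (intros w Hw; apply (RHP_add_neq0 w 1); [exact Hw|lra]).
  split; [|split; [|split]].
  - intros z Hz. eexists. apply (cdiff_div (fun z => 1 + z)%C (fun z => 1 - z)%C); [now apply N1|..].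
    + apply cdiff_plus; [apply cdiff_const|apply cdiff_id].
    + apply cdiff_minus; [apply cdiff_const|apply cdiff_id].
  - intros w Hw. eexists. apply (cdiff_div (fun w => w - 1)%C (fun w => w + 1)%C); [now apply N2|..].
    + apply cdiff_minus; [apply cdiff_id|apply cdiff_const].
    + apply cdiff_plus; [apply cdiff_id|apply cdiff_const].
  - intros z Hz. pose proof (N1 z Hz) as Hn.
    assert (R : RHP ((1 + z) / (1 - z))%C).
    { unfold RHP.
      assert (Pm : 0 < Cmod (1 - z)) by (now apply Cmod_gt_0).
      assert (E : ((1 + z) / (1 - z) = RtoC (/ Cmod (1 - z) ^ 2) * ((1 + z) * Cconj (1 - z)))%C).
      { assert (Hc : Cconj (1 - z) <> 0) by (apply Cmod_gt_0; rewrite Cmod_conj; exact Pm).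
        rewrite RtoC_inv by (apply pow_nonzero; lra). rewrite Cmod2_conj. field. now split. }
      rewrite E, Re_RtoC_mult. apply Rmult_lt_0_compat.
      - apply Rinv_0_lt_compat. now apply pow_lt.
      - apply unit_disk_sq in Hz. destruct z as [x y]. unfold Re, Im in *. simpl in *. nra. }
    split; [exact R|]. field. split; [exact Hn|].
    intros E. pose proof (N2 _ R) as N. apply N.
    transitivity ((1 + z + (1 - z)) / (1 - z))%C; [field; exact Hn|].
    rewrite <- (Cmult_0_l (/ (1 - z))). unfold Cdiv. f_equal. rewrite <- E. ring.
  - intros w Hw. pose proof (N2 w Hw) as Hn. pose proof (proj1 (Cmod_gt_0 _) Hn) as Hp. split.
    + unfold unit_disk. rewrite Cmod_div by exact Hn.
      apply (Rmult_lt_reg_r (Cmod (w + 1))); [exact Hp|].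
      replace (Cmod (w - 1) / Cmod (w + 1) * Cmod (w + 1)) with (Cmod (w - 1)) by (field; lra).
      rewrite Rmult_1_l. unfold Cmod. apply sqrt_lt_1_alt. unfold RHP, Re in Hw.
      destruct w as [x y]. cbn [fst snd Cminus Cplus Copp RtoC] in *. split; [|nra].
      apply Rplus_le_le_0_compat; apply pow2_ge_0.
    + field. split; [exact Hn|]. intros E.
      assert (E2 : RtoC 2 = 0) by (rewrite <- E; ring).
      apply (f_equal fst) in E2. simpl in E2. lra.
Qed.

(** An automorphism takes z1 to 0, a rotation moves the image of z2 to the interval [0,1),
    and the Cayley map sends 0 to 1 and [0,1) into the axis. *)
Lemma two_point_normalization (z1 z2 : C) : unit_disk z1 -> unit_disk z2 -> z1 <> z2 ->
  exists phi psi R0, biholo unit_disk RHP phi psi /\ 1 <= R0 /\ phi z1 = 1 /\ phi z2 = RtoC R0.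
Proof.
  intros U1 U2 Hn.
  set (w := disk_aut z1 z2). assert (Uw : unit_disk w) by (now apply disk_aut_disk).
  assert (Hw : w <> 0).
  { intros E. apply Hn. rewrite <- (disk_aut_inv z1 z2 U1 U2). fold w. rewrite E.
    unfold disk_aut. field. }
  assert (Hu : Cmod (conj_phase w) = 1) by (now apply Cmod_conj_phase).
  pose proof (biholo_comp _ _ _ _ _ _ _ (biholo_comp _ _ _ _ _ _ _ (biholo_disk_aut z1 U1)
    (biholo_rotation (conj_phase w) Hu)) biholo_cayley) as Hb. cbv beta in Hb.
  unfold unit_disk in Uw. pose proof (Cmod_ge_0 w) as Pw.
  eexists. eexists. exists ((1 + Cmod w) / (1 - Cmod w)). split; [exact Hb|]. split; [|split].
  - apply (Rmult_le_reg_r (1 - Cmod w)); [lra|].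
    replace ((1 + Cmod w) / (1 - Cmod w) * (1 - Cmod w)) with (1 + Cmod w) by (field; lra). lra.
  - cbv beta. unfold disk_aut. replace (z1 - z1)%C with (RtoC 0) by ring.
    unfold Cdiv. rewrite !Cmult_0_l, Cmult_0_r. field.
  - cbv beta. fold w. rewrite conj_phase_mult by exact Hw.
    rewrite RtoC_div by lra. now rewrite RtoC_plus, RtoC_minus.
Qed.

(** If |G(a) - G(b)| > (1/c) |H(a) - H(b)|, then some lam with |lam| < c solves
    H(a) + conj (lam G(a)) = H(b) + conj (lam G(b)); the function g = lam G o phi has
    dilatation lam omega o phi, so the hypothesis forbids this. *)
Lemma variation_of_univalence (h phi psi : C -> C) (c : R) : 0 < c ->
  holo unit_disk h -> univalent_on unit_disk h -> biholo unit_disk RHP phi psi ->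
  (forall g, holo unit_disk g -> (forall z, unit_disk z -> Cmod (dilatation h g z) < c) ->
     univalent_on unit_disk (harmonic_mapping h g)) ->
  variation_bound (fun w => h (psi w)) (/ c).
Proof.
  intros Hc Hh Hi [B1 [B2 [B3 B4]]] Huniv omega G Ho Hb HG a b Ha Hb'.
  set (H := fun w => h (psi w)) in *.
  assert (HH : holo RHP H) 
    by exact (holo_comp RHP unit_disk psi h B2 Hh (fun z Hz => proj1 (B4 z Hz))).
  change (Cmod (G a - G b) <= / c * Cmod (H a - H b)).
  apply Rnot_lt_le. intros Hlt.
  set (dG := (G a - G b)%C) in *. set (dH := (H a - H b)%C) in *.
  assert (PH : 0 <= Cmod dH) by apply Cmod_ge_0.
  assert (Pc : 0 < / c) by now apply Rinv_0_lt_compat.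
  assert (PG : 0 < Cmod dG)
    by (eapply Rle_lt_trans; [|exact Hlt]; apply Rmult_le_pos; lra).
  assert (NG : dG <> 0) by (now apply Cmod_gt_0).
  (* conj lam * conj dG = - dH *)
  set (lam := (- Cconj (dH) / dG)%C).
  assert (Hlam : Cmod lam < c).
  { unfold lam. rewrite Cmod_div, Cmod_opp, Cmod_conj by exact NG.
    apply (Rmult_lt_reg_r (Cmod dG)); [exact PG|].
    replace (Cmod dH / Cmod dG * Cmod dG) with (Cmod dH) by (field; lra).
    apply (Rmult_lt_compat_l c) in Hlt; [|exact Hc].
    rewrite <- Rmult_assoc, Rinv_r, Rmult_1_l in Hlt by lra. exact Hlt. }
  assert (E : a = b).
  { assert (Epsi : psi a = psi b).
    { apply (Huniv (fun z => lam * G (phi z))%C).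
      - intros z Hz. destruct (B1 z Hz) as [l L]. eexists. apply cdiff_scal.
        apply (cdiff_comp G phi); [apply HG; now apply B3|exact L].
      - intros z Hz. destruct (B1 z Hz) as [l L]. destruct (B3 z Hz) as [V _].
        assert (Eg : C_derive (fun z => lam * G (phi z))%C z = (lam * (omega (phi z) * C_derive H (phi z) * l))%C).
        { apply cdiff_C_derive. apply cdiff_scal. apply (cdiff_comp G phi); [now apply HG|exact L]. }
        assert (Eh : C_derive h z = (C_derive H (phi z) * l)%C).
        { apply (cdiff_unique_loc unit_disk h (fun z => H (phi z)) z); auto using copen_unit_disk.
          - intros y Hy. unfold H. now rewrite (proj2 (B3 y Hy)).
          - now apply holo_C_derive with unit_disk.
          - apply (cdiff_comp H phi); [now apply holo_C_derive with RHP|exact L]. }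
        pose proof (univalent_derive_neq0 unit_disk h copen_unit_disk Hh Hi z Hz) as Nh.
        unfold dilatation. rewrite Eg.
        replace (lam * (omega (phi z) * C_derive H (phi z) * l))%C
          with (lam * omega (phi z) * C_derive h z)%C by (rewrite Eh; ring).
        replace (lam * omega (phi z) * C_derive h z / C_derive h z)%C with (lam * omega (phi z))%C
          by (field; exact Nh).
        rewrite Cmod_mult. pose proof (Hb _ V). pose proof (Cmod_ge_0 lam).
        pose proof (Cmod_ge_0 (omega (phi z))). nra.
      - now apply B4.
      - now apply B4.
      - unfold harmonic_mapping. rewrite (proj2 (B4 a Ha)), (proj2 (B4 b Hb')).
        change (h (psi a)) with (H a). change (h (psi b)) with (H b).
        assert (EE : (Cconj (lam * G a) - Cconj (lam * G b) = - dH)%C).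
        { rewrite <- Cminus_conj. replace (lam * G a - lam * G b)%C with (lam * dG)%C by (unfold dG; ring).
          unfold lam. replace (- Cconj dH / dG * dG)%C with (- Cconj dH)%C by (field; exact NG).
          now rewrite Copp_conj, Cconj_conj. }
        transitivity (H a + (Cconj (lam * G a) - Cconj (lam * G b)) + Cconj (lam * G b))%C; [ring|].
        rewrite EE. unfold dH. ring. }
    rewrite <- (proj2 (B4 a Ha)), <- (proj2 (B4 b Hb')). now rewrite Epsi. }
  apply NG. unfold dG. rewrite E. ring.
Qed.

(** * From univalent harmonic mappings to short paths *)

Lemma unit_disk_convex (z1 z2 : C) (t : R) : unit_disk z1 -> unit_disk z2 -> 0 <= t <= 1 ->
  unit_disk (z1 + t * (z2 - z1))%C.
Proof.
  unfold unit_disk. intros H1 H2 Ht.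
  replace (z1 + t * (z2 - z1))%C with (RtoC (1 - t) * z1 + t * z2)%C by (rewrite RtoC_minus; ring).
  eapply Rle_lt_trans; [apply Cmod_triangle|]. rewrite !Cmod_RtoC_mult by lra.
  destruct (Req_dec t 0) as [->|Hn]; nra.
Qed.

Lemma open_copen_at (U : C -> Prop) (w : C) : open U -> U w ->
  exists e, 0 < e /\ forall y, Cmod (y - w) < e -> U y.
Proof.
  intros Ho Hw. destruct (Ho w Hw) as [e He]. exists e. split; [apply cond_pos|].
  intros y Hy. apply He. split; (eapply Rle_lt_trans; [|exact Hy]).
  - exact (re_le_Cmod (y - w)).
  - exact (Rabs_Im_le_Cmod (y - w)).
Qed.

Lemma copen_open (U : C -> Prop) : copen U -> open U.
Proof.
  intros H w Hw. destruct (H w Hw) as [e [He H1]].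
  assert (He2 : 0 < e / 2) by lra. exists (mkposreal _ He2). intros y [B1 B2]. apply H1.
  change (Rabs (fst y - fst w) < e / 2) in B1. change (Rabs (snd y - snd w) < e / 2) in B2.
  destruct y as [y1 y2], w as [w1 w2]. rewrite Cpair_minus.
  eapply Rle_lt_trans; [apply Cmod_pair_le|]. simpl in *. lra.
Qed.

Lemma path_connected (gamma : R -> C) (U V : C -> Prop) :
  (forall s e, unit_interval s -> 0 < e -> exists eta, 0 < eta /\
    forall t, unit_interval t -> Rabs (t - s) < eta -> Cmod (gamma t - gamma s) < e) ->
  open U -> open V -> (forall t, unit_interval t -> U (gamma t) \/ V (gamma t)) ->
  U (gamma 0) -> V (gamma 1) -> exists t, unit_interval t /\ U (gamma t) /\ V (gamma t).
Proof.
  intros Hc HU HV Hcov H0 H1. apply NNPP. intros HN.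
  assert (Stay : forall W s, open W -> unit_interval s -> W (gamma s) -> exists eta, 0 < eta /\
    forall t, unit_interval t -> Rabs (t - s) < eta -> W (gamma t)).
  { intros W s HW Hs Ws. destruct (open_copen_at W _ HW Ws) as [e [He He1]].
    destruct (Hc s e Hs He) as [eta [Heta Heta1]]. exists eta. split; [exact Heta|].
    intros t Ht Hts. apply He1. now apply Heta1. }
  assert (I0 : unit_interval 0) by (unfold unit_interval; lra).
  assert (I1 : unit_interval 1) by (unfold unit_interval; lra).
  set (E := fun t => unit_interval t /\ forall s, 0 <= s <= t -> U (gamma s)).
  assert (E0 : E 0).
  { split; [exact I0|]. intros s Hs. replace s with 0 by lra. exact H0. }
  destruct (completeness E) as [s [L1 L2]].
  - exists 1. intros t [[_ Ht] _]. exact Ht.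
  - now exists 0.
  - assert (Is : unit_interval s).
    { split; [now apply L1|]. apply L2. intros t [[_ Ht] _]. exact Ht. }
    assert (App : forall eta, 0 < eta -> exists t, E t /\ s - eta < t <= s).
    { intros eta Heta. apply NNPP. intros HM.
      assert (s <= s - eta); [|lra]. apply L2. intros t Et. apply Rnot_lt_le. intros Hlt.
      apply HM. exists t. split; [exact Et|]. split; [exact Hlt|now apply L1]. }
    destruct (Hcov s Is) as [Us|Vs].
    + destruct (Stay U s HU Is Us) as [eta [Heta Hst]].
      destruct (App eta Heta) as [t [[It Et] Ht]].
      set (s' := Rmin 1 (s + eta / 2)).
      assert (Hs1 : s' <= 1) by apply Rmin_l. assert (Hs2 : s' <= s + eta / 2) by apply Rmin_r.
      assert (Es' : E s').
      { destruct Is as [Is0 Is1].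
        assert (Hs0 : s <= s') by (unfold s'; apply Rmin_glb; lra).
        split; [split; lra|]. intros r Hr. destruct (Rle_or_lt r t) as [Hrt|Hrt].
        - apply Et. lra.
        - apply Hst; [split; lra|]. apply Rabs_def1; lra. }
      pose proof (L1 s' Es') as Hle. unfold s', Rmin in Hle.
      destruct (Rle_dec 1 (s + eta / 2)).
      * assert (s = 1) as -> by (destruct Is; lra). apply HN. exists 1. auto.
      * lra.
    + destruct (Stay V s HV Is Vs) as [eta [Heta Hst]].
      destruct (App eta Heta) as [t [[It Et] Ht]].
      apply HN. exists t. split; [exact It|]. split.
      * apply Et. destruct It. lra.
      * apply Hst; [exact It|]. apply Rabs_def1; lra.
Qed.

Lemma ccont_along (h : C -> C) (zeta : R -> C) (s L : R) :
  0 <= L -> ccont h (zeta s) ->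
  (forall t, unit_interval t -> Cmod (zeta t - zeta s) <= L * Rabs (t - s)) ->
  forall e, 0 < e -> exists eta, 0 < eta /\
    forall t, unit_interval t -> Rabs (t - s) < eta -> Cmod (h (zeta t) - h (zeta s)) < e.
Proof.
  intros HL Hh Hz e He. destruct (Hh e He) as [d [Hd Hd1]].
  exists (d / (L + 1)). split; [apply Rdiv_lt_0_compat; lra|]. intros t It Ht. apply Hd1.
  eapply Rle_lt_trans; [now apply Hz|].
  apply (Rmult_lt_compat_r (L + 1)) in Ht; [|lra].
  replace (d / (L + 1) * (L + 1)) with d in Ht by (field; lra).
  pose proof (Rabs_pos (t - s)). nra.
Qed.

Lemma univalent_image_domain (h : C -> C) : holo unit_disk h -> univalent_on unit_disk h ->
  Defs.domain (image unit_disk h).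
Proof.
  intros Hh Hi. split; [|split].
  - apply copen_open. intros w [z [Uz <-]].
    destruct (univalent_inverse_continuous unit_disk h copen_unit_disk Hh Hi z 1 Uz Rlt_0_1)
      as [d [Hd H]].
    exists d. split; [exact Hd|]. intros w Hw. destruct (H w Hw) as [y [Uy [_ Ey]]]. now exists y.
  - exists (h 0), 0. split; [|reflexivity]. unfold unit_disk. rewrite Cmod_0. lra.
  - intros U V HU HV Hcov [w1 [[z1 [D1 <-]] U1]] [w2 [[z2 [D2 <-]] V2]].
    set (zeta := fun t : R => (z1 + t * (z2 - z1))%C).
    assert (Dz : forall t, unit_interval t -> unit_disk (zeta t))
      by (intros t Ht; now apply unit_disk_convex).
    destruct (path_connected (fun t => h (zeta t)) U V) as [t [It [Ut Vt]]]; auto.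
    + intros s e Is He. apply (ccont_along h zeta s (Cmod (z2 - z1))); auto.
      * apply Cmod_ge_0.
      * apply holo_ccont with unit_disk; auto.
      * intros t It. right. unfold zeta.
        replace (z1 + t * (z2 - z1) - (z1 + s * (z2 - z1)))%C with (RtoC (t - s) * (z2 - z1))%C
          by (rewrite RtoC_minus; ring).
        rewrite Cmod_mult, Cmod_R. ring.
    + intros t It. apply Hcov. exists (zeta t). auto.
    + unfold zeta. now replace (z1 + RtoC 0 * (z2 - z1))%C with z1 by ring.
    + unfold zeta. now replace (z1 + RtoC 1 * (z2 - z1))%C with z2 by ring.
    + exists (h (zeta t)). split; [|now split]. exists (zeta t). auto.
Qed.

Lemma sum_n_telescope_le (f : nat -> R) (g : nat -> R) (n : nat) :
  (forall i, (i <= n)%nat -> f i <= g (S i) - g i) -> sum_n f n <= g (S n) - g 0%nat.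
Proof.
  induction n as [|n IH]; intros H.
  - rewrite sum_O. apply H. lia.
  - rewrite sum_Sn. unfold plus. simpl. pose proof (H (S n) ltac:(lia)).
    assert (sum_n f n <= g (S n) - g 0%nat) by (apply IH; intros; apply H; lia). lra.
Qed.

Lemma path_length_le (gamma : R -> C) (Phi : R -> R) :
  (forall s t, 0 <= s -> s <= t -> t <= 1 -> Cmod (gamma t - gamma s) <= Phi t - Phi s) ->
  Rbar_le (path_length gamma) (Finite (Phi 1 - Phi 0)).
Proof.
  intros H. apply Lub_Rbar_correct. intros l [n [t [T0 [T1 [T2 ->]]]]].
  assert (Mono : forall i, (i <= S n)%nat -> 0 <= t i).
  { induction i as [|i IH]; intros Hi; [rewrite T0; lra|]. pose proof (T2 i ltac:(lia)).
    specialize (IH ltac:(lia)). lra. }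
  assert (Mono' : forall k, (k <= S n)%nat -> t (S n - k)%nat <= 1).
  { induction k as [|k IH]; intros Hk; [rewrite Nat.sub_0_r, T1; lra|].
    pose proof (T2 (S n - S k)%nat ltac:(lia)) as T.
    replace (S (S n - S k)) with (S n - k)%nat in T by lia. specialize (IH ltac:(lia)). lra. }
  assert (Top : forall i, (i <= S n)%nat -> t i <= 1).
  { intros i Hi. replace i with (S n - (S n - i))%nat by lia. apply Mono'. lia. }
  simpl. rewrite <- T0, <- T1.
  apply (sum_n_telescope_le _ (fun i => Phi (t i))). intros i Hi.
  apply H; [apply Mono; lia|now apply T2|apply Top; lia].
Qed.

(** The path is the image of the hyperbolic geodesic between the two preimages,
    parametrized by the segment [1,R0] of the half plane. *)
Lemma linearly_connected_of_variation (h : C -> C) (c : R) : 0 < c ->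
  holo unit_disk h -> univalent_on unit_disk h ->
  (forall g, holo unit_disk g -> (forall z, unit_disk z -> Cmod (dilatation h g z) < c) ->
     univalent_on unit_disk (harmonic_mapping h g)) ->
  exists M : R, forall w1 w2 : C, image unit_disk h w1 -> image unit_disk h w2 ->
    exists gamma : R -> C, path_in (image unit_disk h) gamma w1 w2 /\
      Rbar_le (path_length gamma) (Finite (M * Cmod (w1 - w2)%C)).
Proof.
  intros Hc Hh Hi Hg.
  destruct (axis_variation (/ c)) as [M HM]; [now apply Rinv_0_lt_compat|].
  exists M. intros w1 w2 [z1 [D1 <-]] [z2 [D2 <-]].
  destruct (classic (z1 = z2)) as [<-|Hn].
  { exists (fun _ => h z1). split; [split; [|split; [|split]]|].
    - intros t _. apply filterlim_const.
    - intros t _. now exists z1.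
    - reflexivity.
    - reflexivity.
    - replace (M * Cmod (h z1 - h z1)) with ((fun _ : R => 0) 1 - (fun _ : R => 0) 0)
        by (rewrite Cmod_sub_diag; ring).
      apply (path_length_le (fun _ => h z1) (fun _ => 0)). intros. rewrite Cmod_sub_diag. lra. }
  destruct (two_point_normalization z1 z2 D1 D2 Hn) as [phi [psi [R0 [Hb [HR [P1 P2]]]]]].
  pose proof (variation_of_univalence h phi psi c Hc Hh Hi Hb Hg) as Hvar.
  destruct Hb as [B1 [B2 [B3 B4]]].
  pose proof (holo_comp RHP unit_disk psi h B2 Hh (fun z Hz => proj1 (B4 z Hz))) as HH.
  assert (HI : univalent_on RHP (fun w => h (psi w))).
  { intros a b Ha Hb E. apply Hi in E; [|now apply B4..].
    rewrite <- (proj2 (B4 a Ha)), <- (proj2 (B4 b Hb)). now rewrite E. }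
  destruct (HM _ HH HI Hvar R0 HR) as [Phi [F1 F2]].
  assert (E1 : psi 1 = z1) by (rewrite <- P1; now apply B3).
  assert (E2 : psi (RtoC R0) = z2) by (rewrite <- P2; now apply B3).
  rewrite E1, E2 in F2.
  set (x := fun t => 1 + t * (R0 - 1)).
  set (gamma := fun t => h (psi (RtoC (x t)))).
  assert (Ux : forall t, unit_interval t -> RHP (RtoC (x t))).
  { intros t [T0 T1]. apply RHP_RtoC. unfold x. nra. }
  exists gamma. split; [split; [|split; [|split]]|].
  - intros s Is. apply filterlim_locally. intros eps.
    destruct (ccont_along (fun w => h (psi w)) (fun t => RtoC (x t)) s (R0 - 1)) with (e := eps : R)
      as [eta [Heta Hd]]; [lra| | |apply cond_pos|].
    + apply holo_ccont with RHP; auto.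
    + intros t It. right. rewrite <- RtoC_minus, Cmod_R.
      replace (x t - x s) with ((R0 - 1) * (t - s)) by (unfold x; ring).
      rewrite Rabs_mult, (Rabs_pos_eq (R0 - 1)); lra.
    + exists (mkposreal eta Heta). intros t Ht It.
      specialize (Hd t It Ht). split; (eapply Rle_lt_trans; [|exact Hd]).
      * exact (re_le_Cmod (gamma t - gamma s)).
      * exact (Rabs_Im_le_Cmod (gamma t - gamma s)).
  - intros t It. exists (psi (RtoC (x t))). split; [|reflexivity]. now apply B4, Ux.
  - unfold gamma, x. replace (1 + 0 * (R0 - 1)) with 1 by ring. now rewrite E1.
  - unfold gamma, x. replace (1 + 1 * (R0 - 1)) with R0 by ring. now rewrite E2.
  - apply Rbar_le_trans with (Finite (Phi (x 1) - Phi (x 0))).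
    + apply (path_length_le gamma (fun t => Phi (x t))). intros s t Hs Hst Ht.
      apply F1; unfold x; nra.
    + unfold x. replace (1 + 1 * (R0 - 1)) with R0 by ring.
      replace (1 + 0 * (R0 - 1)) with 1 by ring. exact F2.
Qed.

Theorem theorem1 (h : C -> C)
  (h_holo : holomorphic_on unit_disk h)
  (h_univ : univalent_on unit_disk h) :
  (exists c : R, 0 < c /\
     forall g : C -> C,
       holomorphic_on unit_disk g ->
       (forall z : C, unit_disk z -> Cmod (dilatation h g z) < c) ->
       univalent_on unit_disk (harmonic_mapping h g))
  <-> linearly_connected_domain (image unit_disk h).
Proof.
  apply holomorphic_on_holo in h_holo. split.
  - intros [c [Hc Hg]]. split; [now apply univalent_image_domain|].
    apply (linearly_connected_of_variation h c); auto.
    intros g Hg0. apply Hg. now apply holomorphic_on_holo.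
  - intros [_ [M HM]].
    destruct (harmonic_univalent_of_paths unit_disk h M copen_unit_disk h_holo h_univ HM)
      as [c [Hc Hg]].
    exists c. split; [exact Hc|]. intros g Hg0. apply Hg. now apply holomorphic_on_holo.
Qed.
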